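(* Let $\widetilde H\in\mathcal L\big(\bigoplus_{j=1}^3L^2(\Gamma_j^*;\mathbb C^2)\big)$ be a momentum space Hamiltonian for double-incommensurate twisted trilayer graphene (as in the context). For each $q\in\mathbb R^2$, the reciprocal Hamiltonian $\widehat H_q\in\mathcal L(\mathcal E_q\chi^a)$ satisfies the intertwining relation $$\big(\mathcal E_q\widetilde H\widetilde\psi\big)_{(G,j\alpha)}=\big(\widehat H_q\mathcal E_q\widetilde\psi\big)_{(G,j\alpha)}$$ for all $\widetilde\psi\in\chi^a$ and $(G,j\alpha)\in\Omega^*$. In particular, for all $((G,j\alpha),(G',k\beta))\in\Omega_j^*\times\Omega_k^*$, $$\big[\widehat H_q\big]^{(G,j\alpha)}_{(G',k\beta)}=\delta_k^j\,\delta_{G'}^{G}\,\widetilde h_{j\beta}^{j\alpha}\Big(q+\sum_{t\ne j}G_t\Big)+(1-\delta_k^j)\,\delta_{G_l'}^{G_l}\,T_{(G_j',\alpha)}^{(G_k,\beta)}\,\widehat h_{k\beta}^{j\alpha}(q+G_j'+G_k+G_l),$$ where, for $j\neq k$, $l$ is the third layer, and $$\widetilde h_{j\beta}^{j\alpha}(q)=\sum_{R\in\mathcal R_j}e^{-iq\cdot(R+\tau_{j\alpha}-\tau_{j\beta})}(h_{j\beta}^{j\alpha})_R,\qquad T_{(G_j',\alpha)}^{(G_k,\beta)}=c_j^*c_k^*e^{i(G_j'\cdot\tau_{j\alpha}-G_k\cdot\tau_{k\beta})}.$$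
   Context: Lattices. Let $a=1.42\sqrt3$, $A=\frac a2\begin{bmatrix}2&1\\0&\sqrt3\end{bmatrix}$, $B=2\pi A^{-T}$, and let $\mathfrak R_\theta$ be the counterclockwise rotation of $\mathbb R^2$ by $\theta$. For twist angles $\theta_1,\theta_2,\theta_3$ and $j\in\{1,2,3\}$ put $A_j=\mathfrak R_{\theta_j}A$, $B_j=\mathfrak R_{\theta_j}B$, $\mathcal R_j=A_j\mathbb Z^2$, $\mathcal R_j^*=B_j\mathbb Z^2$, $\Gamma_j^*=B_j[0,1)^2$, $c_j^*=\sqrt{|\Gamma_j^*|}$. Orbital indices: $\mathcal A_j=\{jA,jB\}$, $\mathcal A=\bigcup_j\mathcal A_j$, with shifts $\tau_{jA}=0$, $\tau_{jB}=\mathfrak R_{\theta_j}\frac a2(1,\tfrac{\sqrt3}{3})^T$. Double incommensurability (assumed): for both $(\mathcal R_j)_{j=1}^3$ and $(\mathcal R_j^* )_{j=1}^3$, for every $I\subset\{1,2,3\}$ and lattice vectors $v_j$ in the $j$th lattice, $\sum_{j\in I}v_j=0$ iff $v_j=0$ for all $j\in I$. Hoppings. Intralayer $h_{j\beta}^{j\alpha}:\mathcal R_j\to\mathbb C$ and, for $j\neq k$, continuous interlayer $h_{k\beta}^{j\alpha}:\mathbb R^2\to\mathbb C$, with $\widehat h(\xi)=\frac1{4\pi^2}\int_{\mathbb R^2}h(x)e^{-i\xi\cdot x}dx$. Standing assumptions: there are $\gamma_1,\gamma_2>0$ such that for $j\neq k$ and all orbitals $\sup_x|h_{k\beta}^{j\alpha}(x)|e^{\gamma_1\|x\|_2}+\sup_\xi|\widehat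 h_{k\beta}^{j\alpha}(\xi)|e^{\gamma_2\|\xi\|_2}<\infty$, and $\sup_{R\in\mathcal R_j}|(h_{j\beta}^{j\alpha})_R|e^{\gamma_1\|R\|_2}<\infty$; $(h_{j\beta}^{j\alpha})_R=\overline{(h_{j\alpha}^{j\beta})_{-R}}$ and $h_{k\beta}^{j\alpha}(x)=\overline{h_{j\alpha}^{k\beta}(-x)}$; $h_{3\beta}^{1\alpha}=h_{1\beta}^{3\alpha}=0$. Momentum space Hamiltonian. Elements $\widetilde\psi_j$ of $L^2(\Gamma_j^*;\mathbb C^2)$ are extended to $\mathbb R^2$ quasi-periodically: $\widetilde\psi_{j\alpha}(q+G)=e^{-iG\cdot\tau_{j\alpha}}\widetilde\psi_{j\alpha}(q)$, $G\in\mathcal R_j^*$. Then $$(\widetilde H\widetilde\psi)_{j\alpha}(q)=\sum_{j\beta\in\mathcal A_j}\widetilde h_{j\beta}^{j\alpha}(q)\widetilde\psi_{j\beta}(q)+\sum_{k\ne j}\sum_{k\beta\in\mathcal A_k}c_j^*c_k^*\sum_{G\in\mathcal R_j^*}e^{iG\cdot\tau_{j\alpha}}\widehat h_{k\beta}^{j\alpha}(q+G)\widetilde\psi_{k\beta}(q+G).$$ Unfolding. $\chi_j^a$ is the space of square-integrable functions $\Gamma_j^*\to\mathbb C^2$ whose quasi-periodic extension to $\mathbb R^2$ is (real) analytic; $\chi^a=\bigoplus_{j=1}^3\chi_j^a$. $\kappa_j^*=\{G\in\bigoplus_{t=1}^3\mathcal R_t^*:G_j=0\}$, $\Omega_j^*=\kappa_j^*\times\mathcal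 A_j$, $\Omega^*=\bigsqcup_j\Omega_j^*$. $\mathcal E_{jq}:\chi_j^a\to\ell^\infty(\Omega_j^* )$, $(\mathcal E_{jq}\widetilde\psi_j)_{(G,j\alpha)}=\widetilde\psi_{j\alpha}(q+\sum_{t=1}^3G_t)$, and $\mathcal E_q=\bigoplus_{j=1}^3\mathcal E_{jq}$. $[\widehat H_q]^{(G,j\alpha)}_{(G',k\beta)}$ is the matrix entry with row $(G,j\alpha)$ and column $(G',k\beta)$: $(\widehat H_q\widehat\psi)_{(G,j\alpha)}=\sum_{(G',k\beta)}[\widehat H_q]^{(G,j\alpha)}_{(G',k\beta)}\widehat\psi_{(G',k\beta)}$. *)

(* Defs.v *)
From mathcomp Require Import all_boot all_order all_algebra.
From mathcomp Require Import all_classical all_reals all_analysis.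
From mathcomp Require Import complex.

Set Implicit Arguments.
Unset Strict Implicit.
Unset Printing Implicit Defensive.

Import Order.TTheory GRing.Theory Num.Theory numFieldNormedType.Exports.

Local Open Scope classical_set_scope.
Local Open Scope ring_scope.
Local Open Scope complex_scope.

(* Vectors of R^2 are column vectors 'cV[R]_2.  The layers 1, 2, 3 are the
   elements 0, 1, 2 of 'I_3, and the orbital index jA (resp. jB) is the pair of
   the layer j and the boolean false (resp. true). *)

Section Analysis.
Context {R : realType}.
Local Notation C := R[i].
Local Notation vec := 'cV[R]_2.

Definition dotv (u v : vec) : R := \sum_i u i 0 * v i 0.

(* `|u| on 'cV[R]_2 is the sup norm; the Euclidean one is needed here. *)
Definition norm2 (u : vec) : R := Num.sqrt (dotv u u).

(* e^{it} *)
Definition cis (t : R) : C := cos t +i* sin t.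

Definition cabs (z : C) : R := ComplexField.Normc.normc z.

(* Unordered sums of complex families.  They are meaningful for absolutely
   summable families (csum is a junk value otherwise). *)
Definition csummable (T : choiceType) (D : set T) (f : T -> C) : Prop :=
  (\esum_(x in D) (cabs (f x))%:E < +oo)%E.

Definition rsum (T : choiceType) (D : set T) (f : T -> R) : R :=
  fine (\esum_(x in D) (Num.max (f x) 0)%:E)
  - fine (\esum_(x in D) (Num.max (- f x) 0)%:E).

Definition csum (T : choiceType) (D : set T) (f : T -> C) : C :=
  rsum D (fun x => complex.Re (f x)) +i* rsum D (fun x => complex.Im (f x)).

Definition vec2 (x y : R) : vec := \col_(i < 2) (if i == ord0 then x else y).

(* Lebesgue measure on the plane, on the carrier R * R; functions and subsets
   of 'cV[R]_2 are transported along the coordinates. *)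
Definition leb2 := (@lebesgue_measure R \x @lebesgue_measure R)%E.

Definition coords (A : set vec) : set (R * R) := [set p | A (vec2 p.1 p.2)].

Definition area (A : set vec) : R := fine (leb2 (coords A)).

Definition cintegral (f : vec -> C) : C :=
  (\int[leb2]_(p in setT) complex.Re (f (vec2 p.1 p.2)))
  +i* (\int[leb2]_(p in setT) complex.Im (f (vec2 p.1 p.2))).

Definition fourier (h : vec -> C) (xi : vec) : C :=
  (1 / (4 * pi ^+ 2))%:C * cintegral (fun x => h x * cis (- dotv xi x)).

Definition square_integrable_on (A : set vec) (f : vec -> C) : Prop :=
  [/\ measurable_fun (coords A) (fun p => complex.Re (f (vec2 p.1 p.2))),
      measurable_fun (coords A) (fun p => complex.Im (f (vec2 p.1 p.2))) &
      leb2.-integrable (coords A)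
        (fun p => (cabs (f (vec2 p.1 p.2)) ^+ 2)%:E)].

(* Near every point, f is the sum of an absolutely convergent power series in
   the two real coordinates. *)
Definition real_analytic (f : vec -> C) : Prop :=
  forall x0 : vec, exists (r : R) (a : nat * nat -> C), 0 < r /\
    forall x : vec, (forall i, `|x i 0 - x0 i 0| < r) ->
      let term (mn : nat * nat) :=
        a mn * ((x ord0 0 - x0 ord0 0) ^+ mn.1 *
                (x ord_max 0 - x0 ord_max 0) ^+ mn.2)%:C in
      csummable setT term /\ f x = csum setT term.

Definition sup_norm (T : Type) (u : T -> C) : \bar R :=
  ereal_sup (range (fun w => (cabs (u w))%:E)).

Definition linf (T : Type) : set (T -> C) := [set u | (sup_norm u < +oo)%E].

(* L restricts to a bounded linear operator on the subspace V of l^oo(T). *)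
Definition bounded_linear_on (T : Type) (V : set (T -> C))
    (L : (T -> C) -> (T -> C)) : Prop :=
  [/\ forall u, V u -> V (L u),
      forall (a : C) u v, V u -> V v ->
        forall w, L (fun w' => a * u w' + v w') w = a * L u w + L v w &
      exists K : R, forall u, V u -> (sup_norm (L u) <= K%:E * sup_norm u)%E].

(* M is a matrix of L on V, the defining row sums being absolutely convergent. *)
Definition matrix_of_on (T : choiceType) (V : set (T -> C))
    (L : (T -> C) -> (T -> C)) (M : T -> T -> C) : Prop :=
  forall u, V u -> forall w,
    csummable setT (fun w' => M w w' * u w') /\
    L u w = csum setT (fun w' => M w w' * u w').

End Analysis.

Section Lattices.
Context {R : realType}.
Local Notation vec := 'cV[R]_2.

Definition lattice_const : R := 142%:R / 100%:R * Num.sqrt 3%:R.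

Definition rotation (t : R) : 'M[R]_2 :=
  \matrix_(i < 2, j < 2)
    if i == j then cos t else if i == ord0 then - sin t else sin t.

Definition untwisted_basis : 'M[R]_2 :=
  (lattice_const / 2%:R) *:
    row_mx (vec2 2%:R 0) (vec2 1 (Num.sqrt 3%:R)).

Definition untwisted_dual_basis : 'M[R]_2 :=
  (2%:R * pi) *: (invmx untwisted_basis)^T.

Definition lattice_of (M : 'M[R]_2) : set vec :=
  [set M *m map_mx intr n | n in [set: 'cV[int]_2]].

Variable theta : 'I_3 -> R.

Definition lat (j : 'I_3) : set vec :=
  lattice_of (rotation (theta j) *m untwisted_basis).

Definition dual_basis (j : 'I_3) : 'M[R]_2 :=
  rotation (theta j) *m untwisted_dual_basis.

Definition dual_lat (j : 'I_3) : set vec := lattice_of (dual_basis j).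

Definition dual_cell (j : 'I_3) : set vec :=
  [set dual_basis j *m t | t in [set t : vec | forall i, 0 <= t i 0 < 1]].

Definition cstar (j : 'I_3) : R := Num.sqrt (area (dual_cell j)).

Definition orb_shift (j : 'I_3) (a : bool) : vec :=
  if a then rotation (theta j) *m
              ((lattice_const / 2%:R) *: vec2 1 (Num.sqrt 3%:R / 3%:R))
  else 0.

Definition incommensurate (L : 'I_3 -> set vec) : Prop :=
  forall (I : {set 'I_3}) (v : 'I_3 -> vec), (forall j, j \in I -> L j (v j)) ->
    (\sum_(j in I) v j = 0 <-> forall j, j \in I -> v j = 0).

Definition double_incommensurate : Prop :=
  incommensurate lat /\ incommensurate dual_lat.

End Lattices.

Section Hamiltonian.
Context {R : realType}.
Local Notation C := R[i].
Local Notation vec := 'cV[R]_2.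
Variable theta : 'I_3 -> R.

(* hin j a b r stands for the intralayer hopping (h_{jb}^{ja})_r, which is only
   used for r in the lattice of layer j; hout j k a b x stands for the
   interlayer hopping h_{kb}^{ja}(x), which is only used for j != k. *)
Variable hin : 'I_3 -> bool -> bool -> vec -> C.
Variable hout : 'I_3 -> 'I_3 -> bool -> bool -> vec -> C.

Definition hoppings_continuous : Prop :=
  forall j k a b, j != k ->
    continuous (fun x : vec => complex.Re (hout j k a b x)) /\
    continuous (fun x : vec => complex.Im (hout j k a b x)).

Definition hoppings_decay : Prop :=
  exists g1 g2 : R, [/\ 0 < g1, 0 < g2,
    forall j k a b, j != k ->
      (ereal_sup (range (fun x : vec =>
         (cabs (hout j k a b x) * expR (g1 * norm2 x))%:E))
       + ereal_sup (range (fun xi : vec =>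
         (cabs (fourier (hout j k a b) xi) * expR (g2 * norm2 xi))%:E))
       < +oo)%E &
    forall j a b,
      (ereal_sup [set (cabs (hin j a b r) * expR (g1 * norm2 r))%:E
                 | r in lat theta j] < +oo)%E].

Definition hoppings_symmetric : Prop :=
  (forall j a b r, lat theta j r -> hin j a b r = conjc (hin j b a (- r))) /\
  (forall j k a b x, j != k -> hout j k a b x = conjc (hout k j b a (- x))).

Definition no_outer_hopping : Prop :=
  forall a b x, hout ord0 ord_max a b x = 0 /\ hout ord_max ord0 a b x = 0.

Definition bloch (j : 'I_3) (a b : bool) (q : vec) : C :=
  csum (lat theta j)
    (fun r => cis (- dotv q (r + orb_shift theta j a - orb_shift theta j b))
              * hin j a b r).

(* Wave functions of layer j are represented by their two components extended
   quasi-periodically from the cell to R^2. *)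
Definition quasi_periodic (j : 'I_3) (phi : bool -> vec -> C) : Prop :=
  forall a q G, dual_lat theta j G ->
    phi a (q + G) = cis (- dotv G (orb_shift theta j a)) * phi a q.

Definition chi_layer (j : 'I_3) : set (bool -> vec -> C) :=
  [set phi | [/\ quasi_periodic j phi,
    forall a, square_integrable_on (dual_cell theta j) (phi a) &
    forall a, real_analytic (phi a)]].

Definition chi : set ('I_3 -> bool -> vec -> C) :=
  [set psi | forall j, chi_layer j (psi j)].

(* The formula is evaluated at every q in R^2, not only on the cell: on
   quasi-periodic psi it is again quasi-periodic, so that this is the extension
   of the values on the cell.  On chi it selects the analytic representative of
   the L^2 class. *)
Definition mom_ham (psi : 'I_3 -> bool -> vec -> C) :
    'I_3 -> bool -> vec -> C := fun j a q =>
  \sum_(b : bool) bloch j a b q * psi j b q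
  + \sum_(k : 'I_3 | k != j) \sum_(b : bool)
      (cstar theta j * cstar theta k)%:C *
      csum (dual_lat theta j)
        (fun G => cis (dotv G (orb_shift theta j a))
                  * fourier (hout j k a b) (q + G) * psi k b (q + G)).

(* Omega^*: triples (j, G, a) with G a family of dual lattice vectors such that
   G_j = 0; the layer j records the summand of the disjoint union. *)
Definition Omega : set ('I_3 * {ffun 'I_3 -> vec} * bool) :=
  [set w : 'I_3 * {ffun 'I_3 -> vec} * bool |
    (forall t, dual_lat theta t (w.1.2 t)) /\ w.1.2 w.1.1 = 0].

Definition layer (w : Omega) : 'I_3 := (val w).1.1.
Definition momentum (w : Omega) : {ffun 'I_3 -> vec} := (val w).1.2.
Definition orbital (w : Omega) : bool := (val w).2.

Definition unfolding (q : vec) (psi : 'I_3 -> bool -> vec -> C) : Omega -> C :=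
  fun w => psi (layer w) (orbital w) (q + \sum_t momentum w t).

Definition unfolded_space (q : vec) : set (Omega -> C) := unfolding q @` chi.

(* The remaining layer, for j != k. *)
Definition third (j k : 'I_3) : 'I_3 :=
  odflt j [pick l | (l != j) && (l != k)].

(* The matrix entry with row w = (G, ja) and column w' = (G', kb). *)
Definition reciprocal_entry (q : vec) (w w' : Omega) : C :=
  let j := layer w in let G := momentum w in let a := orbital w in
  let k := layer w' in let G' := momentum w' in let b := orbital w' in
  let l := third j k in
  let T := (cstar theta j * cstar theta k)%:C
           * cis (dotv (G' j) (orb_shift theta j a)
                  - dotv (G k) (orb_shift theta k b)) in
  (k == j)%:R * (G' == G)%:R * bloch j a b (q + \sum_(t | t != j) G t)
  + (k != j)%:R * (G' l == G l)%:R * T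
    * fourier (hout j k a b) (q + G' j + G k + G l).

End Hamiltonian.

Arguments unfolding {R} theta q psi w.
Arguments unfolded_space {R} theta q _.
Arguments reciprocal_entry {R} theta hin hout q w w'.

(* Main.v *)
Require Import Defs.
From mathcomp Require Import all_boot all_order all_algebra.
From mathcomp Require Import all_classical all_reals all_analysis.
From mathcomp Require Import complex.
From mathcomp Require Import measurable_realfun ring lra zify.

Set Implicit Arguments.
Unset Strict Implicit.
Unset Printing Implicit Defensive.

Import Order.TTheory GRing.Theory Num.Theory numFieldNormedType.Exports.

Local Open Scope classical_set_scope.
Local Open Scope ring_scope.

(* The intertwining relation and the matrix entries come from regrouping the absolutely
   convergent sum defining the momentum space Hamiltonian: for a row in layer j, the columns
   of layer k <> j in its support are indexed by the dual lattice of layer j, and moving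
   G_k out of the argument of psi_k by quasi-periodicity produces the phase T.

   That the Hamiltonian preserves chi requires the analyticity of
   sum_G \hat h(q + G) psi(q + G).  Power series are measured by the weighted coefficient
   norm at a fixed radius.  By compactness of the cell, psi has the same radius and bound
   at every point.  Exponential decay of h makes the norms of \hat h at all centers bounded,
   and their decay in the center follows from the decay of the values of \hat h on the real
   plane by polynomial interpolation, so that the norms are summable over the lattice.

   The matrix is unique because, by incommensurability, the points q + sum_t G_t of a layer
   are pairwise distinct modulo its dual lattice: tested against the plane waves in chi, an
   absolutely summable row that annihilates chi is an atomic measure on a torus with
   vanishing Fourier coefficients. *)

(** * Absolutely summable families *)

(** The hard point is that the operator maps the unfolded space to itself: the interlayer sum must
    be analytic, and decay of the values of [fourier] does not by itself control its derivatives.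
    Interpolating with degree [N] loses a factor exponential in [N], while the truncation error is
    geometric in [N]. So [N] grows in proportion to the distance of the center from the origin, with
    a slope small enough that the loss consumes only half of the decay; the truncation error then
    also becomes exponentially small in that distance. The operator is defined by its rows. Their
    absolute sums are bounded uniformly, which gives the bound on l^oo and justifies each regrouping
    by absolute convergence. For uniqueness, each plane wave lives on one layer and one orbital, so
    a row splits into one atomic measure per component. An atom is isolated by powers of (1 +
    e^{-i(x - x0).r})/2: they have modulus at most 1, equal 1 at the atom x0, and become small at
    another point for a suitable [r]. Multiplying by them only mixes Fourier coefficients, so their
    vanishing is preserved. *)

Section ComplexModulus.
Local Open Scope complex_scope.
Context {R : realType}.
Implicit Types z w : R[i].

Lemma cabsM z w : cabs (z * w) = cabs z * cabs w.
Proof. exact: ComplexField.Normc.normcM. Qed.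

Lemma cabs_norm z : (cabs z)%:C = `|z|.
Proof. by []. Qed.

Lemma cabs_ge0 z : 0 <= cabs z.
Proof. by case: z => a b; exact: sqrtr_ge0. Qed.

Lemma cabsD z w : cabs (z + w) <= cabs z + cabs w.
Proof. by rewrite -lecR rmorphD /= !cabs_norm ler_normD. Qed.

Lemma cabsN z : cabs (- z) = cabs z.
Proof. by apply: complexI; rewrite !cabs_norm normrN. Qed.

Lemma cabsB z w : cabs (z - w) <= cabs z + cabs w.
Proof. by rewrite -(cabsN w) cabsD. Qed.

Lemma cabs0 : cabs (0 : R[i]) = 0.
Proof. exact: ComplexField.Normc.normc0. Qed.

Lemma cabs1 : cabs (1 : R[i]) = 1.
Proof. exact: ComplexField.Normc.normc1. Qed.

Lemma cabsX z n : cabs (z ^+ n) = cabs z ^+ n.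
Proof. by elim: n => [|n ih]; rewrite ?expr0 ?cabs1// !exprS cabsM ih. Qed.

Lemma cabs_eq0 z : cabs z = 0 -> z = 0.
Proof. exact: ComplexField.Normc.eq0_normc. Qed.

Lemma cabsV z : cabs z^-1 = (cabs z)^-1.
Proof. exact: ComplexField.Normc.normcV. Qed.

Lemma cabs_real (r : R) : cabs r%:C = `|r|.
Proof. by rewrite /cabs /= expr0n addr0 sqrtr_sqr. Qed.

Lemma Re_le_cabs z : `|complex.Re z| <= cabs z.
Proof. by rewrite -lecR; exact: normc_ge_Re. Qed.

Lemma Im_le_cabs z : `|complex.Im z| <= cabs z.
Proof.
case: z => a b /=; rewrite -sqrtr_sqr /cabs /= ler_sqrt ?addr_ge0 ?sqr_ge0//.
by rewrite lerDr sqr_ge0.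
Qed.

Lemma cabs_le_ReIm z : cabs z <= `|complex.Re z| + `|complex.Im z|.
Proof.
case: z => a b /=; rewrite -[leRHS]ger0_norm ?addr_ge0// -sqrtr_sqr.
rewrite /cabs /= ler_sqrt ?sqr_ge0// sqrrD !real_normK ?num_real//.
by rewrite -addrA (addrC (_ *+ 2)) addrA lerDl mulrn_wge0 ?mulr_ge0.
Qed.

Lemma cabs_sum (I : Type) (s : seq I) (P : pred I) (f : I -> R[i]) :
  cabs (\sum_(i <- s | P i) f i) <= \sum_(i <- s | P i) cabs (f i).
Proof.
by elim/big_ind2: _ => [|x a y b xa yb|//]; rewrite ?cabs0// (le_trans (cabsD _ _))// lerD.
Qed.

Lemma cabs_prod (I : Type) (s : seq I) (P : pred I) (f : I -> R[i]) :
  cabs (\prod_(i <- s | P i) f i) = \prod_(i <- s | P i) cabs (f i).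
Proof. by elim/big_ind2: _ => [|x a y b <- <-|//]; rewrite ?cabs1 ?cabsM. Qed.

Lemma cabs_conj z : z^*%C * z = (cabs z ^+ 2)%:C.
Proof. by rewrite rmorphXn /= cabs_norm sqr_normc mulrC. Qed.

Lemma complex_ext z w :
  complex.Re z = complex.Re w -> complex.Im z = complex.Im w -> z = w.
Proof. by case: z w => a b [c d] /= -> ->. Qed.

End ComplexModulus.

Section NonnegativeSums.
Context {R : realType}.
Local Open Scope ereal_scope.

(** Finite partial sums give one inequality, for every nonnegative scalar; the other is that same
    inequality for [c^-1] and the scaled family. *)
Lemma esumZ (T : choiceType) (D : set T) (c : R) (f : T -> \bar R) :
  (0 <= c)%R -> (forall x, D x -> 0 <= f x) ->
  \esum_(x in D) (c%:E * f x) = c%:E * \esum_(x in D) f x.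
Proof.
move=> c0 f0.
have half (k : R) (g : T -> \bar R) : (0 <= k)%R -> (forall x, 0 <= g x) ->
    \esum_(x in D) (k%:E * g x) <= k%:E * \esum_(x in D) g x.
  move=> k0 g0; apply: ge_ereal_sup => _ /= [X [finX XD] <-].
  rewrite -ge0_mule_fsumr//.
  by apply: lee_wpmul2l; rewrite ?lee_fin//; apply: ereal_sup_ubound; exists X.
pose g x := if x \in D then f x else 0.
have g0 x : 0 <= g x by rewrite /g; case: ifPn => // /set_mem /f0.
have fg x : D x -> f x = g x by move=> Dx; rewrite /g mem_set.
rewrite (@eq_esum _ _ D (fun x => c%:E * f x) (fun x => c%:E * g x)); last by move=> x /fg ->.
rewrite (eq_esum fg).
have [->|cn0] := eqVneq c 0%R.
  by rewrite mul0e esum1// => x _; rewrite mul0e.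
apply/eqP; rewrite eq_le half//=.
have cp : (0 < c)%R by rewrite lt_neqAle eq_sym cn0.
have := @half (c^-1)%R (fun x => c%:E * g x).
rewrite invr_ge0 => /(_ c0) H.
have {}H : \esum_(x in D) g x <= (c^-1)%:E * \esum_(x in D) (c%:E * g x).
  apply: le_trans (H _); last by move=> x; rewrite mule_ge0.
  by apply: le_esum => x _; rewrite muleA -EFinM mulVf// mul1e.
rewrite -(@lee_pmul2l _ (c^-1)%:E) ?lte_fin ?invr_gt0//.
by rewrite muleA -EFinM mulVf// mul1e.
Qed.

Lemma esum_fibers (T U : choiceType) (D : set T) (s : T -> U) (f : T -> \bar R) :
  (forall x, D x -> 0 <= f x) ->
  \esum_(x in D) f x = \esum_(u in [set: U]) \esum_(x in D `&` s @^-1` [set u]) f x.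
Proof.
move=> f0; rewrite (esum_esum (a := fun _ x => f x)); last by move=> u x _ [/f0].
rewrite (reindex_esum D _ (fun x => (s x, x)))//; split.
- by move=> x Dx; split.
- by move=> x y _ _ [].
- by move=> [u x] [_ [Dx /= <-]]; exists x.
Qed.

Lemma esum_subset (T : choiceType) (A B : set T) (f : T -> \bar R) :
  A `<=` B -> (forall x, B x -> 0 <= f x) ->
  \esum_(x in A) f x <= \esum_(x in B) f x.
Proof.
move=> AB f0; rewrite (esumID A B) ?(setIidr AB)//.
by rewrite leeDl// esum_ge0// => x [/f0].
Qed.

Lemma esum_support (T : choiceType) (A B : set T) (f : T -> \bar R) :
  A `<=` B -> (forall x, B x -> ~ A x -> f x = 0) ->
  \esum_(x in A) f x = \esum_(x in B) f x.
Proof.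
move=> AB f0; rewrite esum_mkcond [RHS]esum_mkcond; apply: eq_esum => x _.
case: ifPn => [/set_mem/AB/mem_set ->//|/negP nA].
by case: ifPn => // /set_mem Bx; rewrite f0// => Ax; apply/nA/mem_set.
Qed.

Lemma esum_prod (T U : choiceType) (f : T -> R) (g : U -> R) :
  (forall x, 0 <= f x)%R -> (forall x, 0 <= g x)%R ->
  \esum_(y in [set: U]) (g y)%:E < +oo ->
  \esum_(p in [set: T * U]) (f p.1 * g p.2)%:E =
  (\esum_(x in [set: T]) (f x)%:E) * (\esum_(y in [set: U]) (g y)%:E).
Proof.
move=> f0 g0 gs.
have -> : [set: T * U] = [set: T] `*`` (fun=> [set: U]) by apply/seteqP; split.
rewrite -(esum_esum (a := fun x y => (f x * g y)%:E)); last first.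
  by move=> x y _ _; rewrite lee_fin mulr_ge0.
have G0 : 0 <= \esum_(y in [set: U]) (g y)%:E.
  by apply: esum_ge0 => x _; rewrite lee_fin.
have -> : \esum_(x in [set: T]) \esum_(y in [set: U]) (f x * g y)%:E =
    \esum_(x in [set: T]) ((f x)%:E * \esum_(y in [set: U]) (g y)%:E).
  by apply: eq_esum => x _; rewrite -esumZ// => y _; rewrite lee_fin.
move: G0 gs; case: (\esum_(y in _) _) => [r|//|//] r0 _.
rewrite lee_fin in r0.
rewrite muleC -esumZ//; last by move=> x _; rewrite lee_fin.
by apply: eq_esum => x _; rewrite muleC.
Qed.

Lemma esum_fin_num (T : choiceType) (D : set T) (f : T -> \bar R) :
  (forall x, D x -> 0 <= f x) -> \esum_(x in D) f x < +oo ->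
  \esum_(x in D) f x \is a fin_num.
Proof. by move=> f0 foo; rewrite ge0_fin_numE// esum_ge0. Qed.

End NonnegativeSums.

Section RealSums.
Context {R : realType} {T : choiceType}.
Implicit Types (D : set T) (f g h : T -> R).

Definition rsummable D f := (\esum_(x in D) (`|f x|)%:E < +oo)%E.

(** Summing max(f, 0) + h = g + max(- f, 0) and cancelling finite terms frees [rsum] from the
    positive and negative parts; linearity then amounts to choosing a convenient decomposition. *)
Lemma rsum_decomposition D f g h :
  (forall x, D x -> 0 <= g x) -> (forall x, D x -> 0 <= h x) ->
  (forall x, D x -> f x = g x - h x) ->
  (\esum_(x in D) (g x)%:E < +oo)%E -> (\esum_(x in D) (h x)%:E < +oo)%E ->
  rsum D f = fine (\esum_(x in D) (g x)%:E) - fine (\esum_(x in D) (h x)%:E).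
Proof.
move=> g0 h0 fE gs hs.
have p0 x : (0 <= (Num.max (f x) 0)%:E)%E by rewrite lee_fin le_max lexx orbT.
have m0 x : (0 <= (Num.max (- f x) 0)%:E)%E by rewrite lee_fin le_max lexx orbT.
have ps : (\esum_(x in D) (Num.max (f x) 0)%:E < +oo)%E.
  apply: le_lt_trans gs; apply: le_esum => x Dx.
  by rewrite lee_fin ge_max g0// fE// lerBlDr lerDl h0.
have ms : (\esum_(x in D) (Num.max (- f x) 0)%:E < +oo)%E.
  apply: le_lt_trans hs; apply: le_esum => x Dx.
  by rewrite lee_fin ge_max h0// fE// opprB lerBlDr lerDl g0.
have : (\esum_(x in D) (Num.max (f x) 0)%:E + \esum_(x in D) (h x)%:E =
        \esum_(x in D) (g x)%:E + \esum_(x in D) (Num.max (- f x) 0)%:E)%E.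
  rewrite -!esumD//.
  apply: eq_esum => x Dx; rewrite -!EFinD fE//; congr EFin.
  by rewrite /Num.max; case: ltP => ?; case: ltP => ?; lra.
have Eg : (\esum_(x in D) (g x)%:E)%E \is a fin_num by rewrite esum_fin_num.
have Eh : (\esum_(x in D) (h x)%:E)%E \is a fin_num by rewrite esum_fin_num.
have Ep : (\esum_(x in D) (Num.max (f x) 0)%:E)%E \is a fin_num by rewrite esum_fin_num.
have Em : (\esum_(x in D) (Num.max (- f x) 0)%:E)%E \is a fin_num by rewrite esum_fin_num.
by move/(congr1 fine); rewrite !fineD// /rsum; lra.
Qed.

Lemma rsum_posneg D f : rsummable D f ->
  (\esum_(x in D) (Num.max (f x) 0)%:E < +oo)%E /\
  (\esum_(x in D) (Num.max (- f x) 0)%:E < +oo)%E.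
Proof.
move=> fs; split; apply: le_lt_trans fs; apply: le_esum => x _; rewrite lee_fin.
  by rewrite ge_max ler_norm normr_ge0.
by rewrite ge_max -normrN ler_norm normr_ge0.
Qed.

Lemma rsumD D f g : rsummable D f -> rsummable D g ->
  rsum D (fun x => f x + g x) = rsum D f + rsum D g.
Proof.
move=> /rsum_posneg[fp fn] /rsum_posneg[gp gn].
have p0 (y : R) : (0 <= (Num.max y 0)%:E)%E by rewrite lee_fin le_max lexx orbT.
rewrite (@rsum_decomposition _ _ (fun x => Num.max (f x) 0 + Num.max (g x) 0)
  (fun x => Num.max (- f x) 0 + Num.max (- g x) 0)).
- under eq_esum do rewrite EFinD; under [X in _ - fine X]eq_esum do rewrite EFinD.
  rewrite !esumD// !fineD// ?esum_fin_num//.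
  by rewrite /rsum; lra.
- by move=> x _ /=; rewrite addr_ge0// le_max lexx orbT.
- by move=> x _ /=; rewrite addr_ge0// le_max lexx orbT.
- move=> x _ /=; rewrite /Num.max.
  by case: ltP => ?; case: ltP => ?; case: ltP => ?; case: ltP => ?; lra.
- under eq_esum do rewrite EFinD.
  by rewrite esumD// lte_add_pinfty.
- under eq_esum do rewrite EFinD.
  by rewrite esumD// lte_add_pinfty.
Qed.

Lemma rsumN D f : rsum D (fun x => - f x) = - rsum D f.
Proof. by rewrite /rsum; under [X in _ - fine X]eq_esum do rewrite opprK; rewrite opprB. Qed.

Lemma rsumZ D (c : R) f : rsummable D f -> rsum D (fun x => c * f x) = c * rsum D f.
Proof.
move=> fs; have [fp fn] := rsum_posneg fs.
wlog c0 : c / 0 <= c.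
  move=> H; have [/H//|c0] := leP 0 c.
  rewrite -[LHS]opprK -rsumN.
  under [X in rsum _ X]eq_fun do rewrite -mulNr.
  by rewrite H ?mulNr ?opprK// oppr_ge0 ltW.
have p0 (y : R) : (0 <= (Num.max y 0)%:E)%E by rewrite lee_fin le_max lexx orbT.
have E (k : T -> R) : (\esum_(x in D) (Num.max (c * k x) 0)%:E =
    c%:E * \esum_(x in D) (Num.max (k x) 0)%:E)%E.
  rewrite -esumZ//; apply: eq_esum => x _; rewrite -EFinM; congr EFin.
  by rewrite maxr_pMr// mulr0.
rewrite /rsum E; under [X in _ - fine X]eq_esum do rewrite -mulrN.
by rewrite (E (fun x => - f x)) !fineM ?esum_fin_num// mulrBr.
Qed.

Lemma rsum_le D f : rsummable D f -> ((rsum D f)%:E <= \esum_(x in D) (`|f x|)%:E)%E.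
Proof.
move=> fs; have [fp fn] := rsum_posneg fs.
have p0 (y : R) : (0 <= (Num.max y 0)%:E)%E by rewrite lee_fin le_max lexx orbT.
rewrite /rsum EFinB !fineK ?esum_fin_num//.
apply: (@le_trans _ _ (\esum_(x in D) (Num.max (f x) 0)%:E)%E).
  by rewrite leeBlDr ?esum_fin_num// leeDl// esum_ge0.
by apply: le_esum => x _; rewrite lee_fin ge_max ler_norm normr_ge0.
Qed.

Lemma eq_rsum D f g : (forall x, D x -> f x = g x) -> rsum D f = rsum D g.
Proof.
by move=> fg; rewrite /rsum; congr (fine _ - fine _); apply: eq_esum => x /fg ->.
Qed.

Lemma rsum_reindex (U : choiceType) D (E : set U) (e : T -> U) (f : U -> R) :
  set_bij D E e -> rsum E f = rsum D (f \o e).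
Proof. by move=> be; rewrite /rsum; congr (fine _ - fine _); apply: reindex_esum. Qed.

Lemma rsum_support (A B : set T) f : A `<=` B ->
  (forall x, B x -> ~ A x -> f x = 0) -> rsum A f = rsum B f.
Proof.
move=> AB f0; rewrite /rsum; congr (fine _ - fine _); apply: esum_support => // x Bx nAx.
  by rewrite f0// maxxx.
by rewrite f0// oppr0 maxxx.
Qed.

Lemma rsummable_sub (A B : set T) f : A `<=` B -> rsummable B f -> rsummable A f.
Proof. by move=> AB; apply: le_lt_trans; apply: esum_subset. Qed.

Lemma rsumID (A D : set T) f : rsummable D f ->
  rsum D f = rsum (D `&` A) f + rsum (D `&` ~` A) f.
Proof.
move=> fs; have [fp fn] := rsum_posneg fs.
have [fp1 fn1] := rsum_posneg (rsummable_sub (@subIsetl _ D A) fs).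
have [fp2 fn2] := rsum_posneg (rsummable_sub (@subIsetl _ D (~` A)) fs).
have p0 (y : R) : (0 <= (Num.max y 0)%:E)%E by rewrite lee_fin le_max lexx orbT.
rewrite {1}/rsum (esumID A)// (esumID A D (fun x => (Num.max (- f x) 0)%:E))//.
rewrite !fineD ?esum_fin_num// /rsum; lra.
Qed.

End RealSums.

(** The fibre sums of the positive and negative parts of [f] need not be the positive and negative
    parts of the fibre sums, but they do decompose them. *)
Lemma rsum_fibers (R : realType) (T U : choiceType) (D : set T) (s : T -> U) (f : T -> R) : rsummable D f ->
  rsum D f = rsum setT (fun u => rsum (D `&` s @^-1` [set u]) f).
Proof.
move=> fs; have [fp fn] := rsum_posneg fs.
have p0 (y : R) : (0 <= (Num.max y 0)%:E)%E by rewrite lee_fin le_max lexx orbT.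
pose F (k : T -> R) u := (\esum_(x in D `&` s @^-1` [set u]) (Num.max (k x) 0)%:E)%E.
have FE (k : T -> R) u : (\esum_(x in D) (Num.max (k x) 0)%:E < +oo)%E ->
    F k u = (fine (F k u))%:E.
  move=> ks; rewrite fineK// esum_fin_num//.
  by apply: le_lt_trans ks; apply: esum_subset.
have FS (k : T -> R) : (\esum_(x in D) (Num.max (k x) 0)%:E < +oo)%E ->
    (\esum_(x in D) (Num.max (k x) 0)%:E = \esum_(u in setT) (fine (F k u))%:E)%E.
  move=> ks; rewrite (esum_fibers s)//; by apply: eq_esum => u _; rewrite -FE.
have F0 (k : T -> R) u : 0 <= fine (F k u) by apply/fine_ge0/esum_ge0.
rewrite (@rsum_decomposition _ _ _ _ (fun u => fine (F f u)) (fun u => fine (F (fun x => - f x) u)))//.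
- by rewrite -!FS.
- by rewrite -FS.
- by rewrite -FS.
Qed.

Section ComplexSums.
Context {R : realType}.
Local Notation C := R[i].
Local Open Scope complex_scope.

Lemma csummable_ReIm (T : choiceType) (D : set T) (f : T -> C) : csummable D f ->
  rsummable D (fun x => complex.Re (f x)) /\ rsummable D (fun x => complex.Im (f x)).
Proof.
move=> fs; split; apply: le_lt_trans fs; apply: le_esum => x _; rewrite lee_fin.
  exact: Re_le_cabs.
exact: Im_le_cabs.
Qed.

Lemma le_csummable (T : choiceType) (D : set T) (f g : T -> C) :
  (forall x, D x -> cabs (f x) <= cabs (g x)) -> csummable D g -> csummable D f.
Proof. by move=> fg; apply: le_lt_trans; apply: le_esum => x /fg. Qed.

Lemma sub_csummable (T : choiceType) (A B : set T) (f : T -> C) :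
  A `<=` B -> csummable B f -> csummable A f.
Proof.
move=> AB; apply: le_lt_trans; apply: esum_subset => // x _.
by rewrite lee_fin cabs_ge0.
Qed.

Lemma csummableD (T : choiceType) (D : set T) (f g : T -> C) :
  csummable D f -> csummable D g -> csummable D (fun x => f x + g x).
Proof.
move=> fs gs; apply: le_lt_trans (lte_add_pinfty fs gs).
rewrite -esumD; [|by move=> x _; rewrite lee_fin cabs_ge0..].
by apply: le_esum => x _; rewrite lee_fin cabsD.
Qed.

Lemma csummableZ (T : choiceType) (D : set T) (c : C) (f : T -> C) :
  csummable D f -> csummable D (fun x => c * f x).
Proof.
move=> fs; rewrite /csummable.
under eq_esum do rewrite cabsM EFinM.
rewrite esumZ ?cabs_ge0//; last by move=> x _; rewrite lee_fin cabs_ge0.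
by rewrite lte_mul_pinfty// ?lee_fin ?cabs_ge0.
Qed.

Lemma eq_csum (T : choiceType) (D : set T) (f g : T -> C) :
  (forall x, D x -> f x = g x) -> csum D f = csum D g.
Proof.
by move=> fg; rewrite /csum; congr (_ +i* _); apply: eq_rsum => x /fg ->.
Qed.

Lemma eq_csummable (T : choiceType) (D : set T) (f g : T -> C) :
  (forall x, D x -> f x = g x) -> csummable D f = csummable D g.
Proof. by move=> fg; congr (is_true (_ < _)%E); apply: eq_esum => x /fg ->. Qed.

Lemma csumD (T : choiceType) (D : set T) (f g : T -> C) :
  csummable D f -> csummable D g ->
  csum D (fun x => f x + g x) = csum D f + csum D g.
Proof.
move=> /csummable_ReIm[fR fI] /csummable_ReIm[gR gI].
rewrite /csum; apply: complex_ext => /=; rewrite -rsumD//;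
  by apply: eq_rsum => x _; case: (f x) (g x) => a b [c d].
Qed.

Lemma csumZ (T : choiceType) (D : set T) (c : C) (f : T -> C) :
  csummable D f -> csum D (fun x => c * f x) = c * csum D f.
Proof.
move=> /csummable_ReIm[fR fI].
have sZ (r : R) g : rsummable D g -> rsummable D (fun x => r * g x).
  move=> gs; rewrite /rsummable; under eq_esum do rewrite normrM EFinM.
  by rewrite esumZ// lte_mul_pinfty// lee_fin.
case: c => a b; rewrite /csum; apply: complex_ext => /=.
  rewrite -mulNr -!rsumZ// -rsumD; [|exact: sZ..].
  by apply: eq_rsum => x _; case: (f x) => u v /=; rewrite mulNr.
rewrite -!rsumZ// -rsumD; [|exact: sZ..].
by apply: eq_rsum => x _; case: (f x).
Qed.

Lemma csumB (T : choiceType) (D : set T) (f g : T -> C) :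
  csummable D f -> csummable D g ->
  csum D (fun x => f x - g x) = csum D f - csum D g.
Proof.
move=> fs gs; have gs' := csummableZ (-1) gs.
rewrite -mulN1r -csumZ// -csumD//; by apply: eq_csum => x _; rewrite mulN1r.
Qed.

Lemma csummableB (T : choiceType) (D : set T) (f g : T -> C) :
  csummable D f -> csummable D g -> csummable D (fun x => f x - g x).
Proof.
move=> fs gs; have := csummableD fs (csummableZ (-1) gs).
by rewrite (eq_csummable (g := fun x => f x - g x))// => x _; rewrite mulN1r.
Qed.

(* Multiplying by the conjugate of the sum reduces to the real part. *)
Lemma csum_le (T : choiceType) (D : set T) (f : T -> C) :
  ((cabs (csum D f))%:E <= \esum_(x in D) (cabs (f x))%:E)%E.
Proof.
have [fs|] := boolP (\esum_(x in D) (cabs (f x))%:E < +oo)%E; last first.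
  by rewrite -leNgt leye_eq => /eqP ->; rewrite leey.
set S := csum D f; have [->|S0] := eqVneq (cabs S) 0.
  by apply: esum_ge0 => x _; rewrite lee_fin cabs_ge0.
have Sp : 0 < cabs S by rewrite lt_neqAle eq_sym S0 cabs_ge0.
have H : (cabs S ^+ 2)%:C = csum D (fun x => S^*%C * f x) by rewrite csumZ// cabs_conj.
have {}H : cabs S ^+ 2 = rsum D (fun x => complex.Re (S^*%C * f x)).
  by have := congr1 (@complex.Re R) H.
rewrite -(@lee_pmul2l _ (cabs S)%:E) ?lte_fin// -EFinM -expr2 H.
have [sR sI] := csummable_ReIm (csummableZ (S^*%C) fs).
apply: le_trans (rsum_le sR) _.
rewrite -esumZ ?cabs_ge0//; last by move=> x _; rewrite lee_fin cabs_ge0.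
apply: le_esum => x _; rewrite -EFinM lee_fin (le_trans (Re_le_cabs _))// cabsM.
by rewrite (_ : cabs S^*%C = cabs S)//; apply: complexI; rewrite !cabs_norm normcJ.
Qed.

Lemma csum_reindex (T U : choiceType) (D : set T) (E : set U) (e : T -> U) (f : U -> C) :
  set_bij D E e -> csum E f = csum D (f \o e).
Proof.
by move=> be; rewrite /csum; congr (_ +i* _); rewrite (rsum_reindex _ be).
Qed.

Lemma csummable_reindex (T U : choiceType) (D : set T) (E : set U) (e : T -> U)
    (f : U -> C) :
  set_bij D E e -> csummable E f = csummable D (f \o e).
Proof. by move=> be; rewrite /csummable (reindex_esum _ _ _ _ be). Qed.

Lemma csum_support (T : choiceType) (A B : set T) (f : T -> C) : A `<=` B ->
  (forall x, B x -> ~ A x -> f x = 0) -> csum A f = csum B f.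
Proof.
move=> AB f0; rewrite /csum; congr (_ +i* _); apply: rsum_support => // x Bx nAx;
  by rewrite f0.
Qed.

Lemma csumID (T : choiceType) (A D : set T) (f : T -> C) : csummable D f ->
  csum D f = csum (D `&` A) f + csum (D `&` ~` A) f.
Proof.
move=> /csummable_ReIm[fR fI]; rewrite /csum; apply: complex_ext => /=;
  exact: rsumID.
Qed.

Lemma csum_fibers (T U : choiceType) (D : set T) (s : T -> U) (f : T -> C) :
  csummable D f ->
  csum D f = csum setT (fun u => csum (D `&` s @^-1` [set u]) f).
Proof.
by move=> /csummable_ReIm[fR fI]; rewrite {1}/csum !(rsum_fibers s).
Qed.

Lemma csum_set0 (T : choiceType) (f : T -> C) : csum set0 f = 0.
Proof. by rewrite /csum /rsum !esum_set0 subr0. Qed.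

Lemma csum0 (T : choiceType) (D : set T) (f : T -> C) :
  (forall x, D x -> f x = 0) -> csum D f = 0.
Proof.
move=> f0; rewrite -(csum_set0 f); apply/esym/csum_support => //.
by move=> x /f0.
Qed.

Lemma csum_set1 (T : choiceType) (x : T) (f : T -> C) : csum [set x] f = f x.
Proof.
have p0 (y : R) : (0 <= (Num.max y 0)%:E)%E by rewrite lee_fin le_max lexx orbT.
rewrite /csum /rsum !esum_set1//=; apply: complex_ext => /=;
  rewrite /Num.max; by case: ltP => ?; case: ltP => ?; lra.
Qed.

Lemma csummable_seq (T : choiceType) (s : seq T) (f : T -> C) : csummable [set` s] f.
Proof.
rewrite /csummable esum_fset//; last by move=> x _; rewrite lee_fin cabs_ge0.
by rewrite fsbig_finite//= sumEFin ltry.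
Qed.

Lemma csum_seq (T : choiceType) (s : seq T) (f : T -> C) : uniq s ->
  csum [set` s] f = \sum_(x <- s) f x.
Proof.
elim: s => [_|x s ih /= /andP[xs us]].
  by rewrite big_nil csum0.
rewrite (csumID [set x]); last exact: csummable_seq.
rewrite big_cons -ih// -[X in _ = X + _](csum_set1 x f).
congr (_ + _); congr (csum _ f).
  apply/seteqP; split => [y [_ //]|y /= ->]; split => //=.
  by rewrite in_cons eqxx.
apply/seteqP; split => y /=.
  by rewrite in_cons => -[/orP[/eqP//|//]].
move=> ys; split; first by rewrite in_cons ys orbT.
by move=> yx; rewrite yx (negPf xs) in ys.
Qed.

Lemma csum_fin (T : choiceType) (I : finType) (e : I -> T) (D : set T) (f : T -> C) :
  set_bij setT D e -> csum D f = \sum_i f (e i).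
Proof.
move=> be; rewrite (csum_reindex f be) -(csum_seq _ (index_enum_uniq I)).
by congr (csum _ _); apply/seteqP; split => // i _ /=; rewrite mem_index_enum.
Qed.

Lemma csum_prod (T U : choiceType) (f : T -> C) (g : U -> C) :
  csummable setT f -> csummable setT g ->
  csummable setT (fun p : T * U => f p.1 * g p.2) /\
  csum setT (fun p : T * U => f p.1 * g p.2) = csum setT f * csum setT g.
Proof.
move=> fs gs; have ps : csummable setT (fun p : T * U => f p.1 * g p.2).
  rewrite /csummable; under eq_esum do rewrite cabsM.
  rewrite (esum_prod (fun x => cabs_ge0 (f x)) (fun y => cabs_ge0 (g y)))//.
  have F0 : (\esum_(x in setT) (cabs (f x))%:E)%E \is a fin_num.
    by rewrite esum_fin_num// => x _; rewrite lee_fin cabs_ge0.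
  have G0 : (\esum_(x in setT) (cabs (g x))%:E)%E \is a fin_num.
    by rewrite esum_fin_num// => x _; rewrite lee_fin cabs_ge0.
  by rewrite ltey_eq fin_numM.
split => //; rewrite (csum_fibers fst)// mulrC -csumZ//.
apply: eq_csum => x _; rewrite (@csum_reindex _ _ setT _ (fun y => (x, y))); last first.
  split => //; first by move=> y z _ _ [].
  by move=> [x' y] [_ /= ->]; exists y.
by rewrite (eq_csum (g := fun y => f x * g y))// csumZ// mulrC.
Qed.

End ComplexSums.

(** * Power series in two variables *)

Section IteratedSums.
Context {R : realType}.
Local Notation C := R[i].
Local Open Scope complex_scope.

Lemma esum_iterated (T U : choiceType) (D : set T) (E : set U) (f : T -> U -> \bar R) :
  (forall x y, D x -> E y -> (0 <= f x y)%E) ->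
  (\esum_(x in D) \esum_(y in E) f x y = \esum_(p in D `*` E) f p.1 p.2)%E.
Proof.
move=> f0; rewrite esum_esum//; congr (esum _ _).
Qed.

Lemma esum_exchange (T U : choiceType) (D : set T) (E : set U) (f : T -> U -> \bar R) :
  (forall x y, D x -> E y -> (0 <= f x y)%E) ->
  (\esum_(x in D) \esum_(y in E) f x y = \esum_(y in E) \esum_(x in D) f x y)%E.
Proof.
move=> f0; rewrite esum_iterated// esum_iterated; last by move=> y x Ey Dx; exact: f0.
apply: (reindex_esum _ _ (fun p => (p.2, p.1)) (fun p => f p.1 p.2)); split.
- by move=> [y x] [].
- by move=> [y x] [y' x'] _ _ [-> ->].
- by move=> [x y] [Dx Ey]; exists (y, x).
Qed.

Lemma csum_iterated (T U : choiceType) (D : set T) (E : set U) (f : T -> U -> C) :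
  csummable (D `*` E) (fun p => f p.1 p.2) ->
  csum D (fun x => csum E (f x)) = csum (D `*` E) (fun p => f p.1 p.2).
Proof.
move=> fs; rewrite (csum_fibers fst fs).
have H x : D x -> csum E (f x) =
    csum (D `*` E `&` fst @^-1` [set x]) (fun p => f p.1 p.2).
  move=> Dx; apply/esym; rewrite (@csum_reindex _ _ _ E _ (fun y => (x, y)))//.
  split => //; first by move=> y z _ _ [].
  by move=> [x' y] [[/= _ Ey] <-]; exists y.
rewrite (eq_csum H); apply: csum_support => // x _ Dx; apply: csum0 => -[x' y].
by move=> [[/= Dx' _] xx']; case: Dx; rewrite -xx'.
Qed.

Lemma csum_exchange (T U : choiceType) (D : set T) (E : set U) (f : T -> U -> C) :
  csummable (D `*` E) (fun p => f p.1 p.2) ->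
  csum D (fun x => csum E (f x)) = csum E (fun y => csum D (fun x => f x y)).
Proof.
move=> fs; rewrite csum_iterated//.
have be : set_bij (E `*` D) (D `*` E) (fun p => (p.2, p.1)).
  split.
  - by move=> [y x] [].
  - by move=> [y x] [y' x'] _ _ [-> ->].
  - by move=> [x y] [Dx Ey]; exists (y, x).
rewrite (csum_reindex _ be) csum_iterated//.
by rewrite (csummable_reindex _ be) in fs.
Qed.

Lemma csummable_iterated (T U : choiceType) (D : set T) (E : set U) (f : T -> U -> C) :
  (\esum_(x in D) \esum_(y in E) (cabs (f x y))%:E < +oo)%E ->
  csummable (D `*` E) (fun p => f p.1 p.2).
Proof. by rewrite esum_iterated// => x y _ _; rewrite lee_fin cabs_ge0. Qed.

Lemma csum_single (T : choiceType) (x : T) (f : T -> C) :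
  (forall y, y != x -> f y = 0) -> csum setT f = f x.
Proof.
move=> f0; rewrite -(csum_set1 x f); apply/esym/csum_support => // y _.
by move=> /eqP; exact: f0.
Qed.

Lemma esum_single (T : choiceType) (x : T) (f : T -> \bar R) : (0 <= f x)%E ->
  (forall y, y != x -> f y = 0) -> (\esum_(y in setT) f y = f x)%E.
Proof.
move=> fx f0; rewrite -(esum_set1 fx); apply/esym/esum_support => // y _.
by move=> /eqP; exact: f0.
Qed.

End IteratedSums.

Section PowerSeries.
Context {R : realType}.
Local Notation C := R[i].
Local Notation vec := 'cV[R]_2.
Local Open Scope complex_scope.

Definition monomial (p x : vec) (mn : nat * nat) : R :=
  (x ord0 0 - p ord0 0) ^+ mn.1 * (x ord_max 0 - p ord_max 0) ^+ mn.2.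

(** The square is closed because a finite norm at radius [r] gives absolute convergence up to the
    boundary. *)
Definition in_square (p : vec) (r : R) (x : vec) : Prop :=
  forall i, `|x i 0 - p i 0| <= r.

Definition series_norm (r : R) (a : nat * nat -> C) : \bar R :=
  \esum_(mn in setT) (cabs (a mn) * r ^+ (mn.1 + mn.2))%:E.

(* The weighted coefficient norm at radius [r] is a Banach algebra norm that also controls
   infinite sums of functions, hence its use instead of bare analyticity. *)
Definition has_series (p : vec) (r M : R) (f : vec -> C) : Prop :=
  exists2 a : nat * nat -> C, (series_norm r a <= M%:E)%E &
    forall x, in_square p r x ->
      f x = csum setT (fun mn => a mn * (monomial p x mn)%:C).

Lemma monomial_le p r x mn : in_square p r x ->
  `|monomial p x mn| <= r ^+ (mn.1 + mn.2).
Proof.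
move=> xp; have r0 : 0 <= r by apply: le_trans (xp ord0).
by rewrite normrM !normrX exprD ler_pM ?exprn_ge0// lerXn2r ?nnegrE ?normr_ge0.
Qed.

Lemma series_summable p r M (a : nat * nat -> C) x : (series_norm r a <= M%:E)%E ->
  in_square p r x -> csummable setT (fun mn => a mn * (monomial p x mn)%:C).
Proof.
move=> aM xp; apply: (@le_lt_trans _ _ M%:E); last exact: ltry.
apply: le_trans aM; apply: le_esum => mn _; rewrite lee_fin cabsM cabs_real.
by rewrite ler_wpM2l ?cabs_ge0// monomial_le.
Qed.

Lemma in_square_center p r : 0 <= r -> in_square p r p.
Proof. by move=> r0 i; rewrite subrr normr0. Qed.

Lemma in_square_le p r r' x : r <= r' -> in_square p r x -> in_square p r' x.
Proof. by move=> rr H i; apply: le_trans rr. Qed.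

Lemma has_series_bound p r M f x : has_series p r M f -> in_square p r x ->
  cabs (f x) <= M.
Proof.
move=> [a aM fE] xp; rewrite fE// -lee_fin; apply: le_trans (csum_le _ _) _.
apply: le_trans aM; apply: le_esum => mn _; rewrite lee_fin cabsM cabs_real.
by rewrite ler_wpM2l ?cabs_ge0// monomial_le.
Qed.

Lemma has_series_ge0 p r M f : 0 <= r -> has_series p r M f -> 0 <= M.
Proof.
move=> r0 fs; apply: le_trans (has_series_bound fs (in_square_center p r0)).
exact: cabs_ge0.
Qed.

Lemma has_series_le p r r' M M' f : 0 <= r' -> r' <= r -> M <= M' ->
  has_series p r M f -> has_series p r' M' f.
Proof.
move=> r0 rr MM [a aM fE]; exists a; last first.
  by move=> x xp; apply/fE/in_square_le/xp.
rewrite (@le_trans _ _ M%:E)// (le_trans _ aM)//; apply: le_esum => mn _.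
by rewrite lee_fin ler_wpM2l ?cabs_ge0// lerXn2r ?nnegrE// (le_trans r0).
Qed.

Lemma eq_has_series p r M f g : (forall x, f x = g x) ->
  has_series p r M f -> has_series p r M g.
Proof. by move=> /funext ->. Qed.

Lemma has_series_cst p r (c : C) : has_series p r (cabs c) (fun=> c).
Proof.
exists (fun mn => if mn == (0, 0)%N then c else 0).
  rewrite /series_norm (esum_single (x := (0, 0)%N))/= ?expr0 ?mulr1 ?lee_fin ?cabs_ge0//.
  by move=> mn /negPf ->; rewrite cabs0 mul0r.
move=> x _; rewrite (csum_single (x := (0, 0)%N))/=.
  by rewrite /monomial !expr0 !mulr1.
by move=> mn /negPf ->; rewrite mul0r.
Qed.

Lemma has_series_coord p r (b : bool) : 0 <= r ->
  has_series p r r (fun x => (if b then x ord_max 0 - p ord_max 0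
                              else x ord0 0 - p ord0 0)%:C).
Proof.
move=> r0; pose k := if b then (0, 1)%N else (1, 0)%N.
exists (fun mn => if mn == k then 1 else 0).
  rewrite /series_norm (esum_single (x := k))/= ?eqxx ?cabs1 ?mul1r ?lee_fin ?exprn_ge0//.
    by rewrite /k; case: (b); rewrite /= expr1.
  by move=> mn /negPf ->; rewrite cabs0 mul0r.
move=> x _; rewrite (csum_single (x := k))/=.
  by rewrite eqxx mul1r /monomial /k; case: (b); rewrite /= expr0 expr1 ?mulr1 ?mul1r.
by move=> mn /negPf ->; rewrite mul0r.
Qed.

Lemma has_seriesZ p r M (c : C) f : 0 <= r -> has_series p r M f ->
  has_series p r (cabs c * M) (fun x => c * f x).
Proof.
move=> r0 [a aM fE]; exists (fun mn => c * a mn); last first.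
  move=> x xp; rewrite fE// -csumZ; last exact: series_summable aM xp.
  by apply: eq_csum => mn _; rewrite mulrA.
rewrite /series_norm; under eq_esum do rewrite cabsM -mulrA EFinM.
rewrite esumZ ?cabs_ge0//; last first.
  by move=> mn _; rewrite lee_fin mulr_ge0 ?cabs_ge0 ?exprn_ge0.
by rewrite EFinM lee_wpmul2l// lee_fin cabs_ge0.
Qed.

Lemma has_seriesD p r M N f g : 0 <= r -> has_series p r M f -> has_series p r N g ->
  has_series p r (M + N) (fun x => f x + g x).
Proof.
move=> r0 [a aM fE] [b bN gE]; exists (fun mn => a mn + b mn); last first.
  move=> x xp; rewrite fE// gE// -csumD; [|exact: series_summable aM xp|
    exact: series_summable bN xp].
  by apply: eq_csum => mn _; rewrite mulrDl.
rewrite EFinD; apply: le_trans (leeD aM bN).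
rewrite -esumD; try by move=> mn _; rewrite lee_fin mulr_ge0 ?cabs_ge0 ?exprn_ge0.
apply: le_esum => mn _; rewrite -EFinD lee_fin -mulrDl.
by rewrite ler_wpM2r ?exprn_ge0// cabsD.
Qed.

Lemma has_series_sum p r (I : Type) (s : seq I) (P : pred I) (M : I -> R)
    (f : I -> vec -> C) : 0 <= r -> (forall i, P i -> has_series p r (M i) (f i)) ->
  has_series p r (\sum_(i <- s | P i) M i) (fun x => \sum_(i <- s | P i) f i x).
Proof.
move=> r0 fs; elim: s => [|i s ih].
  rewrite big_nil; apply: eq_has_series (fun x => esym (big_nil _ _ _ _)) _.
  by rewrite -[X in has_series _ _ X _]cabs0; exact: has_series_cst.
rewrite big_cons; apply: eq_has_series (fun x => esym (big_cons _ _ _ _ _ _)) _.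
by case: ifP => // Pi; apply: has_seriesD => //; exact: fs.
Qed.

(** Completeness of the norm: the coefficients are summed one by one, and the double sum of weighted
    moduli, at most [S], licenses the exchange with the sum over monomials. *)
Lemma has_series_csum p r (T : choiceType) (D : set T) (M : T -> R) (S : R)
    (f : T -> vec -> C) : 0 < r -> (forall i, D i -> has_series p r (M i) (f i)) ->
  (\esum_(i in D) (M i)%:E <= S%:E)%E ->
  has_series p r S (fun x => csum D (fun i => f i x)).
Proof.
move=> r0 fs MS.
have /choice[a aP] : forall i, exists a : nat * nat -> C, D i ->
    (series_norm r a <= (M i)%:E)%E /\ forall x, in_square p r x ->
      f i x = csum setT (fun mn => a mn * (monomial p x mn)%:C).
  move=> i; have [/fs[a aM fE]|nD] := pselect (D i); first by exists a.
  by exists (fun=> 0).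
have aM i : D i -> (series_norm r (a i) <= (M i)%:E)%E by move=> /aP[].
have w0 mn : 0 <= r ^+ (mn.1 + mn.2) :> R by rewrite exprn_ge0// ltW.
have key : (\esum_(i in D) \esum_(mn in [set: nat * nat])
    (cabs (a i mn) * r ^+ (mn.1 + mn.2))%:E <= S%:E)%E.
  by apply: le_trans MS; apply: le_esum => i /aM.
(* The weight is nonzero since [0 < r], so it can be divided out of the summable weighted family. *)
have asum mn : csummable D (fun i => a i mn).
  have : (\esum_(i in D) (cabs (a i mn) * r ^+ (mn.1 + mn.2))%:E < +oo)%E.
    apply: (@le_lt_trans _ _ S%:E); last exact: ltry.
    apply: le_trans key; apply: le_esum => i Di.
    rewrite -[leLHS](esum_set1 (t := mn) (a := fun mn => (cabs (a i mn) * r ^+ (mn.1 + mn.2))%:E)).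
      by apply: esum_subset => // k _; rewrite lee_fin mulr_ge0 ?cabs_ge0.
    by rewrite lee_fin mulr_ge0 ?cabs_ge0.
  move=> H; rewrite /csummable.
  have -> : (\esum_(i in D) (cabs (a i mn))%:E = (r ^+ (mn.1 + mn.2))^-1%:E *
      \esum_(i in D) (cabs (a i mn) * r ^+ (mn.1 + mn.2))%:E)%E.
    rewrite -esumZ ?invr_ge0//; last by move=> i _; rewrite lee_fin mulr_ge0 ?cabs_ge0.
    apply: eq_esum => i _; rewrite -EFinM mulrCA mulVf ?mulr1//.
    by rewrite expf_neq0// gt_eqF.
  by rewrite lte_mul_pinfty// lee_fin invr_ge0.
exists (fun mn => csum D (fun i => a i mn)).
  apply: le_trans key; rewrite esum_exchange; last first.
    by move=> i mn _ _; rewrite lee_fin mulr_ge0 ?cabs_ge0.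
  apply: le_esum => mn _; rewrite mulrC EFinM.
  under [leRHS]eq_esum do rewrite mulrC EFinM.
  rewrite esumZ//; last by move=> i _; rewrite lee_fin cabs_ge0.
  by rewrite lee_wpmul2l ?lee_fin// csum_le.
move=> x xp; have fE i : D i -> f i x = csum setT (fun mn => a i mn * (monomial p x mn)%:C).
  by move=> /aP[_]; exact.
rewrite (eq_csum fE) csum_exchange.
  apply: eq_csum => mn _; rewrite mulrC -csumZ//.
  by apply: eq_csum => i _; rewrite mulrC.
apply: (@csummable_iterated _ _ _ _ _ (fun i mn => a i mn * (monomial p x mn)%:C)).
apply: (@le_lt_trans _ _ S%:E); last exact: ltry.
apply: le_trans key; apply: le_esum => i _; apply: le_esum => mn _.
by rewrite lee_fin cabsM cabs_real ler_wpM2l ?cabs_ge0// monomial_le.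
Qed.

Lemma monomialD p x (k l : nat * nat) :
  monomial p x (k.1 + l.1, k.2 + l.2)%N = monomial p x k * monomial p x l.
Proof. by rewrite /monomial /= !exprD mulrACA. Qed.

(** Cauchy product: the coefficients are sums over the fibres of the addition [s] of exponents. The
    weight is multiplicative along [s], hence the product of the norms. *)
Lemma has_seriesM p r M N f g : 0 < r -> has_series p r M f -> has_series p r N g ->
  has_series p r (M * N) (fun x => f x * g x).
Proof.
move=> r0 [a aM fE] [b bN gE].
have w0 n : 0 <= r ^+ n :> R by rewrite exprn_ge0// ltW.
pose s (kl : (nat * nat) * (nat * nat)) := (kl.1.1 + kl.2.1, kl.1.2 + kl.2.2)%N.
pose c (kl : (nat * nat) * (nat * nat)) := a kl.1 * b kl.2.
have wE kl : cabs (c kl) * r ^+ ((s kl).1 + (s kl).2) =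
    (cabs (a kl.1) * r ^+ (kl.1.1 + kl.1.2)) * (cabs (b kl.2) * r ^+ (kl.2.1 + kl.2.2)).
  by rewrite /c /s /= cabsM addnACA exprD mulrACA.
have key : (\esum_(kl in setT) (cabs (c kl) * r ^+ ((s kl).1 + (s kl).2))%:E <= (M * N)%:E)%E.
  under eq_esum do rewrite wE.
  rewrite (esum_prod (f := fun k => cabs (a k) * r ^+ (k.1 + k.2))
                     (g := fun k => cabs (b k) * r ^+ (k.1 + k.2))).
  - rewrite EFinM; apply: lee_pmul => //; apply: esum_ge0 => k _;
      by rewrite lee_fin mulr_ge0 ?cabs_ge0.
  - by move=> k; rewrite mulr_ge0 ?cabs_ge0.
  - by move=> k; rewrite mulr_ge0 ?cabs_ge0.
  - by apply: (@le_lt_trans _ _ N%:E) => //; exact: ltry.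
pose F u := setT `&` s @^-1` [set u].
have csm u : csummable (F u) c.
  rewrite /csummable; have -> : (\esum_(kl in F u) (cabs (c kl))%:E =
     (r ^+ (u.1 + u.2))^-1%:E *
      \esum_(kl in F u) (cabs (c kl) * r ^+ ((s kl).1 + (s kl).2))%:E)%E.
    rewrite -esumZ ?invr_ge0//; last by move=> i _; rewrite lee_fin mulr_ge0 ?cabs_ge0.
    apply: eq_esum => i [_ si]; rewrite (_ : s i = u)// -EFinM mulrCA mulVf ?mulr1//.
    by rewrite expf_neq0// gt_eqF.
  rewrite lte_mul_pinfty// ?lee_fin ?invr_ge0//.
  apply: (@le_lt_trans _ _ (M * N)%:E); last exact: ltry.
  apply: le_trans key; apply: esum_subset => // kl _.
  by rewrite lee_fin mulr_ge0 ?cabs_ge0.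
exists (fun u => csum (F u) c).
  apply: le_trans key; rewrite (esum_fibers s); last first.
    by move=> kl _; rewrite lee_fin mulr_ge0 ?cabs_ge0.
  apply: le_esum => u _; rewrite mulrC EFinM.
  rewrite (@eq_esum _ _ _ _ (fun kl => (r ^+ (u.1 + u.2))%:E * (cabs (c kl))%:E)%E); last first.
    by move=> kl [_ si]; rewrite (_ : s kl = u)// mulrC.
  rewrite esumZ//; last by move=> i _; rewrite lee_fin cabs_ge0.
  by rewrite lee_wpmul2l ?lee_fin// csum_le.
move=> x xp; have fs := series_summable aM xp; have gs := series_summable bN xp.
have [fgs fgE] := csum_prod fs gs.
rewrite fE// gE// -fgE (csum_fibers s)//; apply: eq_csum => u _.
rewrite mulrC -csumZ; last exact: csm.
apply: eq_csum => kl [_ /= <-].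
by rewrite mulrACA -rmorphM -monomialD mulrC.
Qed.

Lemma has_seriesX p r M f n : 0 < r -> has_series p r M f ->
  has_series p r (M ^+ n) (fun x => f x ^+ n).
Proof.
move=> r0 fs; elim: n => [|n ih].
  by rewrite expr0 -[X in has_series _ _ X _]cabs1; exact: has_series_cst.
rewrite exprS; apply: eq_has_series (fun x => esym (exprS _ _)) _.
exact: has_seriesM.
Qed.

Lemma in_square_shift p v r x : in_square p r (x + v) <-> in_square (p - v) r x.
Proof. by split => H i; have := H i; rewrite !mxE opprB addrA. Qed.

Lemma has_series_shift p v r M f : has_series p r M f ->
  has_series (p - v) r M (fun x => f (x + v)).
Proof.
move=> [a aM fE]; exists a => // x /in_square_shift xp; rewrite fE//.
by apply: eq_csum => mn _; rewrite /monomial !mxE !opprB !addrA.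
Qed.

(** Around [q], each coordinate of x - p is a constant of modulus at most [r] plus a coordinate of x
    - q, so its norm at radius [r] is at most 2r. A monomial then has norm at most its weight at
    radius 2r, and the original norm bounds the new one. *)
Lemma has_series_recenter p q r M f : 0 < r -> in_square p r q ->
  has_series p (r *+ 2) M f -> has_series q r M f.
Proof.
move=> r0 qp [a aM fE].
pose m (mn : nat * nat) (x : vec) : C :=
  a mn * (((x ord0 0 - p ord0 0)%:C) ^+ mn.1 * ((x ord_max 0 - p ord_max 0)%:C) ^+ mn.2).
have [b bM gE] : has_series q r M (fun x => csum setT (fun mn => m mn x)).
  apply: (has_series_csum (M := fun mn => cabs (a mn) * (r *+ 2) ^+ (mn.1 + mn.2))) => // mn _.
  apply: has_seriesZ; first exact: ltW.
  rewrite exprD; apply: has_seriesM => //; apply: has_seriesX => //.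
    apply: (@has_series_le _ r _ (cabs ((q ord0 0 - p ord0 0)%:C) + r)) => //.
      exact: ltW.
      by rewrite cabs_real mulr2n lerD2r qp.
    apply: (eq_has_series (f := fun x => (q ord0 0 - p ord0 0)%:C + (x ord0 0 - q ord0 0)%:C)).
      by move=> x; rewrite -rmorphD /=; congr _%:C; lra.
    apply: has_seriesD; [exact: ltW|exact: has_series_cst|].
    exact: (has_series_coord _ false (ltW r0)).
  apply: (@has_series_le _ r _ (cabs ((q ord_max 0 - p ord_max 0)%:C) + r)) => //.
    exact: ltW.
    by rewrite cabs_real mulr2n lerD2r qp.
  apply: (eq_has_series (f := fun x => (q ord_max 0 - p ord_max 0)%:C + (x ord_max 0 - q ord_max 0)%:C)).
    by move=> x; rewrite -rmorphD /=; congr _%:C; lra.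
  apply: has_seriesD; [exact: ltW|exact: has_series_cst|].
  exact: (has_series_coord _ true (ltW r0)).
exists b => // x xq; rewrite -gE// fE.
  by apply: eq_csum => mn _; rewrite /m /monomial rmorphM !rmorphXn.
move=> i; have -> : x i 0 - p i 0 = (x i 0 - q i 0) + (q i 0 - p i 0) by lra.
by rewrite mulr2n (le_trans (ler_normD _ _))// lerD.
Qed.

End PowerSeries.

(** * Characters *)

Section SumsOverNat.
Context {R : realType}.

Lemma esum_nat_cvg (g : nat -> R) : (forall n, 0 <= g n) ->
  (\esum_(n in setT) (g n)%:E < +oo)%E ->
  (fun n => \sum_(0 <= k < n) g k) @ \oo --> fine (\esum_(n in setT) (g n)%:E)%E.
Proof.
move=> g0 gs.
have gs' : summable xpredT (EFin \o g).
  apply: le_lt_trans gs; apply: (@le_trans _ _ (\esum_(n in setT) `|(g n)%:E|)%E).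
    by apply: esum_subset => // n _; rewrite abse_ge0.
  by apply: le_esum => n _; rewrite gee0_abs ?lee_fin.
have c : cvg ((fun n => \sum_(0 <= k < n) g k) @ \oo).
  by apply: (@summable_cvg _ xpredT (EFin \o g)) => // n _; rewrite lee_fin.
rewrite -nneseries_esumT; last by move=> n; rewrite lee_fin.
rewrite (@summable_nneseries_lim _ xpredT (EFin \o g))//.
by move=> n _; rewrite lee_fin.
Qed.

Lemma esum_nat_lim (g : nat -> R) (l : R) : (forall n, 0 <= g n) ->
  (fun n => \sum_(0 <= k < n) g k) @ \oo --> l ->
  (\esum_(n in setT) (g n)%:E = l%:E)%E.
Proof.
move=> g0 gl; rewrite -nneseries_esumT; last by move=> n; rewrite lee_fin.
apply/cvg_lim => //.
rewrite (_ : (fun n : nat => _) = EFin \o (fun n => \sum_(0 <= k < n) g k)).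
  exact: cvg_EFin (nearW _ _) gl.
by apply/funext => n /=; rewrite -sumEFin.
Qed.

Lemma rsum_nat_cvg (f : nat -> R) : rsummable setT f ->
  (fun n => \sum_(0 <= k < n) f k) @ \oo --> rsum setT f.
Proof.
move=> /rsum_posneg[fp fn].
have p0 (y : R) : 0 <= Num.max y 0 by rewrite le_max lexx orbT.
rewrite (_ : (fun n => _) = (fun n => \sum_(0 <= k < n) Num.max (f k) 0) \-
                            (fun n => \sum_(0 <= k < n) Num.max (- f k) 0)).
  by apply: cvgB; apply: esum_nat_cvg.
apply/funext => n /=; rewrite -sumrB; apply: eq_bigr => k _.
by rewrite /Num.max; case: ltP => ?; case: ltP => ?; lra.
Qed.

Lemma rsum_nat_lim (f : nat -> R) (l : R) : rsummable setT f ->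
  (fun n => \sum_(0 <= k < n) f k) @ \oo --> l -> rsum setT f = l.
Proof. by move=> /rsum_nat_cvg fs fl; apply: cvg_unique fs fl. Qed.

Lemma exp_series (t : R) : 0 <= t ->
  (\esum_(n in setT) (t ^+ n / n`!%:R)%:E = (expR t)%:E)%E.
Proof.
move=> t0; apply: esum_nat_lim => [n|]; first by rewrite divr_ge0 ?exprn_ge0.
exact: (is_cvg_series_exp_coeff t).
Qed.

Lemma esum_geometric (q : R) : 0 <= q -> q < 1 ->
  (\esum_(n in [set: nat]) (q ^+ n)%:E = ((1 - q)^-1)%:E)%E.
Proof.
move=> q0 q1; apply: (@esum_nat_lim (fun n => q ^+ n)); first by move=> n; rewrite exprn_ge0.
have := @cvg_geometric_series R 1 q.
rewrite ger0_norm// => /(_ q1); rewrite mul1r.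
apply: cvg_trans; apply: near_eq_cvg; apply: nearW => n.
by apply: eq_bigr => k _ /=; rewrite mul1r.
Qed.

End SumsOverNat.

Lemma ord2_cases (i : 'I_2) : i = ord0 \/ i = ord_max.
Proof. by case: i => [[|[|//]] ?]; [left|right]; apply: val_inj. Qed.

Lemma sum_ord2 (V : nmodType) (F : 'I_2 -> V) : \sum_i F i = F ord0 + F ord_max.
Proof. by rewrite big_ord_recl big_ord1; congr (_ + F _); apply: val_inj. Qed.

Section Characters.
Context {R : realType}.
Local Notation C := R[i].
Local Notation vec := 'cV[R]_2.
Local Open Scope complex_scope.

Lemma dotvE (u v : vec) : dotv u v = u ord0 0 * v ord0 0 + u ord_max 0 * v ord_max 0.
Proof. by rewrite /dotv sum_ord2. Qed.

Lemma cabs_cis (t : R) : cabs (cis t) = 1.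
Proof. by rewrite /cabs /cis /= cos2Dsin2 sqrtr1. Qed.

Lemma cisD (s t : R) : cis (s + t) = cis s * cis t.
Proof.
by rewrite /cis; apply: complex_ext => /=; rewrite ?cosD// sinD addrC mulrC [sin t * _]mulrC addrC.
Qed.

Lemma cis0 : cis (0 : R) = 1.
Proof. by rewrite /cis cos0 sin0. Qed.

Lemma cisN (t : R) : cis t * cis (- t) = 1.
Proof. by rewrite -cisD subrr cis0. Qed.

Definition cis_coeff (t : R) (n : nat) : C := ('i * t%:C) ^+ n * (n`!%:R^-1)%:C.

Lemma cabs_cis_coeff t n : cabs (cis_coeff t n) = `|t| ^+ n / n`!%:R.
Proof.
rewrite cabsM cabsX cabsM !cabs_real [`|_^-1|]ger0_norm ?invr_ge0 ?ler0n// /cabs /=.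
by rewrite expr0n add0r expr1n sqrtr1 mul1r.
Qed.

Lemma cis_coeff_esum t :
  (\esum_(n in setT) (cabs (cis_coeff t n))%:E = (expR `|t|)%:E)%E.
Proof. by under eq_esum do rewrite cabs_cis_coeff; rewrite exp_series. Qed.

(** The parity factors are those of [cos_coeff] and [sin_coeff], which thus become the real and
    imaginary parts of [cis_coeff]. *)
Lemma exp_i (n : nat) : ('i : C) ^+ n =
  ((~~ odd n)%:R * (-1) ^+ n./2) +i* ((odd n)%:R * (-1) ^+ n.-1./2).
Proof.
have E : forall k, ('i : C) ^+ k.*2 = ((-1) ^+ k)%:C.
  by move=> k; rewrite -mul2n exprM sqr_i rmorphXn /= rmorphN1.
rewrite -(odd_double_half n); case: (odd n); move: (n./2) => k.
  rewrite add1n exprS E oddS odd_double /= doubleK uphalf_double.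
  by apply: complex_ext; rewrite /= ?mulr0 ?mul0r ?mul1r ?subr0 ?add0r.
by rewrite [(false + _)%N]add0n E odd_double /= doubleK mul1r mul0r.
Qed.

Lemma cis_series t : cis t = csum setT (cis_coeff t).
Proof.
have s : csummable setT (cis_coeff t) by rewrite /csummable cis_coeff_esum ltry.
have [sR sI] := csummable_ReIm s.
have E n : cis_coeff t n = (cos_coeff t n) +i* (sin_coeff t n).
  rewrite /cis_coeff exprMn exp_i -rmorphXn /= -mulrA -rmorphM /=.
  rewrite /cos_coeff /sin_coeff /=.
  by apply: complex_ext => /=; rewrite ?mulr0 ?subr0 ?add0r ?addr0 mulrA.
apply/esym; rewrite /csum /cis; congr (_ +i* _); apply: rsum_nat_lim => //.
  rewrite (_ : (fun n => _) = series (cos_coeff t)); last first.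
    by apply/funext => n; apply: eq_bigr => k _; rewrite E.
  by rewrite cos.unlock; apply: (@is_cvg_series_cos_coeff R t).
rewrite (_ : (fun n => _) = series (sin_coeff t)); last first.
  by apply/funext => n; apply: eq_bigr => k _; rewrite E.
by rewrite sin.unlock; apply: (@is_cvg_series_sin_coeff R t).
Qed.

Lemma cis_coeffZ (d t : R) n : cis_coeff (d * t) n = cis_coeff t n * (d ^+ n)%:C.
Proof.
rewrite /cis_coeff; have -> : (d * t)%:C = t%:C * d%:C :> C by rewrite -rmorphM /= mulrC.
by rewrite mulrA exprMn rmorphXn mulrAC.
Qed.

Definition char_coeff (v : vec) (mn : nat * nat) : C :=
  cis_coeff (- v ord0 0) mn.1 * cis_coeff (- v ord_max 0) mn.2.

(** The norm grows exponentially in [v] with rate [r]: a radius below the decay rate of the hoppings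
    keeps Fourier integrals and Bloch sums convergent in norm. *)
Lemma char_coeff_norm (r : R) (v : vec) : 0 <= r ->
  series_norm r (char_coeff v) = (expR (r * (`|v ord0 0| + `|v ord_max 0|)))%:E.
Proof.
move=> r0; rewrite /series_norm.
have cE t n : cabs (cis_coeff (r * t) n) = cabs (cis_coeff t n) * r ^+ n.
  by rewrite cis_coeffZ cabsM cabs_real ger0_norm// exprn_ge0.
have E mn : cabs (char_coeff v mn) * r ^+ (mn.1 + mn.2) =
    cabs (cis_coeff (r * - v ord0 0) mn.1) * cabs (cis_coeff (r * - v ord_max 0) mn.2).
  by rewrite !cE /char_coeff cabsM exprD mulrACA.
under eq_esum do rewrite E.
rewrite (esum_prod (f := fun m => cabs (cis_coeff (r * - v ord0 0) m))
   (g := fun n => cabs (cis_coeff (r * - v ord_max 0) n))); last first.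
- by rewrite cis_coeff_esum ltry.
- by move=> n; exact: cabs_ge0.
- by move=> n; exact: cabs_ge0.
have N (t : R) : `|r * - t| = r * `|t| by rewrite normrM normrN ger0_norm.
have := N (v ord_max 0); have := N (v ord0 0).
move: (r * - v ord0 0) (r * - v ord_max 0) => s t Ns Nt.
transitivity ((expR `|s|)%:E * (expR `|t|)%:E)%E.
  by congr (_ * _)%E; exact: cis_coeff_esum.
by rewrite Ns Nt mulrDr expRD.
Qed.

Lemma char_expansion (p x v : vec) : cis (- dotv x v) =
  cis (- dotv p v) * csum setT (fun mn => char_coeff v mn * (monomial p x mn)%:C).
Proof.
have s t : csummable setT (@cis_coeff t) by rewrite /csummable cis_coeff_esum ltry.
pose d i := x i 0 - p i 0.
have -> : - dotv x v = - dotv p v + (d ord0 * - v ord0 0 + d ord_max * - v ord_max 0).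
  by rewrite !dotvE /d; ring.
have [_ E] := csum_prod (s (d ord0 * - v ord0 0)) (s (d ord_max * - v ord_max 0)).
rewrite cisD; congr (_ * _); rewrite cisD.
rewrite (cis_series (d ord0 * _)) (cis_series (d ord_max * _)) -E.
apply: eq_csum => mn _.
by rewrite !cis_coeffZ /char_coeff /monomial rmorphM mulrACA.
Qed.

Lemma has_series_char p r (v : vec) : 0 <= r ->
  has_series p r (expR (r * (`|v ord0 0| + `|v ord_max 0|))) (fun x => cis (- dotv x v)).
Proof.
move=> r0; rewrite -[X in has_series _ _ X _]mul1r -(cabs_cis (- dotv p v)).
apply: (eq_has_series (f := fun x => cis (- dotv p v) *
  csum setT (fun mn => char_coeff v mn * (monomial p x mn)%:C))).
  by move=> x; rewrite -char_expansion.
apply: has_seriesZ => //; exists (char_coeff v); last by [].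
by rewrite char_coeff_norm.
Qed.

End Characters.

(** * Interpolation *)

Section PolynomialCoefficients.
Context {R : realType}.
Local Notation C := R[i].
Local Open Scope complex_scope.

(** With weights s^n, multiplication by X - x enlarges the largest weighted coefficient by a factor
    of at most s + |x| <= 2s. *)
Lemma coef_prod_XsubC_le (s : R) (xs : seq R) (n : nat) : 0 <= s ->
  (forall x, x \in xs -> `|x| <= s) ->
  cabs (\prod_(x <- xs) ('X - (x%:C)%:P : {poly C}))`_n * s ^+ n <= (2 * s) ^+ size xs.
Proof.
move=> s0; elim: xs n => [n _|x xs ih n xss].
  rewrite big_nil coef1 /=; case: n => [|n]; first by rewrite cabs1 mulr1 expr0.
  by rewrite cabs0 mul0r.
have xs_le : `|x| <= s by apply: xss; rewrite in_cons eqxx.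
have {}ih k := ih k (fun y yxs => xss y (mem_behead (s := x :: xs) yxs)).
rewrite big_cons; set q := \prod_(x <- xs) _ in ih *.
rewrite mulrBl coefB coefXM coefCM /=.
apply: (@le_trans _ _ (cabs (if n == 0%N then 0 else q`_n.-1) * s ^+ n +
   cabs (x%:C * q`_n) * s ^+ n)).
  by rewrite -mulrDl ler_wpM2r ?exprn_ge0// cabsB.
have H : cabs (x%:C * q`_n) * s ^+ n <= s * (2 * s) ^+ size xs.
  by rewrite cabsM cabs_real -mulrA ler_pM// mulr_ge0 ?cabs_ge0 ?exprn_ge0.
have -> : (2 * s) ^+ (size xs).+1 = s * (2 * s) ^+ size xs + s * (2 * s) ^+ size xs.
  by rewrite exprS; set B := _ ^+ size xs; ring.
rewrite lerD//; case: n {H} => [|n].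
  by rewrite eqxx cabs0 mul0r ?mulr_ge0 ?exprn_ge0 ?mulr_ge0.
by rewrite exprS mulrCA ler_wpM2l//; exact: ih.
Qed.

(** Up to scaling, these are the denominators of Lagrange interpolation at equally spaced nodes; the
    indices below [i] give the first factorial and those above it the second. *)
Lemma prod_dist_nodes (N : nat) (i : 'I_N.+1) :
  \prod_(j < N.+1 | j != i) `|i%:R - j%:R| = (i`! * (N - i)`!)%:R :> R.
Proof.
rewrite natrM -(big_mkord (fun j => j != i) (fun j => `|i%:R - j%:R : R|)).
rewrite (big_cat_nat (n := i))//=; last by rewrite ltnW.
rewrite [X in _ * X]big_ltn_cond ?eqxx//=; congr (_ * _).
  rewrite fact_prod big_add1 /= [RHS]natr_prod big_nat_rev /= big_nat_cond [RHS]big_nat_cond.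
  apply: eq_big => j; rewrite add0n ?andbT.
    case: (ltnP j i) => //= ji.
    by rewrite neq_ltn; apply/orP; left; rewrite ltn_subrL (leq_ltn_trans _ ji).
  move=> /andP[/= ji _].
  by rewrite natrB// opprB addrC subrK ger0_norm ?ler0n.
rewrite fact_prod [in RHS]big_add1 /= [RHS]natr_prod -{1}[i.+1]add0n big_addn subSS.
rewrite big_nat_cond [RHS]big_nat_cond.
apply: eq_big => j; rewrite ?andbT /=.
  rewrite (_ : (j + i.+1 == i)%N = false) ?andbT//.
  by apply/negbTE; rewrite neq_ltn; apply/orP; right; rewrite addnS ltnS leq_addl.
move=> _; rewrite distrC -natrB ?addnS -?addSn ?addnK ?leq_addl//.
by rewrite ger0_norm.
Qed.

Lemma pow_fact_le (x : R) (n : nat) : 0 <= x -> x ^+ n / n`!%:R <= expR x.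
Proof.
move=> x0; rewrite -lee_fin -exp_series//.
rewrite -(@esum_set1 _ _ n (fun n => (x ^+ n / n`!%:R)%:E)).
  by apply: esum_subset => // k _; rewrite lee_fin divr_ge0 ?exprn_ge0.
by rewrite lee_fin divr_ge0 ?exprn_ge0.
Qed.

(** The difference of the two sides has degree at most [N] and [N.+1] distinct roots. *)
Lemma lagrange_interpolation (N : nat) (x : 'I_N.+1 -> C) (p : {poly C}) :
  injective x -> (size p <= N.+1)%N ->
  p = \sum_i (p.[x i] / \prod_(j | j != i) (x i - x j)) *:
        \prod_(j | j != i) ('X - (x j)%:P).
Proof.
move=> xi sp; apply/eqP; rewrite -subr_eq0; apply/eqP.
set q := _ - _.
have sq : (size q <= N.+1)%N.
  rewrite (leq_trans (size_polyD _ _))// geq_max size_polyN sp /=.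
  apply: (leq_trans (size_sum _ _ _)); apply/bigmax_leqP => i _.
  rewrite (leq_trans (size_scale_leq _ _))// -big_filter size_prod_XsubC ltnS.
  by rewrite size_filter -sum1_count sum1_card cardC1 card_ord.
apply/eqP; apply: contraTT sq => q0; rewrite -ltnNge.
rewrite -[X in (X < _)%N](card_ord N.+1) cardE -(size_map x).
apply: (max_poly_roots q0); last by rewrite map_inj_uniq ?enum_uniq.
apply/allP => _ /mapP[k _ ->]; rewrite rootE hornerD hornerN horner_sum.
rewrite (bigD1 k)//= [X in _ - (_ + X)]big1 ?addr0; last first.
  move=> i ik; rewrite hornerZ horner_prod [X in _ * X](bigD1 k) 1?eq_sym//=.
  by rewrite hornerXsubC subrr mul0r mulr0.
rewrite hornerZ horner_prod.
under [X in _ / _ * X]eq_bigr do rewrite hornerXsubC.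
rewrite divfK ?subrr//; apply/prodf_neq0 => j jk.
by rewrite subr_eq0 (inj_eq xi) eq_sym.
Qed.

(** One factor 2 of the 4 comes from the coefficients of the node polynomials, the other from the
    sum of the binomials; [expR 1] comes from (N+1)^N / N! <= e^(N+1). *)
Definition interpolation_const : R := 4%:R * expR 1.

(* Lagrange interpolation at [N.+1] equally spaced nodes of [[0, s]]; the loss is only
   exponential in the degree [N]. *)
Lemma poly_coef_le (N : nat) (s d : R) (p : {poly C}) (n : nat) :
  0 < s -> (size p <= N.+1)%N ->
  (forall t, 0 <= t <= s -> cabs p.[t%:C] <= d) ->
  cabs p`_n * s ^+ n <= interpolation_const ^+ N.+1 * d.
Proof.
move=> s0 sp pd.
have d0 : 0 <= d by apply: le_trans (cabs_ge0 _) (pd 0 _); rewrite lexx ltW.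
(* Dividing by [N.+1] instead of [N] covers degree 0; the last node is then short of [s], which is
   harmless. *)
pose h := s / N.+1%:R; have h0 : 0 < h by rewrite divr_gt0.
pose x (i : 'I_N.+1) : R := h * i%:R.
have x_s i : 0 <= x i <= s.
  rewrite mulr_ge0 ?(ltW h0)//= /x /h -mulrA ler_piMr ?(ltW s0)//.
  by rewrite ler_pdivrMl// mulr1 ler_nat ltnW.
have xi : injective (fun i => (x i)%:C).
  move=> i j [] /(mulfI (lt0r_neq0 h0)) /eqP.
  by rewrite eqr_nat => /eqP /val_inj.
have fact0 k : (0 : R) < k`!%:R by rewrite ltr0n fact_gt0.
have node i : cabs (\prod_(j | j != i) ((x i)%:C - (x j)%:C)) =
    h ^+ N * (i`! * (N - i)`!)%:R.
  rewrite cabs_prod -prod_dist_nodes.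
  under eq_bigr do rewrite -rmorphB cabs_real -mulrBr normrM (gtr0_norm h0).
  rewrite big_split /= prodr_const; congr (_ ^+ _ * _).
  by have := cardC1 i; rewrite card_ord /=; move=> ->.
rewrite (lagrange_interpolation xi sp) coef_sum.
have coef i : cabs (\prod_(j | j != i) ('X - ((x j)%:C)%:P : {poly C}))`_n * s ^+ n <=
    (2 * s) ^+ N.
  pose r := [seq x j | j <- index_enum 'I_N.+1 & j != i].
  have -> : \prod_(j | j != i) ('X - ((x j)%:C)%:P : {poly C}) =
      \prod_(y <- r) ('X - (y%:C)%:P) by rewrite big_map big_filter.
  have <- : size r = N.
    by rewrite size_map size_filter -sum1_count sum1_card cardC1 card_ord.
  apply: coef_prod_XsubC_le; first exact: ltW.
  by move=> _ /mapP[j _ ->]; have /andP[? ?] := x_s j; rewrite ger0_norm.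
(* The inverse of i! (N-i)! is written as a binomial over N!, so that the sum over the nodes is 2^N
   / N!. *)
apply: (@le_trans _ _ (\sum_(i < N.+1) (d * (2 * s) ^+ N / h ^+ N) * ('C(N, i)%:R / N`!%:R))).
  apply: (@le_trans _ _ (\sum_(i < N.+1) cabs (((p.[(x i)%:C] / \prod_(j | j != i) ((x i)%:C - (x j)%:C)) *:
        \prod_(j | j != i) ('X - ((x j)%:C)%:P))`_n) * s ^+ n)).
    by rewrite -mulr_suml ler_wpM2r ?exprn_ge0 ?(ltW s0)// cabs_sum.
  apply: ler_sum => i _; rewrite coefZ cabsM cabsM cabsV node.
  have iN : (i <= N)%N by rewrite -ltnS.
  have -> : 'C(N, i)%:R / N`!%:R = ((i`! * (N - i)`!)%:R)^-1 :> R.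
    rewrite -(bin_fact iN) natrM invfM mulrA mulfV ?mul1r//.
    by rewrite pnatr_eq0 -lt0n bin_gt0.
  have := coef i; set L := cabs _ => LE; set F := (_ * _)%:R.
  have F0 : 0 < F by rewrite ltr0n muln_gt0 !fact_gt0.
  have hN : 0 < h ^+ N by rewrite exprn_gt0.
  rewrite -/L; have -> : cabs p.[(x i)%:C] / (h ^+ N * F) * L * s ^+ n =
     cabs p.[(x i)%:C] * (L * s ^+ n) * ((h ^+ N)^-1 * F^-1).
    by rewrite invfM; ring.
  rewrite -[leRHS]mulrA; apply: ler_pM; rewrite ?mulr_ge0 ?cabs_ge0 ?exprn_ge0 ?(ltW s0)//.
    by rewrite invr_ge0 ltW.
    by rewrite invr_ge0 ltW.
  by apply: ler_pM; rewrite ?mulr_ge0 ?cabs_ge0 ?exprn_ge0 ?(ltW s0)//; apply/pd/x_s.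
rewrite -mulr_sumr -mulr_suml -natr_sum.
have -> : (\sum_(i < N.+1) 'C(N, i) = 2 ^ N)%N.
  by rewrite -[2%N]/(1 + 1)%N expnDn; apply: eq_bigr => i _; rewrite !exp1n !muln1.
have -> : d * (2 * s) ^+ N / h ^+ N * ((2 ^ N)%:R / N`!%:R) =
    d * (4%:R ^+ N * (N.+1%:R ^+ N / N`!%:R)).
  have -> : 4%:R = 2 * 2 :> R by rewrite -natrM.
  have -> : s = h * N.+1%:R by rewrite /h divfK// pnatr_eq0.
  rewrite natrX !exprMn; set A := 2 ^+ N; set B := h ^+ N.
  have B0 : B != 0 by rewrite expf_neq0// gt_eqF.
  field; rewrite !expf_neq0 ?invr_eq0 ?pnatr_eq0 ?andbT//; first by rewrite -lt0n fact_gt0.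
  by rewrite gt_eqF.
rewrite mulrC ler_wpM2r// /interpolation_const exprMn ler_pM ?exprn_ge0//.
- by rewrite exprSr ler_peMr ?exprn_ge0// ler1n.
by rewrite -expRM_natl mulr1 pow_fact_le.
Qed.

End PolynomialCoefficients.

Section LocalExpansions.
Context {R : realType}.
Local Notation C := R[i].
Local Notation vec := 'cV[R]_2.
Local Open Scope complex_scope.

Lemma real_analyticP (f : vec -> C) :
  real_analytic f <-> forall p, exists r M : R, 0 < r /\ has_series p r M f.
Proof.
split => [fa p|fa p].
  have [r [a [r0 H]]] := fa p.
  (* At this corner every monomial equals its weight at radius r/2, so absolute convergence at a
     single point is finiteness of the norm. *)
  pose x : vec := \col_i (p i 0 + r / 2).
  have rr : r / 2 < r by lra.
  have xp i : x i 0 - p i 0 = r / 2 by rewrite mxE addrAC subrr add0r.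
  have [/= s _] : csummable setT (fun mn => a mn * (monomial p x mn)%:C) /\ True.
    split => //; have [//|s _] := H x; last exact: s.
    by move=> i; rewrite xp ger0_norm// divr_ge0// ltW.
  have E : series_norm (r / 2) a = (\esum_(mn in setT) (cabs (a mn * (monomial p x mn)%:C))%:E)%E.
    apply: eq_esum => mn _; rewrite cabsM cabs_real /monomial !xp -exprD ger0_norm//.
    by rewrite exprn_ge0// divr_ge0// ltW.
  have fin : (series_norm (r / 2) a)%E \is a fin_num.
    rewrite E esum_fin_num// => mn _; by rewrite lee_fin cabs_ge0.
  exists (r / 2), (fine (series_norm (r / 2) a)); split; first by rewrite divr_gt0.
  exists a; first by rewrite fineK.
  move=> y yp; have [|_ ->//] := H y.
  by move=> i; apply: le_lt_trans rr.
have [r [M [r0 [a aM fE]]]] := fa p; exists r, a; split => // x xp.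
have xp' : in_square p r x by move=> i; apply/ltW/xp.
split; first exact: series_summable aM xp'.
exact: fE.
Qed.

(** In total degree n >= N, shrinking the radius gains (s/r)^n <= (s/r)^N. The set [A] is left free:
    it is the constant term for the Lipschitz bound and a square of exponents for interpolation. *)
Lemma series_tail_norm (r s M : R) (a : nat * nat -> C) (A : set (nat * nat)) (N : nat) :
  0 <= s -> s <= r -> 0 < r -> (series_norm r a <= M%:E)%E ->
  (forall mn, ~ A mn -> (N <= mn.1 + mn.2)%N) ->
  (\esum_(mn in ~` A) (cabs (a mn) * s ^+ (mn.1 + mn.2))%:E <= ((s / r) ^+ N * M)%:E)%E.
Proof.
move=> s0 sr r0 aM AN.
have sr1 : s / r <= 1 by rewrite ler_pdivrMr// mul1r.
have sr0 : 0 <= s / r by rewrite divr_ge0// ltW.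
have w0 mn : 0 <= cabs (a mn) * r ^+ (mn.1 + mn.2).
  by rewrite mulr_ge0 ?cabs_ge0 ?exprn_ge0 ?(ltW r0).
rewrite EFinM; apply: le_trans (lee_wpmul2l _ aM); last by rewrite lee_fin exprn_ge0.
rewrite -esumZ ?exprn_ge0//; last by move=> mn _; rewrite lee_fin.
apply: (@le_trans _ _ (\esum_(mn in ~` A) ((s / r) ^+ N)%:E * (cabs (a mn) * r ^+ (mn.1 + mn.2))%:E)%E).
  apply: le_esum => mn /AN Nmn; rewrite -EFinM lee_fin mulrCA ler_wpM2l ?cabs_ge0//.
  have -> : s ^+ (mn.1 + mn.2) = (s / r) ^+ (mn.1 + mn.2) * r ^+ (mn.1 + mn.2).
    by rewrite -exprMn divfK// gt_eqF.
  by rewrite ler_wpM2r ?exprn_ge0 ?(ltW r0)// ler_wiXn2l.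
by apply: esum_subset => // mn _; rewrite mule_ge0 ?lee_fin ?exprn_ge0.
Qed.

Lemma series_tail (p x : vec) (r s M : R) (a : nat * nat -> C) (A : set (nat * nat)) (N : nat) :
  s <= r -> 0 < r -> (series_norm r a <= M%:E)%E -> in_square p s x ->
  (forall mn, ~ A mn -> (N <= mn.1 + mn.2)%N) ->
  cabs (csum setT (fun mn => a mn * (monomial p x mn)%:C)
        - csum A (fun mn => a mn * (monomial p x mn)%:C)) <= (s / r) ^+ N * M.
Proof.
move=> sr r0 aM xp AN.
have s0 : 0 <= s by apply: le_trans (xp ord0).
have sm := series_summable aM (in_square_le sr xp).
rewrite (csumID A sm) !setTI addrC addKr -lee_fin.
apply: le_trans (csum_le _ _) _; apply: le_trans (series_tail_norm s0 sr r0 aM AN).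
apply: le_esum => mn _; rewrite lee_fin cabsM cabs_real.
by rewrite ler_wpM2l ?cabs_ge0// monomial_le.
Qed.

Lemma has_series_lipschitz (p x : vec) (r s M : R) (f : vec -> C) :
  s <= r -> 0 < r -> has_series p r M f -> in_square p s x ->
  cabs (f x - f p) <= s / r * M.
Proof.
move=> sr r0 [a aM fE] xp; rewrite !fE; [|exact: in_square_center (ltW r0)|
  exact: in_square_le xp].
(* The value at the center is the constant term of the series at [x], so the difference is a tail
   starting in degree 1. *)
have H : csum setT (fun mn => a mn * (monomial p p mn)%:C) =
    csum [set (0, 0)%N] (fun mn => a mn * (monomial p x mn)%:C).
  rewrite csum_set1 (csum_single (x := (0, 0)%N)); first by rewrite /monomial /= !expr0.
  move=> [[|m] n]; rewrite /monomial !subrr /= expr0n /= ?mul0r ?mulr0//.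
  by case: n => [|n]// _; rewrite expr0n /= ?mul0r ?mulr0.
rewrite H -[s / r]expr1; apply: series_tail => //.
by move=> [[|m] [|n]] //= [].
Qed.

(* The Taylor polynomial of bidegree [N] is within [(s / r) ^+ N.+1 * M] of [f], so that
   its coefficients are controlled by the real values of [f] alone. *)
Lemma interpolation (p : vec) (r s M e : R) (N : nat) (f : vec -> C) :
  0 < s -> s <= r -> has_series p r M f ->
  (forall x, in_square p s x -> cabs (f x) <= e) ->
  has_series p (s / 2)
    (4%:R * (interpolation_const ^+ N.+1) ^+ 2 * (e + (s / r) ^+ N.+1 * M)
     + (s / r) ^+ N.+1 * M) f.
Proof.
move=> s0 sr [a aM fE] fe; have r0 : 0 < r by apply: lt_le_trans sr.
exists a; last first.
  move=> x xp; apply/fE/in_square_le/xp; lra.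
set K := interpolation_const ^+ N.+1; set d := e + _.
(* Truncating by bidegree leaves a polynomial of degree at most [N] in each variable, so that the
   two can be interpolated in turn; what is dropped still has total degree at least [N.+1]. *)
pose A : set (nat * nat) := [set mn | (mn.1 < N.+1)%N /\ (mn.2 < N.+1)%N].
have AN mn : ~ A mn -> (N.+1 <= mn.1 + mn.2)%N.
  move=> nA; rewrite leqNgt; apply/negP => lt; apply: nA; split.
    by apply: leq_ltn_trans lt; exact: leq_addr.
  by apply: leq_ltn_trans lt; exact: leq_addl.
pose e2 (mn : 'I_N.+1 * 'I_N.+1) : nat * nat := (val mn.1, val mn.2).
have be : set_bij setT A e2.
  split.
  - by move=> [m n] _; split => /=.
  - by move=> [m n] [m' n'] _ _ [/val_inj -> /val_inj ->].
  - by move=> [m n] [/= mN nN]; exists (Ordinal mN, Ordinal nN).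
(* Interpolating [P y] in the first variable bounds the values of [Q], and interpolating [Q] in the
   second bounds its coefficients: one factor [K] for each variable. *)
have coef m n : A (m, n) -> cabs (a (m, n)) * s ^+ (m + n) <= K ^+ 2 * d.
  move=> [/= mN nN].
  have sm0 k : 0 < s ^+ k by rewrite exprn_gt0.
  pose P (y : R) : {poly C} := \poly_(m < N.+1) \sum_(n < N.+1) a (m, val n) * (y%:C) ^+ n.
  pose Q : {poly C} := \poly_(n < N.+1) a (m, n).
  have PQ y : (P y)`_m = Q.[y%:C].
    by rewrite coef_poly mN horner_poly.
  have Pd y t : 0 <= y <= s -> 0 <= t <= s -> cabs (P y).[t%:C] <= d.
    move=> /andP[y0 ys] /andP[t0 ts].
    pose x : vec := vec2 (p ord0 0 + t) (p ord_max 0 + y).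
    have x0 : x ord0 0 - p ord0 0 = t by rewrite mxE /= addrAC subrr add0r.
    have x1 : x ord_max 0 - p ord_max 0 = y by rewrite mxE /= addrAC subrr add0r.
    have xp : in_square p s x.
      move=> i; have [->|->] := ord2_cases i.
      - by rewrite x0 ger0_norm.
      - by rewrite x1 ger0_norm.
    have -> : (P y).[t%:C] = csum A (fun mn => a mn * (monomial p x mn)%:C).
      rewrite (csum_fin _ be) horner_poly -(pair_bigA _ (fun m n : 'I_N.+1 =>
        a (val m, val n) * (monomial p x (val m, val n))%:C)) /=.
      apply: eq_bigr => k _; rewrite mulr_suml; apply: eq_bigr => l _.
      rewrite /monomial /= x0 x1 rmorphM !rmorphXn /=; set T := _ ^+ k; ring.
    have := series_tail sr r0 aM xp AN; rewrite -fE; last exact: in_square_le xp.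
    set S := csum A _ => H.
    have -> : S = f x - (f x - S) by rewrite opprB addrC subrK.
    by rewrite (le_trans (cabsB _ _))// lerD// fe.
  have Qd y : 0 <= y <= s -> cabs Q.[y%:C] <= K * d / s ^+ m.
    move=> ys; rewrite ler_pdivlMr// -PQ; apply: poly_coef_le => //.
      exact: size_poly.
    by move=> t; exact: Pd.
  have : cabs Q`_n * s ^+ n <= K * (K * d / s ^+ m).
    by apply: poly_coef_le Qd => //; exact: size_poly.
  rewrite coef_poly nN !mulrA ler_pdivlMr// -expr2 => H.
  by rewrite addnC exprD mulrA.
rewrite /series_norm (esumID A); last first.
  by move=> mn _; rewrite lee_fin mulr_ge0 ?cabs_ge0 ?exprn_ge0// divr_ge0// ltW.
rewrite !setTI EFinD; apply: leeD; last first.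
  apply: le_trans (series_tail_norm (ltW s0) sr r0 aM AN).
  apply: le_esum => mn _; rewrite lee_fin ler_wpM2l ?cabs_ge0//.
  by rewrite lerXn2r ?nnegrE//; lra.
have d0 : 0 <= d.
  apply: addr_ge0.
    by apply: le_trans (cabs_ge0 _) (fe p _); apply/in_square_center/ltW.
  rewrite mulr_ge0 ?exprn_ge0 ?divr_ge0 ?(ltW s0) ?(ltW r0)//.
  by rewrite -lee_fin; apply: le_trans aM; apply: esum_ge0 => mn _;
    rewrite lee_fin mulr_ge0 ?cabs_ge0 ?exprn_ge0// ltW.
have Kd : 0 <= K ^+ 2 * d by rewrite mulr_ge0// sqr_ge0.
(* The individual bounds become summable by halving the radius from [s]; the double geometric series
   is 2 * 2, the 4 of the statement. *)
pose q : R := 2^-1; have q0 : 0 <= q by rewrite invr_ge0.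
have geo : (\esum_(n in [set: nat]) (q ^+ n)%:E = (2 : R)%R%:E)%E.
  rewrite esum_geometric// ?invf_lt1// ?ltr1n// /q; congr EFin.
  by field.
apply: (@le_trans _ _ (\esum_(mn in A) (K ^+ 2 * d)%:E * (q ^+ mn.1 * q ^+ mn.2)%:E)%E).
  apply: le_esum => -[m n] /coef mnA; rewrite -EFinM lee_fin /=.
  by rewrite exprMn -exprD mulrA; apply: ler_wpM2r => //; rewrite exprn_ge0.
rewrite esumZ//; last by move=> mn _; rewrite lee_fin mulr_ge0 ?exprn_ge0.
have -> : 4%:R * K ^+ 2 * d = K ^+ 2 * d * 4%:R by rewrite -mulrA mulrC.
rewrite [leRHS]EFinM lee_wpmul2l ?lee_fin//.
apply: (@le_trans _ _ (\esum_(mn in setT) (q ^+ mn.1 * q ^+ mn.2)%:E)%E).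
  by apply: esum_subset => // mn _; rewrite lee_fin mulr_ge0 ?exprn_ge0.
rewrite (esum_prod (f := fun n => q ^+ n) (g := fun n => q ^+ n)); last first.
- by rewrite geo ltry.
- by move=> n; rewrite exprn_ge0.
- by move=> n; rewrite exprn_ge0.
by rewrite geo -EFinM -natrM.
Qed.

End LocalExpansions.

(** * Lattices *)

Section NormOne.
Context {R : realType}.
Local Notation vec := 'cV[R]_2.

Definition norm1 (u : vec) : R := `|u ord0 0| + `|u ord_max 0|.

Lemma norm1_ge0 u : 0 <= norm1 u.
Proof. by rewrite addr_ge0. Qed.

Lemma norm1D u v : norm1 (u + v) <= norm1 u + norm1 v.
Proof. by rewrite /norm1 !mxE addrACA lerD// ler_normD. Qed.

Lemma norm1N u : norm1 (- u) = norm1 u.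
Proof. by rewrite /norm1 !mxE !normrN. Qed.

Lemma norm1_norm2 u : norm1 u <= 2 * norm2 u.
Proof.
rewrite /norm2 dotvE -!expr2 mulr_natl mulr2n.
by apply: lerD; rewrite -sqrtr_sqr ler_sqrt ?addr_ge0 ?sqr_ge0// ?lerDl ?lerDr sqr_ge0.
Qed.

Lemma norm1_square p r x : in_square p r x -> norm1 (x - p) <= r + r.
Proof. by move=> H; rewrite /norm1 !mxE lerD. Qed.

Lemma norm1_mulmx (M : 'M[R]_2) : exists2 c : R, 0 < c &
  forall u : vec, norm1 (M *m u) <= c * norm1 u.
Proof.
(* The extra 1 makes the constant positive, so that it can serve as a divisor. *)
pose c := \sum_i \sum_j `|M i j| + 1.
have S0 : 0 <= \sum_i \sum_j `|M i j| by apply: sumr_ge0 => i _; exact: sumr_ge0.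
exists c; first by rewrite /c; lra.
move=> u; apply: (@le_trans _ _ ((\sum_i \sum_j `|M i j|) * norm1 u)); last first.
  by rewrite ler_wpM2r ?norm1_ge0// /c; lra.
have H i : `|(M *m u) i 0| <= (\sum_j `|M i j|) * norm1 u.
  rewrite mxE mulr_suml (le_trans (ler_norm_sum _ _ _))//; apply: ler_sum => j _.
  rewrite normrM ler_wpM2l// /norm1.
  have [->|->] := ord2_cases j.
  by rewrite lerDl.
  by rewrite lerDr.
by rewrite sum_ord2 mulrDl /norm1 lerD.
Qed.

End NormOne.

Section LatticeSums.
Context {R : realType}.
Local Notation vec := 'cV[R]_2.

(** A translation of the integers brings [t] into [0, 1], at the price of the factor [expR c]; this
    makes [K] uniform in [t]. Two geometric series remain. *)
Lemma esum_exp_int (c : R) : 0 < c -> exists2 K : R, 0 <= K & forall t : R,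
  (\esum_(n in [set: int]) (expR (- (c * `|t + n%:~R|)))%:E <= K%:E)%E.
Proof.
move=> c0; pose q := expR (- c).
have q0 : 0 <= q by exact: expR_ge0.
have q1 : q < 1 by rewrite expR_lt1 oppr_lt0.
pose K1 := (1 - q)^-1; have K10 : 0 <= K1 by rewrite invr_ge0 subr_ge0 ltW.
exists (expR c * (K1 + K1)); first by rewrite mulr_ge0 ?expR_ge0 ?addr_ge0.
move=> t; pose f := Num.floor t; pose s := t - f%:~R.
have s0 : 0 <= s by rewrite subr_ge0 Num.Theory.floor_le.
have s1 : s <= 1.
  by rewrite lerBlDl addrC; have := Num.Theory.floorD1_gt t; rewrite intrD => /ltW; rewrite addrC.
have be : set_bij [set: int] [set: int] (fun n => n - f).
  split => //; first by move=> x y _ _ /addIr.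
  by move=> n _; exists (n + f) => //; rewrite addrK.
rewrite (reindex_esum _ _ _ _ be).
apply: (@le_trans _ _ (\esum_(n in [set: int]) (expR c)%:E * (q ^+ `|n|%N)%:E)%E).
  apply: le_esum => n _; rewrite -EFinM lee_fin -expRM_natl -expRD ler_expR.
  have -> : t + (n - f)%:~R = s + n%:~R by rewrite intrB /s; ring.
  have : `|n%:~R : R| <= `|s + n%:~R| + `|s|.
    by have := ler_normB (s + n%:~R) s; rewrite addrC addKr.
  rewrite (ger0_norm s0) -[`|n|%N%:R]/((`|n|%N)%:Z%:~R) abszE -intr_norm => H.
  have {}H : `|n|%:~R <= `|s + n%:~R| + 1 :> R by apply: (le_trans H); rewrite lerD2l.
  by have := ler_wpM2l (ltW c0) H; rewrite mulrDr mulr1 mulrN (mulrC _ c); lra.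
rewrite esumZ ?expR_ge0//; last by move=> n _; rewrite lee_fin exprn_ge0.
rewrite [leRHS]EFinM lee_wpmul2l ?lee_fin ?expR_ge0//.
rewrite (esumID [set n : int | 0 <= n]); last by move=> n _; rewrite lee_fin exprn_ge0.
rewrite !setTI EFinD; apply: leeD.
  rewrite (reindex_esum [set: nat] _ Posz); first by rewrite esum_geometric.
  split => //; first by move=> m n _ _ [].
  by move=> [n|n] //= _; exists n.
rewrite (reindex_esum [set: nat] _ Negz); last first.
  split => //; first by move=> m n _ _ [].
  by move=> [n|n] //= _; exists n.
rewrite -esum_geometric//; apply: le_esum => n _.
by rewrite lee_fin /= exprS ler_piMl ?exprn_ge0// ltW.
Qed.

Definition intvec (z : int * int) : 'cV[int]_2 :=
  \col_(i < 2) (if i == ord0 then z.1 else z.2).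

Lemma lattice_bij (M : 'M[R]_2) : M \in unitmx ->
  set_bij [set: int * int] (lattice_of M) (fun z => M *m map_mx intr (intvec z)).
Proof.
move=> uM; split.
- by move=> z _; exists (intvec z).
- move=> [z z'] [w w'] _ _ /(congr1 (mulmx (invmx M))); rewrite !mulKmx// => /matrixP H.
  have := H ord0 0; have := H ord_max 0; rewrite !mxE /=.
  by move=> /intr_inj -> /intr_inj ->.
- move=> _ [n _ <-]; exists (n ord0 0, n ord_max 0) => //; congr (_ *m map_mx _ _).
  apply/matrixP => i j; rewrite mxE ord1 /=.
  by have [->|->] := ord2_cases i.
Qed.

(** In coordinates with respect to [M] the exponential is dominated by a product of two
    one-dimensional ones, whose sums do not see the offset [p]. *)
Lemma lattice_sum (M : 'M[R]_2) (g : R) : M \in unitmx -> 0 < g ->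
  exists2 K : R, 0 <= K & forall p : vec,
  (\esum_(v in lattice_of M) (expR (- (g * norm1 (p + v))))%:E <= K%:E)%E.
Proof.
move=> uM g0; have [c c0 cM] := norm1_mulmx (invmx M).
have gc0 : 0 < g / c by rewrite divr_gt0.
have [K K0 HK] := esum_exp_int gc0.
exists (K * K); first exact: mulr_ge0.
move=> p; rewrite (reindex_esum _ _ _ _ (lattice_bij uM)).
pose t := invmx M *m p.
apply: (@le_trans _ _ (\esum_(z in [set: int * int])
    (expR (- (g / c * `|t ord0 0 + z.1%:~R|)) * expR (- (g / c * `|t ord_max 0 + z.2%:~R|)))%:E)%E).
  apply: le_esum => z _; rewrite lee_fin -expRD ler_expR -opprD lerN2 -mulrDr.
  have := cM (p + M *m map_mx intr (intvec z)).
  rewrite mulmxDr mulKmx// {1}/norm1 ![(_ + map_mx _ _) _ _]mxE ![map_mx _ _ _ _]mxE ![intvec _ _ _]mxE /=.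
  rewrite -/t => H; rewrite -mulrA ler_wpM2l ?(ltW g0)// mulrC ler_pdivrMr//.
  by rewrite mulrC.
rewrite (esum_prod (f := fun n : int => expR (- (g / c * `|t ord0 0 + n%:~R|)))
                   (g := fun n : int => expR (- (g / c * `|t ord_max 0 + n%:~R|)))).
- by rewrite EFinM lee_pmul// esum_ge0// => n _; rewrite lee_fin expR_ge0.
- by move=> n; exact: expR_ge0.
- by move=> n; exact: expR_ge0.
- by apply: (@le_lt_trans _ _ K%:E) => //; exact: ltry.
Qed.

End LatticeSums.

Section Lattices.
Context {R : realType}.
Local Notation C := R[i].
Local Notation vec := 'cV[R]_2.
Local Open Scope complex_scope.

Lemma dotvDl (u v w : vec) : dotv (u + v) w = dotv u w + dotv v w.
Proof. by rewrite !dotvE !mxE; ring. Qed.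

Lemma dotvDr (u v w : vec) : dotv u (v + w) = dotv u v + dotv u w.
Proof. by rewrite !dotvE !mxE; ring. Qed.

Lemma dotvNl (u v : vec) : dotv (- u) v = - dotv u v.
Proof. by rewrite !dotvE !mxE; ring. Qed.

Lemma dotvNr (u v : vec) : dotv u (- v) = - dotv u v.
Proof. by rewrite !dotvE !mxE; ring. Qed.

Lemma dotv0l (v : vec) : dotv 0 v = 0.
Proof. by rewrite !dotvE !mxE; ring. Qed.

Lemma dotv_mx (u v : vec) : dotv u v = (u^T *m v) 0 0.
Proof. by rewrite mxE; apply: eq_bigr => i _; rewrite mxE. Qed.

Lemma cis_2pi_nat (n : nat) : cis (2 * pi * n%:R : R) = 1.
Proof.
have c1 : cis (2 * pi : R) = 1.
  by rewrite mulr_natl mulr2n /cis cosDpi sinDpi cospi sinpi !opprK oppr0.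
elim: n => [|n ih]; first by rewrite mulr0 cis0.
by rewrite [n.+1%:R]mulrSr mulrDr mulr1 cisD ih c1 mulr1.
Qed.

Lemma cis_2pi_int (n : int) : cis (2 * pi * n%:~R : R) = 1.
Proof.
case: n => n; first exact: cis_2pi_nat.
have := cisN (2 * pi * n.+1%:R : R); rewrite cis_2pi_nat mul1r => H; rewrite -[RHS]H.
by rewrite NegzE mulrNz mulrN.
Qed.

(** For the fractional part [s], the double angle formula gives sin(pi s) = 0, whereas the sine is
    positive on (0, pi). *)
Lemma cis_2pi_eq1 (t : R) : cis (2 * pi * t) = 1 -> exists n : int, t = n%:~R.
Proof.
move=> H; pose n := Num.floor t; pose s := t - n%:~R; exists n.
have tE : t = s + n%:~R by rewrite subrK.
move: H; rewrite {1}tE mulrDr cisD cis_2pi_int mulr1 => -[c1 _].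
have s0 : 0 <= s by rewrite subr_ge0 Num.Theory.floor_le.
have s1 : s < 1.
  by rewrite ltrBlDl; have := Num.Theory.floorD1_gt t; rewrite intrD addrC.
have [s00|sn0] := eqVneq s 0; first by rewrite tE s00 add0r.
have : 0 < sin (pi * s).
  have sp : 0 < s by rewrite lt_neqAle eq_sym sn0.
  by rewrite sin_gt0_pi// mulr_gt0 ?pi_gt0//= gtr_pMr ?pi_gt0.
have : sin (pi * s) ^+ 2 = 0.
  have := cos_mulr2n (pi * s); rewrite -[(pi * s) *+ 2]mulr_natl mulrA c1 cos2sin2; lra.
by move=> /eqP; rewrite expf_eq0 /= => /eqP ->; rewrite ltxx.
Qed.

Lemma lattice0 (M : 'M[R]_2) : lattice_of M 0.
Proof. by exists 0 => //; rewrite map_mx0 mulmx0. Qed.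

Lemma latticeD (M : 'M[R]_2) u v : lattice_of M u -> lattice_of M v -> lattice_of M (u + v).
Proof. by move=> [m _ <-] [n _ <-]; exists (m + n) => //; rewrite map_mxD mulmxDr. Qed.

Lemma latticeN (M : 'M[R]_2) u : lattice_of M u -> lattice_of M (- u).
Proof. by move=> [m _ <-]; exists (- m) => //; rewrite map_mxN mulmxN. Qed.

Lemma latticeB (M : 'M[R]_2) u v : lattice_of M u -> lattice_of M v -> lattice_of M (u - v).
Proof. by move=> Mu Mv; apply/latticeD/latticeN. Qed.

Lemma rotation_orthogonal (t : R) : (rotation t)^T *m rotation t = 1%:M.
Proof.
apply/matrixP => i j; rewrite mxE sum_ord2 !mxE /=.
have := cos2Dsin2 t; rewrite !expr2.
by have [->|->] := ord2_cases i; have [->|->] := ord2_cases j => /= H; rewrite ?mulrNN; lra.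
Qed.

Lemma lattice_const_gt0 : 0 < lattice_const :> R.
Proof. by rewrite mulr_gt0 ?divr_gt0 ?sqrtr_gt0. Qed.

Lemma untwisted_basis_unit : untwisted_basis \in @unitmx R 2.
Proof.
rewrite unitmxZ; last by rewrite unitfE gt_eqF// divr_gt0 ?lattice_const_gt0.
have s3 : Num.sqrt 3%:R != 0 :> R by rewrite gt_eqF// sqrtr_gt0.
(* The inverse of the matrix with columns (2, 0) and (1, sqrt 3). *)
pose V : 'M[R]_2 := \matrix_(i < 2, j < 2)
  if i == ord0 then (if j == ord0 then 2^-1 else - (2 * Num.sqrt 3%:R)^-1)
  else (if j == ord0 then 0 else (Num.sqrt 3%:R)^-1).
suff /mulmx1_unit[] : row_mx (vec2 2%:R 0) (vec2 1 (Num.sqrt 3%:R)) *m V = 1%:M by [].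
apply/matrixP => i j; rewrite mxE sum_ord2.
have -> : row_mx (vec2 2%:R 0) (vec2 1 (Num.sqrt 3%:R)) i (ord0 : 'I_(1 + 1)) = vec2 2%:R 0 i 0 :> R.
  by rewrite -(row_mxEl (vec2 2%:R 0) (vec2 1 (Num.sqrt 3%:R)) i 0); congr (row_mx _ _ _ _); apply: val_inj.
have -> : row_mx (vec2 2%:R 0) (vec2 1 (Num.sqrt 3%:R)) i (ord_max : 'I_(1 + 1)) = vec2 1 (Num.sqrt 3%:R) i 0 :> R.
  by rewrite -(row_mxEr (vec2 2%:R 0) (vec2 1 (Num.sqrt 3%:R)) i 0); congr (row_mx _ _ _ _); apply: val_inj.
rewrite !mxE.
by have [->|->] := ord2_cases i; have [->|->] := ord2_cases j => /=; field.
Qed.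

Lemma rotation_unit (t : R) : rotation t \in unitmx.
Proof. by have /mulmx1_unit[] := rotation_orthogonal t. Qed.

Variable theta : 'I_3 -> R.

Lemma lat_basis_unit j : rotation (theta j) *m untwisted_basis \in unitmx.
Proof. by rewrite unitmx_mul rotation_unit untwisted_basis_unit. Qed.

Lemma dual_basis_unit j : dual_basis theta j \in unitmx.
Proof.
rewrite unitmx_mul rotation_unit unitmxZ ?unitmx_tr ?unitmx_inv ?untwisted_basis_unit//.
by rewrite unitfE gt_eqF// mulr_gt0// pi_gt0.
Qed.

Lemma dual_basis_lat_basis j :
  (dual_basis theta j)^T *m (rotation (theta j) *m untwisted_basis) = (2 * pi)%:M.
Proof.
rewrite trmx_mul mulmxA -(mulmxA _ _ (rotation _)) rotation_orthogonal mulmx1.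
rewrite /untwisted_dual_basis; have := untwisted_basis_unit; move: untwisted_basis => U uU.
by rewrite linearZ /= trmxK -scalemxAl mulVmx // scalemx1.
Qed.

Lemma dotv_dual_lat j (t : vec) (n : 'cV[int]_2) :
  dotv (dual_basis theta j *m t) (rotation (theta j) *m untwisted_basis *m map_mx intr n) =
  2 * pi * (t ord0 0 * (n ord0 0)%:~R + t ord_max 0 * (n ord_max 0)%:~R).
Proof.
rewrite dotv_mx trmx_mul -(mulmxA t^T) (mulmxA (dual_basis _ _)^T) dual_basis_lat_basis.
by rewrite -dotv_mx mul_scalar_mx dotvE !mxE; ring.
Qed.

Lemma cis_dual_lat j (G r : vec) : dual_lat theta j G -> lat theta j r ->
  cis (dotv G r) = 1.
Proof.
move=> [m _ <-] [n _ <-]; rewrite dotv_dual_lat !mxE -!intrM -intrD.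
exact: cis_2pi_int.
Qed.

(** Converse of [cis_dual_lat], tested on the two basis vectors: frequencies in [lat] separate the
    points of the torus with period lattice [dual_lat]. *)
Lemma dual_lat_separated j (d : vec) :
  (forall r, lat theta j r -> cis (dotv d r) = 1) -> dual_lat theta j d.
Proof.
move=> H; pose t := invmx (dual_basis theta j) *m d.
have dE : d = dual_basis theta j *m t by rewrite mulKVmx// dual_basis_unit.
have [n0 t0] : exists n : int, t ord0 0 = n%:~R.
  apply: cis_2pi_eq1; rewrite -(H _ (imageT _ (intvec (1, 0)))) [in RHS]dE dotv_dual_lat.
  by rewrite !mxE /= mulr1 mulr0 addr0.
have [n1 t1] : exists n : int, t ord_max 0 = n%:~R.
  apply: cis_2pi_eq1; rewrite -(H _ (imageT _ (intvec (0, 1)))) [in RHS]dE dotv_dual_lat.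
  by rewrite !mxE /= mulr1 mulr0 add0r.
rewrite dE; exists (intvec (n0, n1)) => //; congr (_ *m _).
move: t {dE} t0 t1 => t t0 t1; apply/matrixP => i k; rewrite [k]ord1 !mxE.
by have [->|->] := ord2_cases i.
Qed.

(** The coordinates range over the closed interval, as the compactness argument of
    [quasi_periodic_uniform] runs over a closed cell. *)
Lemma cell_decomposition j (q : vec) : exists t G : vec,
  [/\ forall i, 0 <= t i 0 <= 1, dual_lat theta j G & q = dual_basis theta j *m t + G].
Proof.
pose u := invmx (dual_basis theta j) *m q.
exists (\col_i (u i 0 - (Num.floor (u i 0))%:~R)).
exists (dual_basis theta j *m map_mx intr (\col_i Num.floor (u i 0))); split.
- move=> i; rewrite mxE subr_ge0 Num.Theory.floor_le lerBlDl.
  by have := Num.Theory.floorD1_gt (u i 0); rewrite intrD => /ltW.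
- by exists (\col_i Num.floor (u i 0)).
rewrite -mulmxDr (_ : _ + _ = u) ?mulKVmx ?dual_basis_unit//.
by apply/matrixP => i k; rewrite !mxE ord1 subrK.
Qed.

Lemma lat_sum j (g : R) : 0 < g -> exists2 K : R, 0 <= K & forall p : vec,
  (\esum_(v in lat theta j) (expR (- (g * norm1 (p + v))))%:E <= K%:E)%E.
Proof. exact/lattice_sum/lat_basis_unit. Qed.

Lemma dual_lat_sum j (g : R) : 0 < g -> exists2 K : R, 0 <= K & forall p : vec,
  (\esum_(v in dual_lat theta j) (expR (- (g * norm1 (p + v))))%:E <= K%:E)%E.
Proof. exact/lattice_sum/dual_basis_unit. Qed.

End Lattices.

(** * Integration in the plane *)

Section PlaneMeasurability.
Context {R : realType}.
Local Notation C := R[i].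
Local Notation vec := 'cV[R]_2.
Local Open Scope complex_scope.

(** A form of continuity that follows from topological continuity for the hoppings and from the
    Lipschitz bound for power series, and that passes directly to [R * R]. *)
Definition square_continuous (g : vec -> R) : Prop := forall p (e : R), 0 < e ->
  exists2 d : R, 0 < d & forall x, in_square p d x -> `|g x - g p| <= e.

Lemma continuous_square (g : vec -> R) : continuous g -> square_continuous g.
Proof.
move=> cg p e e0.
have /cvgrPdist_le /(_ e e0) := cg p.
move=> /nbhs_ballP[d /= d0 H]; exists (d / 2); first by rewrite divr_gt0.
move=> x xp; rewrite distrC; apply: H; split => // i j.
rewrite ord1 /ball /= distrC (le_lt_trans (xp i))//; lra.
Qed.

Lemma vec2E (u : vec) : vec2 (u ord0 0) (u ord_max 0) = u.
Proof. by apply/matrixP => i j; rewrite mxE ord1; have [->|->] := ord2_cases i. Qed.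

Lemma in_square_vec2 (p : vec) (r x y : R) : `|x - p ord0 0| <= r ->
  `|y - p ord_max 0| <= r -> in_square p r (vec2 x y).
Proof. by move=> H1 H2 i; rewrite mxE; have [->|->] := ord2_cases i. Qed.

Definition grid (n : nat) (x : R) : R := (Num.floor (n.+1%:R * x))%:~R / n.+1%:R.

Lemma grid_dist (n : nat) (x : R) : `|grid n x - x| <= n.+1%:R^-1.
Proof.
have n0 : 0 < n.+1%:R :> R by [].
have H1 := Num.Theory.floor_le (n.+1%:R * x).
have := Num.Theory.floorD1_gt (n.+1%:R * x); rewrite intrD => H2.
have -> : grid n x - x = ((Num.floor (n.+1%:R * x))%:~R - n.+1%:R * x) / n.+1%:R.
  by rewrite /grid; field.
rewrite normrM [X in _ * X]ger0_norm ?invr_ge0// ler_piMl ?invr_ge0//.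
by rewrite ler0_norm; lra.
Qed.

(** Rounding the arguments to a grid gives functions that are constant on countably many half-open
    boxes, hence measurable, and that converge pointwise to [g]. *)
Lemma square_continuous_measurable (g : vec -> R) : square_continuous g ->
  measurable_fun [set: R * R] (fun p => g (vec2 p.1 p.2)).
Proof.
move=> cg; pose h n (p : R * R) := g (vec2 (grid n p.1) (grid n p.2)).
apply: (@measurable_fun_cvg _ _ _ _ h).
  move=> n _ Y mY; rewrite setTI.
  pose box (i : int) : set R := [set x | Num.floor (n.+1%:R * x) = i].
  have mbox i : measurable (box i).
    have -> : box i = `[i%:~R / n.+1%:R, (i + 1)%:~R / n.+1%:R[%classic.
      apply/seteqP; split => x /=; rewrite in_itv /= ler_pdivrMr// ltr_pdivlMr// mulrC.
        by move=> /eqP; rewrite Num.Theory.floor_eq.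
      by rewrite -Num.Theory.floor_eq => /eqP.
    exact: measurable_itv.
  have -> : h n @^-1` Y = \bigcup_(ij : int * int)
      (if g (vec2 (ij.1%:~R / n.+1%:R) (ij.2%:~R / n.+1%:R)) \in Y
       then box ij.1 `*` box ij.2 else set0).
    apply/seteqP; split => [p /= Yp|p /= [[i j] _]].
      exists (Num.floor (n.+1%:R * p.1), Num.floor (n.+1%:R * p.2)) => //=.
      by rewrite mem_set.
    by case: ifPn => // /set_mem /= Yij [/= bi bj]; rewrite /h /grid bi bj.
  apply: countable_bigcupT_measurable; first exact: countableP.
  by move=> ij; case: ifPn => _ //; apply: measurableX.
move=> p _; apply/cvgrPdist_le => e e0.
have [d d0 H] := cg (vec2 p.1 p.2) e e0.
near=> n; have dn : n.+1%:R^-1 <= d.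
  rewrite invf_ple ?posrE//; apply: (@le_trans _ _ n%:R); last by rewrite ler_nat.
  by near: n; exact: nbhs_infty_ger.
by rewrite distrC; apply: H; apply: in_square_vec2; rewrite mxE /=;
  apply: (le_trans (grid_dist _ _)).
Unshelve. all: by end_near. Qed.

(** By symmetry the integral is twice that over the half line, where the integrand is [c^-1] times
    the exponential density. *)
Lemma expR_norm_integral (c : R) : 0 < c ->
  (\int[@lebesgue_measure R]_x (expR (- (c * `|x|)))%:E < +oo)%E.
Proof.
move=> c0; rewrite ge0_symfun_integralT; last 3 first.
- by move=> x; exact: expR_ge0.
- move=> x; apply: continuous_comp; last exact: continuous_expR.
  apply: cvgN; apply: cvgM; first exact: cvg_cst.
  exact: norm_continuous.
- by move=> x /=; rewrite normrN.
apply: lte_mul_pinfty => //.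
have -> : (\int[@lebesgue_measure R]_(x in [set x | (0 <= x)%R]) (expR (- (c * `|x|)))%:E =
    \int[@lebesgue_measure R]_x ((c^-1)%:E * (exponential_pdf c x)%:E))%E.
  rewrite integral_mkcond; apply: eq_integral => x _; rewrite patchE.
  case: ifPn => [/set_mem /= x0|/negP x0].
    rewrite exponential_pdfE// -EFinM mulrA mulVf ?gt_eqF// mul1r.
    by rewrite ger0_norm// mulNr.
  rewrite lt0_exponential_pdf ?mule0// ltNge; apply/negP => x0'.
  by apply: x0; rewrite inE.
rewrite ge0_integralZl//.
- by rewrite integral_exponential_pdf// mule1 ltry.
- by apply/measurable_EFinP; exact: measurable_exponential_pdf.
- by move=> x _; rewrite lee_fin exponential_pdf_ge0// ltW.
- by rewrite lee_fin invr_ge0 ltW.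
Qed.

End PlaneMeasurability.

Section SumIntegralExchange.
Context d (T : measurableType d) (R : realType) (mu : {measure set T -> \bar R}).
Variable g : T -> R.
Hypothesis ig : mu.-integrable setT (EFin \o g).

Lemma esum_integral_le (f : nat -> T -> R) :
  (forall n, measurable_fun setT (f n)) -> (forall n x, 0 <= f n x) ->
  (forall x, (\esum_(n in setT) (f n x)%:E <= (g x)%:E)%E) ->
  (\esum_(n in setT) \int[mu]_x (f n x)%:E <= \int[mu]_x (g x)%:E)%E.
Proof.
move=> mf f0 fg.
rewrite -nneseries_esumT; last by move=> n; apply: integral_ge0 => x _; rewrite lee_fin.
rewrite -integral_nneseries//.
- apply: ge0_le_integral => //.
  + by move=> x _; apply: nneseries_ge0 => n _ _; rewrite lee_fin.
  + apply: ge0_emeasurable_sum => n; first by move=> x _ _; rewrite lee_fin.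
    by move=> _; exact/measurable_EFinP.
  + by have /integrableP[] := ig.
  + move=> x _. rewrite nneseries_esumT; first exact: fg.
    by move=> n; rewrite lee_fin.
- by move=> n; exact/measurable_EFinP.
- by move=> n x _; rewrite lee_fin.
Qed.

(** Dominated convergence for the partial sums, all bounded by [g]; the summability of the integrals
    comes from [esum_integral_le]. *)
Lemma Rintegral_rsum (f : nat -> T -> R) :
  (forall n, measurable_fun setT (f n)) ->
  (forall x, (\esum_(n in setT) (`|f n x|)%:E <= (g x)%:E)%E) ->
  rsummable setT (fun n => \int[mu]_(x in setT) f n x) /\
  \int[mu]_(x in setT) rsum setT (f ^~ x) = rsum setT (fun n => \int[mu]_(x in setT) f n x).
Proof.
move=> mf fg.
have fsm x : rsummable setT (f ^~ x).
  by apply: (le_lt_trans (fg x)); exact: ltry.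
have fng n x : `|f n x| <= g x.
  rewrite -lee_fin; apply: le_trans (fg x).
  rewrite -[leLHS](esum_set1 (t := n) (a := fun n => (`|f n x|)%:E))//.
  exact: esum_subset.
have fi n : mu.-integrable setT (EFin \o f n).
  apply: le_integrable ig => //; first exact/measurable_EFinP.
  by move=> x _ /=; rewrite lee_fin (le_trans (fng n x))// ler_norm.
have rs : rsummable setT (fun n => \int[mu]_(x in setT) f n x).
  apply: (@le_lt_trans _ _ (\int[mu]_x (g x)%:E)%E); last first.
    have /integrableP[mg] := ig; apply: le_lt_trans.
    apply: ge0_le_integral => //.
    + by move=> x _; rewrite lee_fin; apply: le_trans (fng 0%N x).
    + exact: measurableT_comp.
    + by move=> x _; rewrite lee_fin ler_norm.
  apply: le_trans (esum_integral_le (f := fun n x => `|f n x|) _ _ _) => //.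
    apply: le_esum => n _; rewrite EFin_normr_Rintegral//.
    by apply: le_abse_integral => //; exact/measurable_EFinP.
  by move=> n; apply: measurableT_comp.
split=> //; apply/esym/rsum_nat_lim => //.
pose S n x := \sum_(0 <= k < n) f k x.
have mS n : measurable_fun setT (S n) by exact: measurable_sum.
have Scvg x : S ^~ x @ \oo --> rsum setT (f ^~ x) by exact: rsum_nat_cvg.
have Sg n x : `|S n x| <= g x.
  rewrite -lee_fin; apply: le_trans (fg x).
  apply: (@le_trans _ _ (\sum_(0 <= k < n) (`|f k x|)%:E)%E).
    by rewrite sumEFin lee_fin ler_norm_sum.
  rewrite -nneseries_esumT//; exact: nneseries_lim_ge.
have [|||//||int_S _ cvgS] := @dominated_convergence _ _ _ mu setT measurableT
  (fun n x => (S n x)%:E) (fun x => (rsum setT (f ^~ x))%:E) (EFin \o g).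
- by move=> n; exact/measurable_EFinP.
- apply/measurable_EFinP; apply: (measurable_fun_cvg (h := S)) => // x _; exact: Scvg.
- by apply: aeW => x _; apply: cvg_EFin; [exact: nearW|exact: Scvg].
- by apply: aeW => x n _; rewrite lee_fin.
move: cvgS; rewrite -[X in _ --> X]fineK; last exact: integrable_fin_num.
move=> /fine_cvg; apply: cvg_trans; apply: near_eq_cvg; apply: nearW => n /=.
rewrite (_ : (fun x => _) = (fun x => \sum_(0 <= k < n) (f k x)%:E)%E); last first.
  by apply/funext => x; rewrite sumEFin.
rewrite integral_sum//.
have E k : (\int[mu]_x (f k x)%:E = (\int[mu]_(x in setT) f k x)%:E)%E.
  by rewrite fineK//; exact: (integrable_fin_num measurableT (fi k)).
by rewrite (eq_bigr _ (fun k _ => E k)) sumEFin.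
Qed.

End SumIntegralExchange.

Section ComplexIntegral.
Context {R : realType}.
Local Notation C := R[i].
Local Notation vec := 'cV[R]_2.
Local Open Scope complex_scope.

(* The carrier of [leb2]; it carries another display than [R * R]. *)
Local Notation plane := (measurableTypeR R * measurableTypeR R)%type.

Definition cmeasurable (F : R * R -> C) : Prop :=
  measurable_fun [set: plane] (fun p => complex.Re (F p)) /\
  measurable_fun [set: plane] (fun p => complex.Im (F p)).

Definition plane_integral (F : R * R -> C) : C :=
  (\int[leb2]_(p in setT) complex.Re (F p)) +i* (\int[leb2]_(p in setT) complex.Im (F p)).

Lemma cmeasurableM F G : cmeasurable F -> cmeasurable G ->
  cmeasurable (fun p => F p * G p).
Proof.
move=> [FR FI] [GR GI].
have E p : F p * G p =
    (complex.Re (F p) * complex.Re (G p) - complex.Im (F p) * complex.Im (G p)) +i*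
    (complex.Re (F p) * complex.Im (G p) + complex.Im (F p) * complex.Re (G p)).
  by case: (F p) (G p) => a b [c d]; apply: complex_ext.
split; under eq_fun do rewrite E /=.
  by apply: measurable_funB; apply: measurable_funM.
by apply: measurable_funD; apply: measurable_funM.
Qed.

Lemma cmeasurable_cst (c : C) : cmeasurable (fun=> c).
Proof. by split; exact: measurable_cst. Qed.

Lemma cmeasurable_real (f : R * R -> R) : measurable_fun [set: plane] f ->
  cmeasurable (fun p => (f p)%:C).
Proof. by move=> mf; split => //=; exact: measurable_cst. Qed.

Lemma cmeasurableX F n : cmeasurable F -> cmeasurable (fun p => F p ^+ n).
Proof.
move=> mF; elim: n => [|n ih]; first exact: cmeasurable_cst.
by under eq_fun do rewrite exprS; exact: cmeasurableM.
Qed.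

Lemma cmeasurable_cis (f : R * R -> R) : measurable_fun [set: plane] f ->
  cmeasurable (fun p => cis (f p)).
Proof.
move=> mf; split => /=; apply: (measurableT_comp _ mf); apply: continuous_measurable_fun.
  exact: continuous_cos.
exact: continuous_sin.
Qed.

Lemma plane_integralZ (F : R * R -> C) (t : R) :
  leb2.-integrable setT (fun p => (complex.Re (F p))%:E) ->
  leb2.-integrable setT (fun p => (complex.Im (F p))%:E) ->
  plane_integral (fun p => F p * t%:C) = plane_integral F * t%:C.
Proof.
move=> iR iI; rewrite /plane_integral; apply: complex_ext => /=;
  rewrite mulr0 ?subr0 ?add0r -RintegralZr//; apply: eq_Rintegral => p _;
  by case: (F p) => a b /=; rewrite mulr0 ?subr0 ?add0r.
Qed.

Lemma plane_integral_csum (F : nat * nat -> R * R -> C) (g : R * R -> R) :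
  leb2.-integrable setT (EFin \o g) ->
  (forall mn, cmeasurable (F mn)) ->
  (forall p, (\esum_(mn in setT) (cabs (F mn p))%:E <= (g p)%:E)%E) ->
  (\esum_(mn in setT) (cabs (plane_integral (F mn)))%:E <=
     \int[leb2]_p (g p)%:E + \int[leb2]_p (g p)%:E)%E /\
  plane_integral (fun p => csum setT (F ^~ p)) =
  csum setT (fun mn => plane_integral (F mn)).
Proof.
move=> ig mF Fg.
(* Pairs are enumerated by [nat], as the exchange with the integral is a statement about
   sequences. *)
have /card_set_bijP[e be] : ([set: nat] #= [set: nat * nat])%card.
  by rewrite card_eq_sym; exact: card_nat2.
have Fge p : (\esum_(n in setT) (cabs (F (e n) p))%:E <= (g p)%:E)%E.
  by rewrite -(reindex_esum _ _ _ (fun mn => (cabs (F mn p))%:E) be).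
have FR p : (\esum_(n in setT) (`|complex.Re (F (e n) p)|)%:E <= (g p)%:E)%E.
  by apply: le_trans (Fge p); apply: le_esum => n _; rewrite lee_fin Re_le_cabs.
have FI p : (\esum_(n in setT) (`|complex.Im (F (e n) p)|)%:E <= (g p)%:E)%E.
  by apply: le_trans (Fge p); apply: le_esum => n _; rewrite lee_fin Im_le_cabs.
have Fng n p : cabs (F (e n) p) <= g p.
  rewrite -lee_fin; apply: le_trans (Fge p).
  rewrite -[leLHS](esum_set1 (t := n) (a := fun n => (cabs (F (e n) p))%:E)) ?lee_fin ?cabs_ge0//.
  by apply: esum_subset => // k _; rewrite lee_fin cabs_ge0.
have mR n := (mF (e n)).1; have mI n := (mF (e n)).2.
have iR n : leb2.-integrable setT (fun p => (complex.Re (F (e n) p))%:E).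
  apply: le_integrable ig => //; first exact/measurable_EFinP.
  move=> p _ /=; rewrite lee_fin (le_trans (Re_le_cabs _))// (le_trans (Fng n p))//.
  exact: ler_norm.
have iI n : leb2.-integrable setT (fun p => (complex.Im (F (e n) p))%:E).
  apply: le_integrable ig => //; first exact/measurable_EFinP.
  move=> p _ /=; rewrite lee_fin (le_trans (Im_le_cabs _))// (le_trans (Fng n p))//.
  exact: ler_norm.
have [sR ER] := Rintegral_rsum ig mR FR.
have [sI EI] := Rintegral_rsum ig mI FI.
split.
  rewrite (reindex_esum _ _ _ _ be).
  apply: (@le_trans _ _ (\esum_(n in setT) \int[leb2]_p (`|complex.Re (F (e n) p)|)%:E +
     \esum_(n in setT) \int[leb2]_p (`|complex.Im (F (e n) p)|)%:E)%E).
    rewrite -esumD; try by move=> n _; apply: integral_ge0 => p _; rewrite lee_fin.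
    apply: le_esum => n _.
    apply: (@le_trans _ _ ((`|complex.Re (plane_integral (F (e n)))|)%:E + (`|complex.Im (plane_integral (F (e n)))|)%:E)%E).
      by rewrite -EFinD lee_fin cabs_le_ReIm.
    rewrite /= !EFin_normr_Rintegral//; try exact: iR; try exact: iI.
    by apply: leeD; apply: le_abse_integral => //; exact/measurable_EFinP.
  by apply: leeD; apply: (esum_integral_le ig) => // n; apply: measurableT_comp.
have bE (f : nat * nat -> C) : csum setT f = csum setT (f \o e) by exact: csum_reindex.
rewrite bE /plane_integral /csum; apply: complex_ext => /=.
  rewrite -ER; apply: eq_Rintegral => p _.
  exact: (rsum_reindex (fun mn => complex.Re (F mn p)) be).
rewrite -EI; apply: eq_Rintegral => p _.
exact: (rsum_reindex (fun mn => complex.Im (F mn p)) be).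
Qed.

Lemma expR_norm1_integrable (c : R) : 0 < c ->
  leb2.-integrable setT (fun p : R * R => (expR (- (c * (`|p.1| + `|p.2|))))%:E).
Proof.
move=> c0; have mn : measurable_fun setT (fun x : R => expR (- (c * `|x|))).
  apply: measurableT_comp => //; apply: measurable_funN; apply: measurable_funM => //.
have E (p : R * R) : expR (- (c * (`|p.1| + `|p.2|))) = expR (- (c * `|p.1|)) * expR (- (c * `|p.2|)).
  by rewrite -expRD; congr expR; ring.
have mp : measurable_fun setT (fun p : R * R => expR (- (c * (`|p.1| + `|p.2|)))).
  under eq_fun do rewrite E.
  apply: measurable_funM.
    exact: (measurableT_comp mn measurable_fst).
  exact: (measurableT_comp mn measurable_snd).
apply/integrableP; split; first exact/measurable_EFinP.
under eq_integral do rewrite gee0_abs ?lee_fin ?expR_ge0//.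
rewrite /leb2 fubini_tonelli1; last 2 first.
- exact/measurable_EFinP.
- by move=> p; rewrite lee_fin expR_ge0.
have K1 := expR_norm_integral c0; have K := K1.
have K0 : (0 <= \int[@lebesgue_measure R]_x (expR (- (c * `|x|)))%:E)%E.
  by apply: integral_ge0 => x _; rewrite lee_fin expR_ge0.
rewrite /fubini_F.
rewrite (_ : (fun x => _) = (fun x => (expR (- (c * `|x|)))%:E *
    \int[@lebesgue_measure R]_y (expR (- (c * `|y|)))%:E)%E); last first.
  apply/funext => x; under eq_integral do rewrite E /= EFinM.
  rewrite ge0_integralZl ?lee_fin ?expR_ge0//.
  exact/measurable_EFinP.
have Kf : (\int[@lebesgue_measure R]_x (expR (- (c * `|x|)))%:E)%E \is a fin_num.
  by rewrite ge0_fin_numE.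
under eq_integral do rewrite -(fineK Kf).
rewrite ge0_integralZr//.
- by rewrite lte_mul_pinfty// ltry.
- exact/measurable_EFinP.
- by rewrite lee_fin fine_ge0.
Qed.

End ComplexIntegral.

(** * Fourier transforms of exponentially decaying functions *)

Section FourierSeries.
Context {R : realType}.
Local Notation C := R[i].
Local Notation vec := 'cV[R]_2.
Local Notation plane := (measurableTypeR R * measurableTypeR R)%type.
Local Open Scope complex_scope.

Lemma cmeasurable_cis_coeff (f : R * R -> R) n : measurable_fun [set: plane] f ->
  cmeasurable (fun z => cis_coeff (f z) n).
Proof.
move=> mf; apply: cmeasurableM; last exact: cmeasurable_cst.
apply/cmeasurableX/cmeasurableM; first exact: cmeasurable_cst.
exact: cmeasurable_real.
Qed.

(** The character is expanded around [p] and integrated term by term. With [r = g / 2] its norm uses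
    half of the decay of [h] and leaves the integrable majorant [G]; the phase at [p] has modulus 1,
    so nothing depends on the center. *)
Lemma fourier_has_series (h : vec -> C) (K g : R) :
  square_continuous (fun x => complex.Re (h x)) ->
  square_continuous (fun x => complex.Im (h x)) ->
  0 < g -> (forall x, cabs (h x) <= K * expR (- (g * norm1 x))) ->
  exists r M : R, 0 < r /\ forall p, has_series p r M (fourier h).
Proof.
move=> cR cI g0 hK; pose r := g / 2; have r0 : 0 < r by rewrite divr_gt0.
pose G (z : R * R) := K * expR (- (r * (`|z.1| + `|z.2|))).
have iG : leb2.-integrable setT (EFin \o G).
  exact: (integrableZl measurableT K (expR_norm1_integrable r0)).
pose I := fine (\int[@leb2 R]_z (G z)%:E)%E.
have IE : (\int[@leb2 R]_z (G z)%:E)%E = I%:E.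
  by rewrite fineK//; exact: (integrable_fin_num measurableT iG).
pose c : R := 1 / (4 * pi ^+ 2).
exists r, (`|c| * (I + I)); split => // p.
pose w (mn : nat * nat) : R := r ^+ (mn.1 + mn.2).
have w0 mn : 0 < w mn by rewrite exprn_gt0.
(* The weight sits inside the integrand so that summing the integrals bounds the coefficient norm;
   the coefficients divide it out again. *)
pose F mn (z : R * R) : C := let v := vec2 z.1 z.2 in
  h v * cis (- dotv p v) * (char_coeff v mn * (w mn)%:C).
have mz1 : measurable_fun [set: plane] (fun z : R * R => z.1) by exact: measurable_fst.
have mz2 : measurable_fun [set: plane] (fun z : R * R => z.2) by exact: measurable_snd.
have mF mn : cmeasurable (F mn).
  apply: cmeasurableM; apply: cmeasurableM.
  - by split; [exact: (square_continuous_measurable cR)|exact: (square_continuous_measurable cI)].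
  - apply: cmeasurable_cis; apply: measurable_funN.
    under eq_fun do rewrite dotvE !mxE /=.
    by apply: measurable_funD; apply: measurable_funM => //; exact: measurable_cst.
  - rewrite /char_coeff; under eq_fun do rewrite !mxE /=.
    by apply: cmeasurableM; apply: (cmeasurable_cis_coeff _ (measurable_funN _)).
  - exact: cmeasurable_cst.
have FG z : (\esum_(mn in setT) (cabs (F mn z))%:E <= (G z)%:E)%E.
  set v := vec2 z.1 z.2.
  have -> : (\esum_(mn in setT) (cabs (F mn z))%:E = (cabs (h v))%:E * series_norm r (char_coeff v))%E.
    rewrite /series_norm -esumZ ?cabs_ge0//; last first.
      by move=> mn _; rewrite lee_fin mulr_ge0 ?cabs_ge0 ?exprn_ge0// ltW.
    apply: eq_esum => mn _; rewrite /F !cabsM cabs_cis mulr1 cabs_real.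
    by rewrite (gtr0_norm (w0 mn)) -EFinM.
  rewrite char_coeff_norm ?(ltW r0)// -EFinM lee_fin.
  apply: (@le_trans _ _ (K * expR (- (g * norm1 v)) * expR (r * norm1 v))).
    by rewrite ler_wpM2r ?expR_ge0.
  rewrite -mulrA -expRD /G (_ : - (g * norm1 v) + r * norm1 v = - (r * (`|z.1| + `|z.2|)))//.
  by rewrite /norm1 /v !mxE /= /r; lra.
have [nF _] := plane_integral_csum iG mF FG.
exists (fun mn => c%:C * (plane_integral (F mn) * ((w mn)^-1)%:C)).
  rewrite /series_norm.
  have E mn : cabs (c%:C * (plane_integral (F mn) * ((w mn)^-1)%:C)) * r ^+ (mn.1 + mn.2) =
      `|c| * cabs (plane_integral (F mn)).
    rewrite !cabsM !cabs_real [`|(w mn)^-1|]gtr0_norm ?invr_gt0// -/(w mn).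
    by rewrite -!mulrA mulVf ?mulr1// gt_eqF.
  under eq_esum do rewrite E EFinM.
  rewrite esumZ//; last by move=> mn _; rewrite lee_fin cabs_ge0.
  by rewrite EFinM lee_wpmul2l// EFinD -IE.
(* In units of its weight a monomial is at most 1 on the square, so the expansion at [x] is
   dominated by the same [G]. *)
move=> x xp; pose t mn := monomial p x mn / w mn.
have t1 mn : `|t mn| <= 1.
  by rewrite normrM normfV (gtr0_norm (w0 mn)) ler_pdivrMr// mul1r monomial_le.
pose H mn z := F mn z * (t mn)%:C.
have mH mn : cmeasurable (H mn) by apply: cmeasurableM => //; exact: cmeasurable_cst.
have HG z : (\esum_(mn in setT) (cabs (H mn z))%:E <= (G z)%:E)%E.
  apply: le_trans (FG z); apply: le_esum => mn _.
  by rewrite lee_fin cabsM cabs_real ler_piMr ?cabs_ge0.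
have [_ EH] := plane_integral_csum iG mH HG.
have Fg mn z : cabs (F mn z) <= G z.
  rewrite -lee_fin; apply: le_trans (FG z).
  rewrite -[leLHS](esum_set1 (t := mn) (a := fun n => (cabs (F n z))%:E)) ?lee_fin ?cabs_ge0//.
  by apply: esum_subset => // k _; rewrite lee_fin cabs_ge0.
have iR mn : leb2.-integrable setT (fun z => (complex.Re (F mn z))%:E).
  apply: le_integrable iG => //; first by have /measurable_EFinP := (mF mn).1.
  move=> z _ /=; rewrite lee_fin (le_trans (Re_le_cabs _))// (le_trans (Fg mn z))//.
  exact: ler_norm.
have iI mn : leb2.-integrable setT (fun z => (complex.Im (F mn z))%:E).
  apply: le_integrable iG => //; first by have /measurable_EFinP := (mF mn).2.
  move=> z _ /=; rewrite lee_fin (le_trans (Im_le_cabs _))// (le_trans (Fg mn z))//.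
  exact: ler_norm.
rewrite /fourier -/c /cintegral.
have E z : h (vec2 z.1 z.2) * cis (- dotv x (vec2 z.1 z.2)) = csum setT (H ^~ z).
  rewrite (char_expansion p) mulrA -csumZ; last first.
    have : csummable setT (H ^~ z).
      by rewrite /csummable; apply: (le_lt_trans (HG z)); exact: ltry.
    move=> _; apply: (series_summable (r := `|x ord0 0 - p ord0 0| + `|x ord_max 0 - p ord_max 0|)
      (M := expR ((`|x ord0 0 - p ord0 0| + `|x ord_max 0 - p ord_max 0|) * norm1 (vec2 z.1 z.2)))).
      by rewrite char_coeff_norm ?addr_ge0.
    by move=> i; have [->|->] := ord2_cases i; rewrite ?lerDl ?lerDr.
  apply: eq_csum => mn _; rewrite /H /F /t -[RHS]mulrA; congr (_ * _).
  by rewrite -mulrA -rmorphM /= [w mn * _]mulrC divfK// gt_eqF.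
rewrite [X in _ * X](_ : _ = plane_integral (fun z => csum setT (H ^~ z))); last first.
  by rewrite /plane_integral; congr (_ +i* _); apply: eq_Rintegral => z _; rewrite -E.
rewrite EH -csumZ; last first.
  rewrite /csummable; have [nH _] := plane_integral_csum iG mH HG.
  by apply: (le_lt_trans nH); rewrite IE -EFinD ltry.
apply: eq_csum => mn _; rewrite /H plane_integralZ//.
by rewrite -!mulrA -rmorphM /= /t [(w mn)^-1 * _]mulrC.
Qed.

(* Decay on the real plane passes to the power series coefficients, by interpolation
   with a degree proportional to [norm1 p]; this replaces a three lines theorem. *)
Lemma decaying_has_series (f : vec -> C) (r M K g : R) : 0 < r -> 0 < g ->
  (forall p, has_series p r M f) ->
  (forall x, cabs (f x) <= K * expR (- (g * norm1 x))) ->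
  exists r' K' g' : R, [/\ 0 < r', 0 < g', 0 <= K' &
    forall p, has_series p r' (K' * expR (- (g' * norm1 p))) f].
Proof.
move=> r0 g0 fs fK.
have M0 : 0 <= M by apply: has_series_ge0 (fs 0); exact: ltW.
have K0 : 0 <= K.
  have := le_trans (cabs_ge0 _) (fK 0).
  by rewrite pmulr_lge0 ?expR_gt0.
(* The loss per degree of the two-variable interpolation. *)
pose A : R := interpolation_const ^+ 2.
have A1 : 1 < A.
  have : 1 <= expR 1 :> R by rewrite ltW// expR_gt1.
  by rewrite /A /interpolation_const expr2; nra.
have A0 : 0 < A by lra.
(* With this ratio of radii the truncation error, even multiplied by the loss A^(N+1), is 2^-(N+1)
   times [M]. *)
pose rho := (2 * A)^-1; have rho0 : 0 < rho by rewrite invr_gt0 mulr_gt0.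
have rho2 : rho <= 2^-1 by rewrite lef_pV2 ?posrE ?mulr_gt0//; lra.
pose s := rho * r; have s0 : 0 < s by rewrite mulr_gt0.
have sr : s <= r by rewrite /s ler_piMl ?(ltW r0)//; lra.
pose L := ln A; have L0 : 0 < L by rewrite ln_gt0.
(* Slope of the degree: for N <= b * nu the loss A^N is at most e^(g nu / 2), half of the available
   decay. *)
pose b := g / (2 * L); have b0 : 0 < b by rewrite divr_gt0 ?mulr_gt0.
have l2 : 0 < ln 2 :> R by rewrite ln_gt0// ltr1n.
pose K1 := K * expR (g * (s + s)).
(* The first rate is what remains of the decay of the values, the second is the rate at which
   2^-(N+1) decays for a degree near b * nu. *)
pose g' := Num.min (g / 2) (b * ln 2).
have g'0 : 0 < g' by rewrite lt_min divr_gt0// mulr_gt0.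
exists (s / 2), (4%:R * (A * K1) + 5%:R * M), g'; split => //.
- by rewrite divr_gt0.
- by rewrite addr_ge0 ?mulr_ge0 ?expR_ge0 ?(ltW A0).
move=> p; pose nu := norm1 p; have nu0 : 0 <= nu := norm1_ge0 p.
pose N := Num.truncn (b * nu).
have fe x : in_square p s x -> cabs (f x) <= K1 * expR (- (g * nu)).
  move=> xp; apply: le_trans (fK x) _; rewrite /K1 -mulrA -expRD ler_wpM2l// ler_expR.
  have H : nu <= norm1 x + (s + s).
    have -> : nu = norm1 (x - (x - p)) by rewrite opprB addrC subrK.
    rewrite (le_trans (norm1D _ _))// lerD2l norm1N; exact: norm1_square.
  by have := ler_wpM2l (ltW g0) H; rewrite mulrDr; lra.
have := interpolation N s0 sr (fs p) fe.
apply: has_series_le => //; first by rewrite divr_ge0// ltW.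
have -> : s / r = rho by rewrite /s mulfK// gt_eqF.
have bnu : 0 <= b * nu by rewrite mulr_ge0// ltW.
have /andP[N1 N2] := Num.Theory.truncn_itv bnu.
rewrite -/N in N1 N2.
have AE n : A ^+ n = expR (L * n%:R) by rewrite expRM_natr lnK.
have -> : (interpolation_const ^+ N.+1) ^+ 2 = A ^+ N.+1 :> R by rewrite -!exprM mulnC.
have rhoA : rho ^+ N.+1 * A ^+ N.+1 = 2^-1 ^+ N.+1.
  by rewrite -exprMn /rho invfM mulfVK// gt_eqF.
have rhoN : rho ^+ N.+1 <= 2^-1 ^+ N.+1.
  by rewrite lerXn2r// nnegrE; [exact: ltW|rewrite invr_ge0].
have half : 2^-1 ^+ N.+1 <= expR (- (g' * nu)).
  have -> : 2^-1 = expR (- ln 2) :> R by rewrite expRN lnK// posrE.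
  rewrite -expRM_natr ler_expR mulNr lerN2.
  apply: (@le_trans _ _ (b * ln 2 * nu)).
    by rewrite ler_wpM2r// ge_min lexx orbT.
  by rewrite mulrAC (mulrC (b * nu)) ler_wpM2l ?(ltW l2)// ltW.
have Ag : A ^+ N.+1 * expR (- (g * nu)) <= A * expR (- (g' * nu)).
  rewrite exprS -mulrA ler_wpM2l ?(ltW A0)// AE -expRD ler_expR.
  have gE : g * nu = g / 2 * nu + g / 2 * nu by rewrite -mulrDl -splitr.
  rewrite gE opprD addrA; apply: (@le_trans _ _ (0 - g / 2 * nu)).
    rewrite lerD2r subr_le0; apply: (@le_trans _ _ (L * (b * nu))).
      by rewrite ler_wpM2l// ltW.
    by rewrite /b (_ : L * _ = g / 2 * nu)//; field; rewrite gt_eqF.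
  by rewrite sub0r lerN2 ler_wpM2r// ge_min lexx.
set e := expR (- (g' * nu)) in half Ag *.
set q := 2^-1 ^+ N.+1 in rhoA rhoN half *; set Q := rho ^+ N.+1 in rhoA rhoN *.
set B := A ^+ N.+1 in rhoA Ag *; set E := expR (- (g * nu)) in Ag *.
have K10 : 0 <= K1 by rewrite mulr_ge0 ?expR_ge0.
have -> : 4 * B * (K1 * E + Q * M) + Q * M = 4 * K1 * (B * E) + 4 * ((Q * B) * M) + Q * M by ring.
rewrite rhoA (_ : (4 * (A * K1) + 5 * M) * e = 4 * K1 * (A * e) + 4 * (e * M) + e * M); last by ring.
rewrite !lerD//.
- by rewrite ler_wpM2l// mulr_ge0.
- by rewrite ler_wpM2l// ler_wpM2r.
- by rewrite ler_wpM2r// (le_trans rhoN).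
Qed.

End FourierSeries.

(** * Quasi-periodic analytic functions *)

Section QuasiPeriodic.
Context {R : realType}.
Local Notation C := R[i].
Local Notation vec := 'cV[R]_2.
Local Notation plane := (measurableTypeR R * measurableTypeR R)%type.
Local Open Scope complex_scope.
Variables (theta : 'I_3 -> R) (j : 'I_3).

Lemma quasi_periodic_uniform (tau : vec) (f : vec -> C) :
  (forall q G, dual_lat theta j G -> f (q + G) = cis (- dotv G tau) * f q) ->
  real_analytic f -> exists r M : R, 0 < r /\ forall p, has_series p r M f.
Proof.
move=> fq /real_analyticP fa.
pose B (z : R * R) : vec := dual_basis theta j *m vec2 z.1 z.2.
have [c c0 cB] := norm1_mulmx (dual_basis theta j).
(* One index governs both the radius and the bound, so that compactness in its near-covering form
   yields a single [n] for the whole cell. *)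
pose P (n : nat) (z : R * R) := has_series (B z) (n.+1%:R^-1) n%:R f.
have cK : compact (`[0, 1]%classic `*` `[0, 1]%classic : set (R * R)).
  by apply: compact_setX; exact: segment_compact.
have [N _ PN] : \forall n \near \oo, (`[0, 1]%classic `*` `[0, 1]%classic : set (R * R)) `<=` P n.
  apply: (proj1 (compact_near_coveringP _) cK) => z0 _.
  have [r [M [r0 fs]]] := fa (B z0); pose r' := r / 2.
  have r'0 : 0 < r' by rewrite divr_gt0.
  pose d := r' / (2 * c); have d0 : 0 < d by rewrite divr_gt0 ?mulr_gt0.
  have [N1 _ HN1] : \forall n \near \oo, r'^-1 <= n%:R by exact: nbhs_infty_ger.
  have [N2 _ HN2] : \forall n \near \oo, M <= n%:R by exact: nbhs_infty_ger.
  exists (ball z0 d, [set n | (maxn N1 N2 <= n)%N]).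
    by split; [exact: nbhsx_ballx|exists (maxn N1 N2)].
  move=> [z n] [[/= z1 z2] nN]; rewrite /P.
  apply: (@has_series_le _ _ r' _ M) => //.
  - rewrite invf_ple ?posrE//; apply: (@le_trans _ _ n%:R); last by rewrite ler_nat.
    by apply: HN1 => /=; rewrite (leq_trans _ nN)// leq_maxl.
  - by apply: HN2 => /=; rewrite (leq_trans _ nN)// leq_maxr.
  apply: (has_series_recenter (p := B z0)) => //; last first.
    by rewrite (_ : r' *+ 2 = r)// /r' -mulr_natr divfK.
  move=> i; have -> : B z i 0 - B z0 i 0 = (B z - B z0) i 0 by rewrite !mxE.
  apply: (@le_trans _ _ (norm1 (B z - B z0))).
    by have [->|->] := ord2_cases i; rewrite /norm1 ?lerDl ?lerDr.
  rewrite -mulmxBr (le_trans (cB _))// -ler_pdivlMl// /norm1 !mxE /=.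
  have -> : c^-1 * r' = d + d by rewrite /d; field; rewrite gt_eqF.
  by rewrite lerD// distrC ltW.
exists (N.+1%:R^-1), N%:R; split; first by rewrite invr_gt0.
move=> p; have [t [G [t01 dG ->]]] := cell_decomposition theta j p.
have Pt : P N (t ord0 0, t ord_max 0).
  by apply: (PN N) => //=; rewrite !in_itv /=; split; exact: t01.
have Ept : dual_basis theta j *m t + G = B (t ord0 0, t ord_max 0) - - G.
  by rewrite opprK /B /= vec2E.
have := has_seriesZ (cis (- dotv G tau)) _ (has_series_shift (- G) Pt).
rewrite cabs_cis mul1r -Ept => H.
apply: eq_has_series (H _); last by rewrite invr_ge0.
by move=> x; rewrite -fq// subrK.
Qed.

Lemma uniform_series_bounded (f : vec -> C) (r M : R) : 0 < r ->
  (forall p, has_series p r M f) -> forall p, cabs (f p) <= M.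
Proof.
by move=> r0 fs p; apply: has_series_bound (fs p) _; apply/in_square_center/ltW.
Qed.

Lemma analytic_square_continuous (f : vec -> C) : real_analytic f ->
  square_continuous (fun x => complex.Re (f x)) /\
  square_continuous (fun x => complex.Im (f x)).
Proof.
move=> /real_analyticP fa.
have H p e : 0 < e -> exists2 d : R, 0 < d & forall x, in_square p d x -> cabs (f x - f p) <= e.
  move=> e0; have [r [M [r0 fs]]] := fa p.
  have M0 : 0 <= M by apply: has_series_ge0 fs; exact: ltW.
  pose d := Num.min r (e * r / (M + 1)).
  have M1 : 0 < M + 1 by lra.
  have d0 : 0 < d by rewrite lt_min r0 divr_gt0 ?mulr_gt0.
  exists d => // x xp.
  have dr : d <= r by rewrite ge_min lexx.
  apply: le_trans (has_series_lipschitz dr r0 fs xp) _.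
  have : d <= e * r / (M + 1) by rewrite ge_min lexx orbT.
  rewrite ler_pdivlMr// => de; rewrite mulrAC ler_pdivrMr//.
  by apply: le_trans de; rewrite ler_wpM2l ?(ltW d0)//; lra.
split=> p e /(H p e)[d d0 Hd]; exists d => // x /Hd; apply: le_trans.
  by rewrite -raddfB; exact: Re_le_cabs.
by rewrite -raddfB; exact: Im_le_cabs.
Qed.

Lemma dual_cell_coordsE : coords (dual_cell theta j) =
  (fun z : R * R => (invmx (dual_basis theta j) *m vec2 z.1 z.2) ord0 0) @^-1` `[0, 1[ `&`
  (fun z : R * R => (invmx (dual_basis theta j) *m vec2 z.1 z.2) ord_max 0) @^-1` `[0, 1[.
Proof.
have uB := dual_basis_unit theta j.
apply/seteqP; split => z /=.
  by move=> [t t01 <-]; rewrite mulKmx// !in_itv /=; split; exact: t01.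
rewrite !in_itv /= => -[H0 H1].
exists (invmx (dual_basis theta j) *m vec2 z.1 z.2); last by rewrite mulKVmx.
by move=> i; have [->|->] := ord2_cases i.
Qed.

Lemma mulmx_square_continuous (M : 'M[R]_2) i :
  square_continuous (fun x => (M *m x) i 0).
Proof.
move=> p e e0; have [c c0 cM] := norm1_mulmx M.
exists (e / (c + c)); first by rewrite divr_gt0// addr_gt0.
move=> x xp; have -> : (M *m x) i 0 - (M *m p) i 0 = (M *m (x - p)) i 0 by rewrite mulmxBr !mxE.
apply: (@le_trans _ _ (norm1 (M *m (x - p)))).
  by have [->|->] := ord2_cases i; rewrite /norm1 ?lerDl ?lerDr.
rewrite (le_trans (cM _))//; apply: (le_trans (ler_wpM2l (ltW c0) (norm1_square xp))).
by rewrite (_ : c * _ = e)//; field; rewrite gt_eqF// addr_gt0.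
Qed.

Lemma dual_cell_measurable : measurable (coords (dual_cell theta j) : set plane).
Proof.
rewrite dual_cell_coordsE; apply: measurableI; rewrite -[X in measurable X]setTI.
  exact: (square_continuous_measurable (mulmx_square_continuous _ ord0) measurableT (measurable_itv _)).
exact: (square_continuous_measurable (mulmx_square_continuous _ ord_max) measurableT (measurable_itv _)).
Qed.

Lemma dual_cell_finite : (leb2 (coords (dual_cell theta j)) < +oo)%E.
Proof.
have [c c0 cB] := norm1_mulmx (dual_basis theta j).
pose box : set R := `[- (c * 2), c * 2]%classic.
have mbox : measurable (box : set (measurableTypeR R)) by exact: measurable_itv.
apply: (@le_lt_trans _ _ (leb2 (box `*` box))).
  apply: le_measure; rewrite ?inE.
  - exact: dual_cell_measurable.
  - exact: measurableX.
  move=> z [t t01 tz].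
  have H i : `|vec2 z.1 z.2 i 0| <= c * 2.
    apply: (@le_trans _ _ (norm1 (dual_basis theta j *m t))).
      by rewrite tz; have [->|->] := ord2_cases i; rewrite /norm1 ?lerDl ?lerDr.
    rewrite (le_trans (cB _))// ler_wpM2l ?(ltW c0)// /norm1.
    have t1 k : `|t k 0| <= 1 by have /andP[? ?] := t01 k; rewrite ger0_norm// ltW.
    by have := t1 ord0; have := t1 ord_max; lra.
  have := H ord0; have := H ord_max; rewrite !mxE /= !ler_norml => H1 H0.
  by split; rewrite /box /= in_itv.
have mu : (@lebesgue_measure R box < +oo)%E.
  by rewrite /box lebesgue_measure_itv /=; case: ifP => _; rewrite ?ltry// -EFinD ltry.
rewrite /leb2 product_measure1E//.
by rewrite lte_mul_pinfty// ge0_fin_numE.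
Qed.

Lemma analytic_square_integrable (f : vec -> C) (M : R) : real_analytic f ->
  (forall p, cabs (f p) <= M) -> square_integrable_on (dual_cell theta j) f.
Proof.
move=> fa fM; have [cR cI] := analytic_square_continuous fa.
have mR := square_continuous_measurable cR; have mI := square_continuous_measurable cI.
split.
- exact: measurable_funTS.
- exact: measurable_funTS.
have M0 : 0 <= M by apply: le_trans (fM 0); exact: cabs_ge0.
apply: measurable_bounded_integrable.
- exact: dual_cell_measurable.
- exact: dual_cell_finite.
- have E (z : R * R) : cabs (f (vec2 z.1 z.2)) ^+ 2 =
     complex.Re (f (vec2 z.1 z.2)) ^+ 2 + complex.Im (f (vec2 z.1 z.2)) ^+ 2.
    by case: (f _) => a b; rewrite /cabs /= sqr_sqrtr// addr_ge0 ?sqr_ge0.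
  under eq_fun do rewrite E.
  apply: measurable_funTS; apply: measurable_funD; apply: measurable_funX.
    exact: mR.
  exact: mI.
- exists (M ^+ 2); split; first exact: num_real.
  move=> y My z _; rewrite /= ger0_norm ?sqr_ge0//; apply/ltW/le_lt_trans/My.
  by rewrite lerXn2r ?nnegrE ?cabs_ge0.
Qed.

End QuasiPeriodic.

(** * The momentum space Hamiltonian *)

Section MomentumHamiltonian.
Context {R : realType}.
Local Notation C := R[i].
Local Notation vec := 'cV[R]_2.
Local Open Scope complex_scope.
Variable theta : 'I_3 -> R.
Variable hin : 'I_3 -> bool -> bool -> vec -> C.
Variable hout : 'I_3 -> 'I_3 -> bool -> bool -> vec -> C.
Hypothesis hout_cont : hoppings_continuous hout.
Hypothesis decay : hoppings_decay theta hin hout.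

(** The rate is halved in passing from the Euclidean norm to [norm1], by [norm1_norm2]. *)
Lemma exponential_bound (A : set vec) (F : vec -> C) (g : R) : 0 < g ->
  (ereal_sup [set (cabs (F x) * expR (g * norm2 x))%:E | x in A] < +oo)%E ->
  exists2 K : R, 0 <= K & forall x, A x -> cabs (F x) <= K * expR (- (g / 2 * norm1 x)).
Proof.
move=> g0; set S := ereal_sup _ => Soo.
exists (Num.max 0 (fine S)); first by rewrite le_max lexx.
move=> x Ax; have xS : ((cabs (F x) * expR (g * norm2 x))%:E <= S)%E.
  by apply: ereal_sup_ubound; exists x.
have {}xS : cabs (F x) * expR (g * norm2 x) <= fine S.
  rewrite -lee_fin fineK//; rewrite fin_numElt Soo andbT.
  by apply: lt_le_trans xS; rewrite ltNyr.
have -> : cabs (F x) = (cabs (F x) * expR (g * norm2 x)) * expR (- (g * norm2 x)).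
  by rewrite -mulrA -expRD addrN expR0 mulr1.
apply: ler_pM; rewrite ?mulr_ge0 ?cabs_ge0 ?expR_ge0//.
  by rewrite le_max xS orbT.
rewrite ler_expR lerN2 -mulrA ler_wpM2l ?(ltW g0)// ler_pdivrMl//.
exact: norm1_norm2.
Qed.

Lemma hoppings_bound : exists2 g : R, 0 < g & forall a b,
  (forall j, exists2 K : R, 0 <= K & forall r, lat theta j r ->
     cabs (hin j a b r) <= K * expR (- (g * norm1 r))) /\
  (forall j k, j != k -> exists2 K : R, 0 <= K & forall x,
     cabs (hout j k a b x) <= K * expR (- (g * norm1 x)) /\
     cabs (fourier (hout j k a b) x) <= K * expR (- (g * norm1 x))).
Proof.
have [g1 [g2 [g10 g20 H1 H2]]] := decay.
pose g := Num.min (g1 / 2) (g2 / 2).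
have g0 : 0 < g by rewrite lt_min !divr_gt0.
have gg1 : g <= g1 / 2 by rewrite ge_min lexx.
have gg2 : g <= g2 / 2 by rewrite ge_min lexx orbT.
exists g => // a b; split => [j|j k jk].
  have [K K0 HK] := exponential_bound g10 (H2 j a b).
  exists K => // r /HK h; apply: (le_trans h); rewrite ler_wpM2l// ler_expR lerN2.
  by rewrite ler_wpM2r// norm1_ge0.
have := H1 j k a b jk; set S1 := ereal_sup _; set S2 := ereal_sup _ => S12.
(* Only the sum of the two suprema is assumed finite; as both are nonnegative, each is finite. *)
have S10 : (0 <= S1)%E.
  apply: (@le_trans _ _ (cabs (hout j k a b 0) * expR (g1 * norm2 0))%:E).
    by rewrite lee_fin mulr_ge0 ?cabs_ge0 ?expR_ge0.
  by apply: ereal_sup_ubound; exists 0.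
have S20 : (0 <= S2)%E.
  apply: (@le_trans _ _ (cabs (fourier (hout j k a b) 0) * expR (g2 * norm2 0))%:E).
    by rewrite lee_fin mulr_ge0 ?cabs_ge0 ?expR_ge0.
  by apply: ereal_sup_ubound; exists 0.
have s1 : (S1 < +oo)%E by apply: le_lt_trans S12; rewrite leeDl.
have s2 : (S2 < +oo)%E by apply: le_lt_trans S12; rewrite leeDr.
have [K1 K10 HK1] := exponential_bound g10 s1.
have [K2 K20 HK2] := exponential_bound g20 s2.
exists (K1 + K2); first exact: addr_ge0.
move=> x; split.
  apply: (le_trans (HK1 x I)); rewrite ler_pM ?expR_ge0 ?lerDl//.
  by rewrite ler_expR lerN2 ler_wpM2r// norm1_ge0.
apply: (le_trans (HK2 x I)); rewrite ler_pM ?expR_ge0 ?lerDr//.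
by rewrite ler_expR lerN2 ler_wpM2r// norm1_ge0.
Qed.

Lemma fourier_hout_series j k a b : j != k -> exists r K g : R,
  [/\ 0 < r, 0 < g, 0 <= K &
    forall p, has_series p r (K * expR (- (g * norm1 p))) (fourier (hout j k a b))].
Proof.
move=> jk; have [g g0 /(_ a b)[_ /(_ j k jk)[K K0 HK]]] := hoppings_bound.
have [cR cI] := hout_cont a b jk.
have [r [M [r0 fs]]] := fourier_has_series (continuous_square cR) (continuous_square cI) g0
  (fun x => (HK x).1).
exact: decaying_has_series r0 g0 fs (fun x => (HK x).2).
Qed.

Lemma bloch_summable j a b q : csummable (lat theta j)
  (fun r => cis (- dotv q (r + orb_shift theta j a - orb_shift theta j b)) * hin j a b r).
Proof.
have [g g0 /(_ a b)[/(_ j)[K K0 HK] _]] := hoppings_bound.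
have [L L0 HL] := lat_sum theta j g0.
apply: (@le_lt_trans _ _ (K * L)%:E); last exact: ltry.
rewrite EFinM; apply: (@le_trans _ _ (K%:E * \esum_(r in lat theta j) (expR (- (g * norm1 (0 + r))))%:E)%E).
  rewrite -esumZ//.
  by apply: le_esum => r /HK h; rewrite -EFinM lee_fin cabsM cabs_cis mul1r add0r.
by rewrite lee_wpmul2l// lee_fin.
Qed.

(** As for [fourier_has_series], half of the decay pays for the norm of the characters and the other
    half is summed over the lattice. *)
Lemma bloch_series j a b : exists r M : R, 0 < r /\
  forall p, has_series p r M (bloch theta hin j a b).
Proof.
have [g g0 /(_ a b)[/(_ j)[K K0 HK] _]] := hoppings_bound.
pose r := g / 2; have r0 : 0 < r by rewrite divr_gt0.
have [L L0 HL] := lat_sum theta j r0.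
pose d := orb_shift theta j a - orb_shift theta j b.
exists r, (K * expR (r * norm1 d) * L); split => // p.
apply: (has_series_csum (M := fun v => cabs (hin j a b v) *
   expR (r * norm1 (v + orb_shift theta j a - orb_shift theta j b)))) => //.
  move=> v _; apply: (eq_has_series (fun x => mulrC _ _)).
  by apply: has_seriesZ; [exact: ltW|apply: has_series_char; exact: ltW].
apply: (@le_trans _ _ ((K * expR (r * norm1 d))%:E *
   \esum_(v in lat theta j) (expR (- (r * norm1 (0 + v))))%:E)%E).
  rewrite -esumZ ?mulr_ge0 ?expR_ge0//.
  apply: le_esum => v /HK h; rewrite -EFinM lee_fin add0r -(mulrA K) -expRD.
  apply: (@le_trans _ _ (K * expR (- (g * norm1 v)) * expR (r * norm1 (v + orb_shift theta j a - orb_shift theta j b)))).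
    by rewrite ler_wpM2r ?expR_ge0.
  rewrite -mulrA ler_wpM2l// -expRD ler_expR -addrA -/d.
  have := ler_wpM2l (ltW r0) (norm1D v d); rewrite [r * (_ v + _)]mulrDr.
  have -> : g = r + r by rewrite /r -splitr.
  rewrite mulrDl; move: (r * norm1 (v + d)) (r * norm1 v) (r * norm1 d) => x y z; lra.
by rewrite [leRHS]EFinM lee_wpmul2l// lee_fin mulr_ge0 ?expR_ge0.
Qed.

Lemma interlayer_bound j k a b : j != k -> exists2 K : R, 0 <= K & forall q,
  (\esum_(G in dual_lat theta j) (cabs (fourier (hout j k a b) (q + G)))%:E <= K%:E)%E.
Proof.
move=> jk; have [g g0 /(_ a b)[_ /(_ j k jk)[K K0 HK]]] := hoppings_bound.
have [L L0 HL] := dual_lat_sum theta j g0.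
exists (K * L); first exact: mulr_ge0.
move=> q; apply: (@le_trans _ _ (K%:E * \esum_(G in dual_lat theta j) (expR (- (g * norm1 (q + G))))%:E)%E).
  rewrite -esumZ//.
  by apply: le_esum => G _; rewrite -EFinM lee_fin; exact: (HK _).2.
by rewrite EFinM lee_wpmul2l// lee_fin.
Qed.

Variable psi : 'I_3 -> bool -> vec -> C.
Hypothesis psi_chi : chi theta psi.

Lemma chi_series j a : exists r M : R, 0 < r /\ forall p, has_series p r M (psi j a).
Proof.
have [qp _ an] := psi_chi j.
by apply: quasi_periodic_uniform (an a) => q G /qp ->.
Qed.

Lemma chi_bounded : exists2 M : R, 0 <= M & forall j a q, cabs (psi j a q) <= M.
Proof.
have /choice[m Hm] : forall ja : 'I_3 * bool, exists M : R, forall q, cabs (psi ja.1 ja.2 q) <= M.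
  move=> [j a]; have [r [M [r0 fs]]] := chi_series j a.
  by exists M; exact: uniform_series_bounded r0 fs.
have m0 ja : 0 <= m ja by apply: le_trans (Hm ja 0); exact: cabs_ge0.
exists (\sum_ja m ja); first exact: sumr_ge0.
move=> j a q; rewrite (le_trans (Hm (j, a) q))//.
by rewrite (bigD1 (j, a))//= lerDl sumr_ge0.
Qed.

Lemma interlayer_summable j k a b q : j != k -> csummable (dual_lat theta j)
  (fun G => cis (dotv G (orb_shift theta j a)) * fourier (hout j k a b) (q + G) * psi k b (q + G)).
Proof.
move=> jk; have [K K0 HK] := interlayer_bound a b jk.
have [M M0 HM] := chi_bounded.
apply: (@le_lt_trans _ _ (M * K)%:E); last exact: ltry.
rewrite EFinM; apply: le_trans (lee_wpmul2l _ (HK q)); last by rewrite lee_fin.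
rewrite -esumZ//; last by move=> G _; rewrite lee_fin cabs_ge0.
apply: le_esum => G _; rewrite -EFinM lee_fin 2!cabsM cabs_cis mul1r [leLHS]mulrC.
by rewrite ler_wpM2r ?cabs_ge0 ?HM.
Qed.

Lemma interlayer_series j k a b : j != k -> exists r M : R, 0 < r /\
  forall p, has_series p r M (fun q => csum (dual_lat theta j)
    (fun G => cis (dotv G (orb_shift theta j a)) * fourier (hout j k a b) (q + G) * psi k b (q + G))).
Proof.
move=> jk; have [r1 [K [g [r10 g0 K0 fs]]]] := fourier_hout_series a b jk.
have [r2 [M [r20 ps]]] := chi_series k b.
have [L L0 HL] := dual_lat_sum theta j g0.
have M0 : 0 <= M by apply: has_series_ge0 (ps 0); exact: ltW.
pose r := Num.min r1 r2; have r0 : 0 < r by rewrite lt_min r10.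
have rr1 : r <= r1 by rewrite ge_min lexx.
have rr2 : r <= r2 by rewrite ge_min lexx orbT.
exists r, (K * M * L); split => // p.
apply: (has_series_csum (M := fun G => K * expR (- (g * norm1 (p + G))) * M)) => //.
  move=> G _; apply: has_seriesM => //.
    rewrite -[X in has_series _ _ X _]mul1r -(cabs_cis (dotv G (orb_shift theta j a))).
    apply: has_seriesZ; first exact: ltW.
    (* The translate by [G] expands around [p] as the function itself does around [p + G], where its
       norm has decayed. *)
    rewrite -[p in has_series p](addrK G); apply: has_series_shift.
    exact: has_series_le (ltW r0) rr1 _ (fs _).
  rewrite -[p in has_series p](addrK G); apply: has_series_shift.
  exact: has_series_le (ltW r0) rr2 _ (ps _).
apply: (@le_trans _ _ ((K * M)%:E * \esum_(G in dual_lat theta j) (expR (- (g * norm1 (p + G))))%:E)%E).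
  rewrite -esumZ ?mulr_ge0//.
  by apply: le_esum => G _; rewrite -EFinM lee_fin mulrAC.
by rewrite [leRHS]EFinM lee_wpmul2l// lee_fin mulr_ge0.
Qed.

Lemma mom_ham_series j a : exists r M : R, 0 < r /\
  forall p, has_series p r M (mom_ham theta hin hout psi j a).
Proof.
have E (I : finType) (P : pred I) (f : I -> vec -> C) :
    (forall i, P i -> exists r M : R, 0 < r /\ forall p, has_series p r M (f i)) ->
    exists r M : R, 0 < r /\ forall p, has_series p r M (fun x => \sum_(i | P i) f i x).
  move=> H.
  have /choice[rm Hrm] : forall i, exists rm : R * R, 0 < rm.1 /\
      (P i -> forall p, has_series p rm.1 rm.2 (f i)).
    move=> i; case: (boolP (P i)) => [/H[r [M [r0 fs]]]|nP]; first by exists (r, M).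
    by exists (1, 0).
  (* A finite sum takes the smallest radius; the default 1 keeps it positive for an empty index
     type. *)
  pose r := \big[Num.min/1]_i (rm i).1.
  have r0 : 0 < r.
    by rewrite /r; elim/big_ind: _ => [//|x y x0 y0|i _]; [rewrite lt_min x0|have [] := Hrm i].
  exists r, (\sum_(i | P i) (rm i).2); split => // p.
  apply: has_series_sum; first exact: ltW.
  move=> i Pi; have [_ /(_ Pi p)] := Hrm i; apply: has_series_le => //; first exact: ltW.
  by rewrite /r (bigD1 i)//= ge_min lexx.
have M2 (f g : vec -> C) : (exists r M : R, 0 < r /\ forall p, has_series p r M f) ->
    (exists r M : R, 0 < r /\ forall p, has_series p r M g) ->
    (exists r M : R, 0 < r /\ forall p, has_series p r M (fun x => f x * g x)) /\
    (exists r M : R, 0 < r /\ forall p, has_series p r M (fun x => f x + g x)).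
  move=> [r1 [K1 [r10 f1]]] [r2 [K2 [r20 f2]]].
  pose r := Num.min r1 r2; have r0 : 0 < r by rewrite lt_min r10.
  have rr1 : r <= r1 by rewrite ge_min lexx.
  have rr2 : r <= r2 by rewrite ge_min lexx orbT.
  split; [exists r, (K1 * K2)|exists r, (K1 + K2)]; split => // p.
    by apply: has_seriesM => //; [apply: has_series_le rr1 _ (f1 p)|apply: has_series_le rr2 _ (f2 p)] => //; exact: ltW.
  by apply: has_seriesD => //; [exact: ltW|apply: has_series_le rr1 _ (f1 p)|apply: has_series_le rr2 _ (f2 p)] => //; exact: ltW.
apply: (M2 (fun q => \sum_(b : bool) bloch theta hin j a b q * psi j b q) _ _ _).2.
  apply: (E) => b _; exact: (M2 _ _ (bloch_series j a b) (chi_series j b)).1.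
apply: (E) => k kj; apply: (E) => b _.
have [r [M [r0 fs]]] := interlayer_series a b (negbT (etrans (eq_sym _ _) (negbTE kj))).
exists r, (cabs (cstar theta j * cstar theta k)%:C * M); split => // p.
by apply: has_seriesZ; [exact: ltW|exact: fs].
Qed.

Lemma mom_ham_quasi_periodic j : quasi_periodic theta j (mom_ham theta hin hout psi j).
Proof.
move=> a q G dG; rewrite /mom_ham mulrDr; congr (_ + _); rewrite mulr_sumr.
  apply: eq_bigr => b _; have [qp _ _] := psi_chi j; rewrite (qp b q G dG).
  (* Since e^{-iG.r} = 1 on the lattice, only the shifts contribute a phase; that of [psi j b] then
     cancels the shift of [b] and leaves the one of [a]. *)
  have -> : bloch theta hin j a b (q + G) =
      cis (- dotv G (orb_shift theta j a - orb_shift theta j b)) * bloch theta hin j a b q.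
    rewrite /bloch -csumZ; last exact: bloch_summable.
    apply: eq_csum => r lr; rewrite mulrA; congr (_ * _).
    rewrite -cisD -[LHS]mulr1 -(cis_dual_lat dG lr) -cisD; congr cis.
    by rewrite !dotvDl !dotvDr !dotvNr; ring.
  rewrite mulrACA -cisD; congr (cis _ * _).
  by rewrite dotvDr dotvNr; ring.
apply: eq_bigr => k kj; rewrite mulr_sumr; apply: eq_bigr => b _.
rewrite mulrCA; congr (_ * _); rewrite -csumZ; last first.
  by apply: interlayer_summable; rewrite eq_sym.
(* The vector [G] is no period of layer [k]; here the phase comes from translating the summation
   index in the explicit factor. *)
have be : set_bij (dual_lat theta j) (dual_lat theta j) (fun G' => G' - G).
  split.
  - by move=> G' dG' /=; exact: latticeB.
  - by move=> x y _ _ /addIr.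
  - by move=> G' dG'; exists (G' + G); [exact: latticeD|rewrite addrK].
rewrite (csum_reindex _ be); apply: eq_csum => G' _ /=.
rewrite (_ : q + G + (G' - G) = q + G'); last by rewrite -addrA [G + _]addrC subrK.
rewrite [RHS]mulrA; congr (_ * _); rewrite [RHS]mulrA -cisD; congr (cis _ * _).
by rewrite dotvDl dotvNl addrC.
Qed.

Lemma mom_ham_chi : chi theta (mom_ham theta hin hout psi).
Proof.
move=> j; have an a : real_analytic (mom_ham theta hin hout psi j a).
  apply/real_analyticP => p; have [r [M [r0 fs]]] := mom_ham_series j a.
  by exists r, M; split.
split => //; first exact: mom_ham_quasi_periodic.
move=> a; have [r [M [r0 fs]]] := mom_ham_series j a.
exact: analytic_square_integrable (an a) (uniform_series_bounded r0 fs).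
Qed.

End MomentumHamiltonian.

(** * The reciprocal Hamiltonian *)

Section ReciprocalMatrix.
Context {R : realType}.
Local Notation C := R[i].
Local Notation vec := 'cV[R]_2.
Local Open Scope complex_scope.
Variable theta : 'I_3 -> R.
Local Notation Om := (Omega theta).

Lemma thirdP (j k : 'I_3) : j != k -> third j k != j /\ third j k != k.
Proof.
move=> jk; rewrite /third; case: pickP => [l /andP[]//|H].
by have := H ord0; have := H ord_max; have := H (inord 1); move: jk;
  rewrite -!val_eqE /= inordK//; case: j k {H} => [[|[|[|//]]] ?] [[|[|[|//]]] ?].
Qed.

Lemma layer_cases (j k t : 'I_3) : j != k -> [\/ t = j, t = k | t = third j k].
Proof.
move=> jk; have [lj lk] := thirdP jk; move: (third j k) lj lk => l lj lk.
have [->|tj] := eqVneq t j; first by constructor 1.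
have [->|tk] := eqVneq t k; first by constructor 2.
constructor 3; apply: ord_inj; move: jk lj lk tj tk (ltn_ord j) (ltn_ord k) (ltn_ord l) (ltn_ord t).
by rewrite -!(inj_eq val_inj) /=; lia.
Qed.

Lemma sum_layers (V : nmodType) (j k : 'I_3) (F : 'I_3 -> V) : j != k ->
  \sum_t F t = F j + F k + F (third j k).
Proof.
move=> jk; have [lj lk] := thirdP jk.
rewrite (bigD1 j)//= (bigD1 k) 1?eq_sym//= (bigD1 (third j k)) ?lj//= big1 ?addr0 ?addrA//.
by move=> t; case: (layer_cases t jk) => ->; rewrite eqxx ?andbF.
Qed.

Lemma mk_Omega (k : 'I_3) (G : {ffun 'I_3 -> vec}) (b : bool) :
  (forall t, dual_lat theta t (G t)) -> G k = 0 ->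
  exists w : Om, [/\ layer w = k, momentum w = G & orbital w = b].
Proof.
move=> dG Gk; have H : Omega theta (k, G, b) by split.
by exists (SigSub (mem_set H)).
Qed.

Lemma OmegaP (w : Om) : (forall t, dual_lat theta t (momentum w t)) /\ momentum w (layer w) = 0.
Proof. by have := set_mem (valP w). Qed.

Lemma Omega_inj (w w' : Om) : layer w = layer w' -> momentum w = momentum w' ->
  orbital w = orbital w' -> w = w'.
Proof.
rewrite /layer /momentum /orbital => H1 H2 H3; apply: val_inj.
by case: (val w) (val w') H1 H2 H3 => [[? ?] ?] [[? ?] ?] /= -> -> ->.
Qed.


Definition component (w : Om) : 'I_3 * bool := (layer w, orbital w).

Lemma component_bij : set_bij [set: ('I_3 * bool)%type] setT (fun u => u).
Proof. by split => // u; exists u. Qed.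

Lemma esum_components (f : Om -> R) : (forall w, 0 <= f w) ->
  (\esum_(w in setT) (f w)%:E =
   \sum_(u : 'I_3 * bool) \esum_(w in component @^-1` [set u]) (f w)%:E)%E.
Proof.
move=> f0; under eq_bigr do rewrite esum_mkcond.
rewrite -esum_sum; last by move=> w u _ _; case: ifP => // _; rewrite lee_fin.
apply: eq_esum => w _; rewrite (bigD1 (component w))//= mem_set// big1 ?adde0//.
by move=> u /eqP wu; case: ifPn => // /set_mem /= /esym.
Qed.

Lemma csum_components (f : Om -> C) : csummable setT f ->
  csum setT f = \sum_(k : 'I_3) \sum_(b : bool) csum (component @^-1` [set (k, b)]) f.
Proof.
move=> fs; rewrite (csum_fibers component)// (csum_fin _ component_bij).
rewrite (pair_bigA _ (fun k b => csum (component @^-1` [set (k, b)]) f)) /=.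
by apply: eq_bigr => -[k b] _; rewrite setTI.
Qed.

(* For [k != layer w], the support of row [w] among the columns [(k, b)]; it is in bijection
   with the lattice that [mom_ham] sums over. *)
Definition coupled (w : Om) (k : 'I_3) (b : bool) : set Om :=
  [set w' | [/\ layer w' = k, orbital w' = b &
    momentum w' (third (layer w) k) = momentum w (third (layer w) k)]].

(** The momentum of a column vanishes in its own layer [k] and is prescribed in the third layer, so
    its component in the layer of [w] is the only free one. *)
Lemma coupled_bij (w : Om) k b : layer w != k ->
  set_bij (coupled w k b) (dual_lat theta (layer w)) (fun w' => momentum w' (layer w)).
Proof.
move=> jk; have [lj lk] := thirdP jk; split.
- by move=> w' _; have [+ _] := OmegaP w'.
- move=> w1 w2 /set_mem[k1 b1 m1] /set_mem[k2 b2 m2] m12.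
  apply: Omega_inj; rewrite ?k1 ?b1//; apply/ffunP => t.
  case: (layer_cases t jk) => -> //; last by rewrite m1.
  by have [_ e1] := OmegaP w1; have [_ e2] := OmegaP w2; rewrite -{1}k1 e1 -k2 e2.
- move=> g dg; have [dw _] := OmegaP w.
  pose G := [ffun t => if t == layer w then g else if t == k then 0 else momentum w t].
  have dG t : dual_lat theta t (G t).
    rewrite ffunE; have [->//|_] := eqVneq t (layer w).
    by have [_|_] := eqVneq t k; [exact: lattice0|exact: dw].
  have Gk : G k = 0 by rewrite ffunE eq_sym (negPf jk) eqxx.
  have [w' [H1 H2 H3]] := mk_Omega b dG Gk.
  exists w'; last by rewrite H2 ffunE eqxx.
  by split => //; rewrite H2 ffunE (negPf lj) (negPf lk).
Qed.

Variable hin : 'I_3 -> bool -> bool -> vec -> C.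
Variable hout : 'I_3 -> 'I_3 -> bool -> bool -> vec -> C.
Hypothesis decay : hoppings_decay theta hin hout.
Variable q : vec.
Local Notation entry := (reciprocal_entry theta hin hout q).

Lemma entry_diag (w w' : Om) : layer w' = layer w -> momentum w' = momentum w ->
  entry w w' = bloch theta hin (layer w) (orbital w) (orbital w') (q + \sum_t momentum w t).
Proof.
move=> lE mE; rewrite /reciprocal_entry lE mE !eqxx /= !mul0r addr0 !mul1r.
congr (bloch _ _ _ _ _ (_ + _)); rewrite [RHS](bigD1 (layer w))//=.
by have [_ ->] := OmegaP w; rewrite add0r.
Qed.

Lemma entry_diag0 (w w' : Om) : layer w' = layer w -> momentum w' <> momentum w ->
  entry w w' = 0.
Proof.
move=> lE /eqP mE; rewrite /reciprocal_entry lE eqxx /= (negPf mE).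
by rewrite mulr0 !mul0r addr0.
Qed.

Lemma entry_coupled (w w' : Om) k b : layer w != k -> coupled w k b w' ->
  entry w w' = (cstar theta (layer w) * cstar theta k)%:C *
    cis (dotv (momentum w' (layer w)) (orb_shift theta (layer w) (orbital w))
         - dotv (momentum w k) (orb_shift theta k b)) *
    fourier (hout (layer w) k (orbital w) b)
      (q + \sum_t momentum w t + momentum w' (layer w)).
Proof.
move=> jk [lE bE mE]; rewrite /reciprocal_entry lE bE mE eqxx eq_sym (negPf jk) /=.
rewrite !mul0r add0r !mul1r; congr (_ * fourier _ _).
rewrite (sum_layers _ jk); have [_ ->] := OmegaP w; rewrite add0r.
by rewrite -!addrA; congr (_ + _); rewrite addrC -!addrA.
Qed.

Lemma entry_coupled0 (w w' : Om) k b : layer w != k -> component w' = (k, b) ->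
  ~ coupled w k b w' -> entry w w' = 0.
Proof.
move=> jk [lE bE] nc; rewrite /reciprocal_entry lE eq_sym (negPf jk) /=.
rewrite !mul0r add0r; case: eqP => [mE|_]; last by rewrite mulr0 !mul0r.
by case: nc.
Qed.

(** Row sums bound the operator on l^oo. In its own layer a row has at most one nonzero entry per
    orbital; in another layer it is a sum of [fourier] over a translated lattice, bounded uniformly
    in the translation. The final sum over all layers and orbitals removes the dependence on [w]. *)
Lemma row_bound : exists2 K : R, 0 <= K & forall w : Om,
  (\esum_(w' in setT) (cabs (entry w w'))%:E <= K%:E)%E.
Proof.
have /choice[m Hm] : forall x : ('I_3 * 'I_3) * (bool * bool), exists m : R, 0 <= m /\
    forall w, layer w = x.1.1 -> orbital w = x.2.1 ->
    (\esum_(w' in component @^-1` [set (x.1.2, x.2.2)]) (cabs (entry w w'))%:E <= m%:E)%E.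
  move=> [[j k] [a b]] /=; have [<-|jk] := eqVneq j k.
    have [r [M [r0 fs]]] := bloch_series decay j a b.
    have M0 : 0 <= M by apply: has_series_ge0 (fs 0); exact: ltW.
    exists M; split => // w lw ow.
    have [dw w0] := OmegaP w; rewrite lw in w0.
    have [wb [H1 H2 H3]] := mk_Omega b dw w0.
    rewrite -(esum_support (A := [set wb])).
    - rewrite esum_set1 ?lee_fin ?cabs_ge0// entry_diag ?lw ?ow ?H3//.
      exact: uniform_series_bounded r0 fs _.
    - by move=> _ -> /=; rewrite /component H1 H3.
    - move=> w' [l' b'] nw; rewrite entry_diag0 ?cabs0 ?lw// => mE; apply: nw.
      by apply: Omega_inj; rewrite ?H1 ?H2 ?H3.
  have [K K0 HK] := interlayer_bound decay a b jk.
  exists (`|cstar theta j * cstar theta k| * K); split; first exact: mulr_ge0.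
  move=> w lw ow; rewrite -(esum_support (A := coupled w k b)); last 2 first.
  - by move=> w' [l' b' _]; rewrite /= /component l' b'.
  - by move=> w' c' nc; rewrite (entry_coupled0 _ c' nc) ?cabs0 ?lw.
  have jk' : layer w != k by rewrite lw.
  apply: (@le_trans _ _ (`|cstar theta j * cstar theta k|%:E *
    \esum_(w' in coupled w k b) (cabs (fourier (hout j k a b)
      (q + \sum_t momentum w t + momentum w' (layer w))))%:E)%E).
    rewrite -esumZ//; last by move=> w' _; rewrite lee_fin cabs_ge0.
    apply: le_esum => w' cw; rewrite (entry_coupled jk' cw) -EFinM lee_fin 2!cabsM.
    by rewrite cabs_cis mulr1 cabs_real lw ow.
  rewrite EFinM lee_wpmul2l ?lee_fin//.
  rewrite -(reindex_esum _ _ _ (fun g => (cabs (fourier (hout j k a b) (q + \sum_t momentum w t + g)))%:E)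
    (coupled_bij b jk')).
  by rewrite lw; exact: HK.
have m0 x : 0 <= m x by have [] := Hm x.
exists (\sum_(j : 'I_3) \sum_(a : bool) \sum_(u : 'I_3 * bool) m ((j, u.1), (a, u.2))).
  by do 3?[apply: sumr_ge0 => ? _].
move=> w; rewrite esum_components; last by move=> w'; exact: cabs_ge0.
apply: (@le_trans _ _ (\sum_(u : 'I_3 * bool) (m ((layer w, u.1), (orbital w, u.2)))%:E)%E).
  by apply: lee_sum => -[k b] _; have [_] := Hm ((layer w, k), (orbital w, b)); exact.
rewrite sumEFin lee_fin (bigD1 (layer w))//= (bigD1 (orbital w))//= -addrA lerDl.
by rewrite addr_ge0//; do 3?[apply: sumr_ge0 => ? _].
Qed.

Lemma row_summable (u : Om -> C) (B : R) (w : Om) : (forall w', cabs (u w') <= B) ->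
  csummable setT (fun w' => entry w w' * u w').
Proof.
move=> uB; have [K K0 /(_ w) HK] := row_bound.
have B0 : 0 <= B by apply: le_trans (uB w); exact: cabs_ge0.
apply: (@le_lt_trans _ _ (B * K)%:E); last exact: ltry.
rewrite EFinM; apply: le_trans (lee_wpmul2l _ HK); last by rewrite lee_fin.
rewrite -esumZ//; last by move=> w' _; rewrite lee_fin cabs_ge0.
by apply: le_esum => w' _; rewrite -EFinM lee_fin cabsM mulrC ler_wpM2r ?cabs_ge0.
Qed.

Lemma unfolding_bounded psi : chi theta psi ->
  exists2 B : R, 0 <= B & forall w, cabs (unfolding theta q psi w) <= B.
Proof. by move=> /chi_bounded[B B0 HB]; exists B => // w; exact: HB. Qed.

Lemma intertwining psi (w : Om) : chi theta psi ->
  unfolding theta q (mom_ham theta hin hout psi) w =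
  csum setT (fun w' => entry w w' * unfolding theta q psi w').
Proof.
move=> cpsi; have [B B0 HB] := unfolding_bounded cpsi.
rewrite csum_components; last exact: row_summable HB.
have [dw w0] := OmegaP w.
rewrite (bigD1 (layer w))//= {1}/unfolding /mom_ham; congr (_ + _).
  apply: eq_bigr => b _; have [wb [H1 H2 H3]] := mk_Omega b dw w0.
  rewrite -(csum_support (A := [set wb])).
  - by rewrite csum_set1 entry_diag// /unfolding H1 H2 H3.
  - by move=> _ -> /=; rewrite /component H1 H3.
  - move=> w' [l' b'] nw; rewrite entry_diag0 ?mul0r// => mE; apply: nw.
    by apply: Omega_inj; rewrite ?H1 ?H2 ?H3.
apply: eq_bigr => k; rewrite eq_sym => jk; apply: eq_bigr => b _.
rewrite -(csum_support (A := coupled w k b)); last 2 first.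
- by move=> w' [l' b' _]; rewrite /= /component l' b'.
- by move=> w' c' nc; rewrite (entry_coupled0 jk c' nc) mul0r.
rewrite -csumZ; last exact: (interlayer_summable decay cpsi _ _ _ jk).
rewrite (csum_reindex _ (coupled_bij b jk)); apply: eq_csum => w' cw /=.
rewrite (entry_coupled jk cw) /unfolding; case: (cw) => -> -> mE.
have [qp _ _] := cpsi k.
have [dw' w'0] := OmegaP w'; have lw' : layer w' = k by case: cw.
rewrite lw' in w'0.
(* The two points differ only in how the components are grouped: the third ones agree, and each
   momentum vanishes in its own layer. The vector [momentum w k] left over is a period of layer
   [k]. *)
have -> : q + \sum_t momentum w t + momentum w' (layer w) =
    q + \sum_t momentum w' t + momentum w k.
  rewrite !(sum_layers _ jk) w0 w'0 mE add0r addr0 -!addrA; congr (_ + _).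
  by rewrite addrC [X in X + _]addrC -addrA.
rewrite (qp b _ _ (dw k)) cisD; move: (fourier _ _) => F; rewrite -!mulrA; congr (_ * (_ * _)).
by rewrite mulrCA.
Qed.

End ReciprocalMatrix.

(** * Uniqueness of the matrix *)

Section RowUniqueness.
Context {R : realType}.
Local Notation C := R[i].
Local Notation vec := 'cV[R]_2.
Local Open Scope complex_scope.
Variable theta : 'I_3 -> R.
Local Notation Om := (Omega theta).

(** Adding the orbital shift to the frequency [v] of the lattice produces exactly the quasi-periodic
    phase. *)
Definition character_state (k : 'I_3) (b : bool) (v : vec) : 'I_3 -> bool -> vec -> C :=
  fun j a x => if (j == k) && (a == b) then cis (- dotv x (v + orb_shift theta k b)) else 0.

Lemma character_state_chi k b v : lat theta k v -> chi theta (character_state k b v).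
Proof.
move=> lv j.
have an a : real_analytic (character_state k b v j a).
  apply/real_analyticP => p; rewrite /character_state.
  case: (_ && _); last by exists 1, (cabs 0); split => //; exact: has_series_cst.
  by exists 1, (expR (1 * norm1 (v + orb_shift theta k b))); split => //; exact: has_series_char.
split => //.
- move=> a x G dG; rewrite /character_state; case: ifP => [/andP[/eqP jk /eqP ab]|_].
    rewrite -cisD -[LHS]mulr1 -(cis_dual_lat dG (r := v)) ?jk// -cisD; congr cis.
    by rewrite ab dotvDl !dotvDr; ring.
  by rewrite mulr0.
- move=> a; apply: (@analytic_square_integrable R theta j _ 1) => // x.
  by rewrite /character_state; case: ifP => _; rewrite ?cabs_cis ?cabs0.
Qed.

Lemma half_cis_le (t : R) : cabs ((1 + cis t) / 2 : C) <= 1.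
Proof.
have -> : cabs ((1 + cis t) / 2 : C) = cabs (1 + cis t) / 2.
  by rewrite cabsM cabsV (_ : (2 : C) = (2 : R)%:C) ?cabs_real ?ger0_norm// rmorph_nat.
rewrite ler_pdivrMr// mul1r (le_trans (cabsD _ _))// cabs1 cabs_cis.
by rewrite -[2]/(1 + 1).
Qed.

Lemma half_cis_lt (t : R) : cis t != 1 -> cabs ((1 + cis t) / 2 : C) < 1.
Proof.
move=> t1.
have -> : cabs ((1 + cis t) / 2 : C) = cabs (1 + cis t) / 2.
  by rewrite cabsM cabsV (_ : (2 : C) = (2 : R)%:C) ?cabs_real ?ger0_norm// rmorph_nat.
rewrite ltr_pdivrMr// mul1r.
have c1 : cos t < 1.
  rewrite lt_neqAle cos_le1 andbT; apply: contra t1 => /eqP ct.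
  have := cos2Dsin2 t; rewrite ct expr1n => /eqP; rewrite -subr_eq0 addrAC subrr add0r.
  by rewrite expf_eq0 /= => /eqP st; rewrite /cis ct st.
rewrite /cabs /cis /= add0r -[ltRHS]ger0_norm// -sqrtr_sqr ltr_sqrt//.
have := cos2Dsin2 t; move: c1; set c := cos t; set s := sin t => c1 e.
have -> : (1 + c) ^+ 2 + s ^+ 2 = 1 + 2 * c + (c ^+ 2 + s ^+ 2) by ring.
by rewrite e; lra.
Qed.

Variable q : vec.
Variables (k : 'I_3) (b : bool).
Let S : set Om := @component R theta @^-1` [set (k, b)].
Let pt (w : Om) : vec := q + \sum_t momentum w t.

Hypothesis incomm : incommensurate (dual_lat theta).

Lemma points_separated (w0 w : Om) : S w0 -> S w -> w <> w0 ->
  exists2 r : vec, lat theta k r & cis (- dotv (pt w - pt w0) r) != 1.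
Proof.
move=> [l0 b0] [l1 b1] ww0; apply: contrapT => nr.
have dd : dual_lat theta k (pt w - pt w0).
  apply: dual_lat_separated => r lr; apply: contrapT => /eqP c1; apply: nr.
  exists (- r); first exact: latticeN.
  by rewrite dotvNr opprK.
have [d0 w00] := OmegaP w0; have [d1 w10] := OmegaP w.
rewrite l0 in w00; rewrite l1 in w10.
(* If the two points agreed modulo the dual lattice, this would be a family of dual lattice vectors
   with sum 0, since both momenta vanish in layer [k]. *)
pose v t := if t == k then - (pt w - pt w0) else momentum w t - momentum w0 t.
have dv t : t \in [set: 'I_3]%SET -> dual_lat theta t (v t).
  by move=> _; rewrite /v; have [->|_] := eqVneq t k; [exact: latticeN dd|exact: latticeB (d1 t) (d0 t)].
have [+ _] := incomm dv.
have -> : \sum_(t in [set: 'I_3]%SET) v t = 0.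
  rewrite (bigD1 k) ?inE//= {1}/v eqxx.
  rewrite (eq_bigr (fun t => momentum w t - momentum w0 t)); last first.
    by move=> t; rewrite inE /= /v => /negPf ->.
  rewrite (eq_bigl (fun t => t != k)); last by move=> t; rewrite inE.
  rewrite sumrB /pt (bigD1 k)//= w10 add0r [in X in _ - X](bigD1 k)//= w00 add0r.
  move: (\sum_(i | i != k) momentum w i) (\sum_(i | i != k) momentum w0 i) => U V.
  by apply/matrixP => i l; rewrite !mxE; ring.
move=> /(_ erefl) v0; apply: ww0; apply: Omega_inj; rewrite ?l0 ?l1 ?b0 ?b1//.
apply/ffunP => t; have [->|tk] := eqVneq t k; first by rewrite w10.
by have := v0 t (finset.in_setT _); rewrite /v (negPf tk) => /eqP; rewrite subr_eq0 => /eqP.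
Qed.

Variable D : Om -> C.
Hypothesis Dsum : csummable S D.

(** The Fourier coefficients of the atomic measure with mass [D w * f w] at [pt w]; the factor [f]
    is kept separate because it is what gets modified. *)
Definition annihilated (f : Om -> C) : Prop := forall v, lat theta k v ->
  csum S (fun w => D w * f w * cis (- dotv (pt w) v)) = 0.

(** Multiplication by the character of frequency [r] turns the coefficient at [v] into the one at
    [v + r], up to a constant phase. *)
Lemma annihilated_half (f : Om -> C) (p r : vec) : (forall w, cabs (f w) <= 1) ->
  lat theta k r -> annihilated f ->
  annihilated (fun w => f w * ((1 + cis (- dotv (pt w - p) r)) / 2)).
Proof.
move=> f1 lr Zf v lv.
have sm u : csummable S (fun w => D w * f w * cis (- dotv (pt w) u)).
  apply: le_csummable Dsum => w _; rewrite !cabsM cabs_cis mulr1.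
  by rewrite ler_piMr ?cabs_ge0.
rewrite (eq_csum (g := fun w => 2^-1 * (D w * f w * cis (- dotv (pt w) v)) +
   (2^-1 * cis (dotv p r)) * (D w * f w * cis (- dotv (pt w) (v + r))))); last first.
  move=> w _; rewrite dotvDl dotvNl dotvDr !opprD opprK !cisD; ring.
rewrite csumD; [|exact: csummableZ..].
by rewrite !csumZ// Zf// Zf ?mulr0 ?addr0//; exact: latticeD.
Qed.

(** Each point of [s] is treated by a power of a factor that is 1 at [w0] and less than 1 in modulus
    at that point. The factors have modulus at most 1 everywhere, so points already treated stay
    small. *)
Lemma localizer (w0 : Om) (s : seq Om) (d : R) : S w0 ->
  (forall w, w \in s -> S w /\ w <> w0) -> 0 < d -> annihilated (fun=> 1) ->
  exists f : Om -> C, [/\ annihilated f, forall w, cabs (f w) <= 1, f w0 = 1 &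
    forall w, w \in s -> cabs (f w) <= d].
Proof.
move=> S0 sS d0 Z1; elim: s sS => [_|w s ih sS].
  by exists (fun=> 1); split => // w; rewrite cabs1.
have [f [Zf f1 f0 fd]] := ih (fun x xs => sS x (mem_behead (s := w :: s) xs)).
have [Sw ww0] := sS w (mem_head _ _).
have [r lr r1] := points_separated S0 Sw ww0.
pose g x : C := (1 + cis (- dotv (pt x - pt w0) r)) / 2.
have g1 x : cabs (g x) <= 1 by exact: half_cis_le.
have g0 : g w0 = 1.
  by rewrite /g subrr dotv0l oppr0 cis0 -[1 + 1]/2%:R divff// pnatr_eq0.
have gX1 n x : cabs (g x ^+ n) <= 1 by rewrite cabsX exprn_ile1 ?cabs_ge0.
have fg1 n x : cabs (f x * g x ^+ n) <= 1 by rewrite cabsM mulr_ile1 ?cabs_ge0.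
have Zn n : annihilated (fun x => f x * g x ^+ n).
  elim: n => [|n ihn]; first by under eq_fun do rewrite expr0 mulr1.
  under eq_fun do rewrite exprSr mulrA.
  exact: annihilated_half.
have [n gn] : exists n, cabs (g w) ^+ n <= d.
  have : (fun n => cabs (g w) ^+ n) @ \oo --> (0 : R).
    by apply: cvg_expr; rewrite ger0_norm ?cabs_ge0// half_cis_lt.
  move=> /cvgrPdist_le /(_ d d0) [n _ /(_ n (leqnn n))] /=.
  by rewrite sub0r normrN ger0_norm ?exprn_ge0 ?cabs_ge0// => H; exists n.
exists (fun x => f x * g x ^+ n); split => //.
  by rewrite f0 g0 expr1n mulr1.
move=> x; rewrite in_cons => /orP[/eqP ->|/fd H]; rewrite cabsM.
  by rewrite cabsX (le_trans _ gn)// ler_piMl ?exprn_ge0 ?cabs_ge0.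
by rewrite (le_trans _ H)// ler_piMr ?cabs_ge0.
Qed.

(* Trigonometric polynomials bounded by [1], equal to [1] at [w0] and small on a
   finite set carrying most of the mass of [D], isolate the coefficient [D w0]. *)
Lemma annihilated_eq0 (w0 : Om) : S w0 -> annihilated (fun=> 1) -> D w0 = 0.
Proof.
move=> S0 Z1; apply: contrapT => /eqP Dw0.
have e0 : 0 < cabs (D w0).
  rewrite lt_neqAle cabs_ge0 andbT eq_sym; apply: contra Dw0 => /eqP /cabs_eq0 ->//.
set e := cabs (D w0) in e0.
pose A := S `&` ~` [set w0].
have DA : csummable A D by apply: sub_csummable Dsum => w [].
pose T := (\esum_(w in A) (cabs (D w))%:E)%E.
have Tf : T \is a fin_num by rewrite esum_fin_num// => w _; rewrite lee_fin cabs_ge0.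
have T0 : 0 <= fine T by apply/fine_ge0/esum_ge0 => w _; rewrite lee_fin cabs_ge0.
(* Outside the finite set [F] and [w0] remains less than e/2 of the mass. *)
have /ereal_sup_gt[_ [F [finF FA] <-] FT] : ((fine T - e / 2)%:E < T)%E.
  by rewrite -[X in (_ < X)%E](fineK Tf) lte_fin ltrBlDr ltrDl divr_gt0.
have [s Fs] : exists s : seq Om, F = [set` s].
  by move/finite_seqP: finF.
(* The points of [F] then contribute at most e/4, so the sum off [w0] stays below 3e/4; the added 1
   keeps the divisor positive. *)
pose d := e / 4%:R / (fine T + 1).
have T1 : 0 < fine T + 1 by rewrite ltr_wpDl.
have d0 : 0 < d by rewrite !divr_gt0.
have sS w : w \in s -> S w /\ w <> w0.
  by move=> ws; have := FA w; rewrite Fs => /(_ ws)[].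
have [f [Zf f1 f0 fd]] := localizer S0 sS d0 Z1.
(* At frequency 0 the relation says that [D w0] is minus the sum over the other atoms, of modulus
   less than [e]. *)
have := Zf 0 (lattice0 _).
have sm : csummable S (fun w => D w * f w * cis (- dotv (pt w) 0)).
  apply: le_csummable Dsum => w _; rewrite !cabsM cabs_cis mulr1.
  by rewrite ler_piMr ?cabs_ge0.
rewrite (csumID [set w0] sm) setI1 mem_set// csum_set1 f0 mulr1.
have E0 : dotv (pt w0) 0 = 0 by rewrite dotvE !mxE !mulr0 addr0.
rewrite E0 oppr0 cis0 mulr1 -/A => /eqP; rewrite addr_eq0 => /eqP De.
have : (e%:E <= \esum_(w in A) (cabs (D w * f w * cis (- dotv (pt w) 0)))%:E)%E.
  by rewrite /e De cabsN; exact: csum_le.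
rewrite (esumID F); last by move=> w _; rewrite lee_fin cabs_ge0.
apply/negP; rewrite -ltNge.
have FE : (\esum_(w in F) (cabs (D w))%:E = \sum_(w \in F) (cabs (D w))%:E)%E.
  by rewrite esum_fset// => w _; rewrite lee_fin cabs_ge0.
have AF : A `&` F = F by rewrite setIC; exact/setIidPl.
have TE : T = (\esum_(w in F) (cabs (D w))%:E + \esum_(w in A `&` ~` F) (cabs (D w))%:E)%E.
  by rewrite /T (esumID F) ?AF// => w _; rewrite lee_fin cabs_ge0.
have Ff : (\esum_(w in F) (cabs (D w))%:E)%E \is a fin_num.
  apply: esum_fin_num; first by move=> w _; rewrite lee_fin cabs_ge0.
  by apply: sub_csummable Dsum => w /FA[].
have Rf : (\esum_(w in A `&` ~` F) (cabs (D w))%:E)%E \is a fin_num.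
  apply: esum_fin_num; first by move=> w _; rewrite lee_fin cabs_ge0.
  by apply: sub_csummable Dsum => w [[]].
have R0 : 0 <= fine (\esum_(w in A `&` ~` F) (cabs (D w))%:E)%E.
  by apply/fine_ge0/esum_ge0 => w _; rewrite lee_fin cabs_ge0.
have TE' : fine T = fine (\esum_(w in F) (cabs (D w))%:E)%E +
    fine (\esum_(w in A `&` ~` F) (cabs (D w))%:E)%E by rewrite TE fineD.
move: FT; rewrite -FE -(fineK Ff) lte_fin => FT.
have near_part : (\esum_(w in A `&` F) (cabs (D w * f w * cis (- dotv (pt w) 0)))%:E <=
    (d * fine T)%:E)%E.
  rewrite AF; apply: (@le_trans _ _ (d%:E * \esum_(w in F) (cabs (D w))%:E)%E).
    rewrite -esumZ ?(ltW d0)//; last by move=> w _; rewrite lee_fin cabs_ge0.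
    apply: le_esum => w Fw; rewrite -EFinM lee_fin !cabsM cabs_cis mulr1 mulrC.
    by rewrite ler_wpM2r ?cabs_ge0// fd//; move: Fw; rewrite Fs.
  rewrite [leRHS]EFinM lee_wpmul2l ?lee_fin ?(ltW d0)// -(fineK Ff) lee_fin.
  by rewrite TE' lerDl.
have far_part : (\esum_(w in A `&` ~` F) (cabs (D w * f w * cis (- dotv (pt w) 0)))%:E <=
    \esum_(w in A `&` ~` F) (cabs (D w))%:E)%E.
  apply: le_esum => w _; rewrite lee_fin !cabsM cabs_cis mulr1.
  by rewrite ler_piMr ?cabs_ge0.
apply: (le_lt_trans (leeD near_part far_part)).
rewrite -(fineK Rf) -EFinD lte_fin.
have dT : d * fine T <= e / 4%:R.
  by rewrite /d mulrAC ler_pdivrMr// ler_wpM2l ?divr_ge0 ?(ltW e0)// lerDl.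
move: FT TE' dT e0; move: (fine _) (fine _) (fine _) (d * _) => x y z u; lra.
Qed.

End RowUniqueness.

Lemma row_unique (R : realType) (theta : 'I_3 -> R) (q : 'cV[R]_2)
    (D : Omega theta -> R[i]) : incommensurate (dual_lat theta) ->
  (forall psi, chi theta psi ->
    csummable setT (fun w => D w * unfolding theta q psi w) /\
    csum setT (fun w => D w * unfolding theta q psi w) = 0) ->
  forall w, D w = 0.
Proof.
move=> incomm H w0; pose k := layer w0; pose b := orbital w0.
pose S : set (Omega theta) := @component R theta @^-1` [set (k, b)].
pose pt (w : Omega theta) := q + \sum_t momentum w t.
(* The orbital shift in the plane waves is absorbed into the masses, with unchanged moduli, so that
   only lattice frequencies remain. *)
pose D2 w := D w * cis (- dotv (pt w) (orb_shift theta k b)).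
have uS v w : S w -> D w * unfolding theta q (character_state theta k b v) w =
    D2 w * 1 * cis (- dotv (pt w) v).
  move=> [lw bw]; rewrite /unfolding /character_state lw bw !eqxx /= -/(pt w).
  by rewrite mulr1 /D2 -mulrA -cisD; congr (_ * cis _); rewrite dotvDr; ring.
have uN v w : ~ S w -> D w * unfolding theta q (character_state theta k b v) w = 0.
  move=> nS; rewrite /unfolding /character_state; case: ifP => [/andP[/eqP lw /eqP bw]|_].
    by case: nS; rewrite /S /= /component lw bw.
  by rewrite mulr0.
have D2s : csummable S D2.
  have [sm _] := H _ (character_state_chi b (lattice0 (rotation (theta k) *m untwisted_basis))).
  apply: le_csummable (sub_csummable (@subsetT _ S) sm) => w Sw.
  by rewrite uS// mulr1 cabsM cabs_cis mulr1.
have Z1 : annihilated q k b D2 (fun=> 1).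
  move=> v lv; have [_ <-] := H _ (character_state_chi b lv).
  rewrite -(csum_support (A := S) (B := setT))//; last by move=> w _; exact: uN.
  by apply: eq_csum => w Sw; rewrite uS.
have : D2 w0 = 0 by exact: (annihilated_eq0 incomm D2s (erefl _) Z1).
move=> /(congr1 (@cabs R)); rewrite cabsM cabs_cis mulr1 cabs0.
exact: cabs_eq0.
Qed.

(** * The reciprocal Hamiltonian as an operator and its matrix *)

Theorem proposition3p2 (R : realType) (theta : 'I_3 -> R)
    (hin : 'I_3 -> bool -> bool -> 'cV[R]_2 -> R[i])
    (hout : 'I_3 -> 'I_3 -> bool -> bool -> 'cV[R]_2 -> R[i]) :
  double_incommensurate theta ->
  hoppings_continuous hout ->
  hoppings_decay theta hin hout ->
  hoppings_symmetric theta hin hout ->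
  no_outer_hopping hout ->
  (forall psi, chi theta psi -> chi theta (mom_ham theta hin hout psi)) /\
  forall q : 'cV[R]_2,
    unfolded_space theta q `<=` @linf R (Omega theta) /\
    exists Hq : (Omega theta -> R[i]) -> (Omega theta -> R[i]),
      [/\ bounded_linear_on (unfolded_space theta q) Hq,
          forall psi, chi theta psi -> forall w : Omega theta,
            unfolding theta q (mom_ham theta hin hout psi) w
            = Hq (unfolding theta q psi) w &
          forall M : Omega theta -> Omega theta -> R[i],
            matrix_of_on (unfolded_space theta q) Hq M <->
            forall w w', M w w' = reciprocal_entry theta hin hout q w w'].
Proof.
move=> [_ incomm] hout_cont decay _ _.
split=> [psi|q]; first exact: mom_ham_chi.
pose E := reciprocal_entry theta hin hout q.
(* Defining the operator by its rows, without inverting the unfolding, gives linearity and the bound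
   directly; invariance of the unfolded space is read off the intertwining relation. *)
pose Hq (u : Omega theta -> R[i]) w := csum setT (fun w' => E w w' * u w').
have HqE psi : chi theta psi ->
    Hq (unfolding theta q psi) = unfolding theta q (mom_ham theta hin hout psi).
  by move=> cpsi; apply/funext => w; rewrite (intertwining decay _ _ cpsi).
have bound u : unfolded_space theta q u -> exists2 B : R, 0 <= B & forall w, cabs (u w) <= B.
  by move=> [psi cpsi <-]; exact: unfolding_bounded.
split=> [u /bound[B B0 uB]|].
  apply: (@le_lt_trans _ _ B%:E); last exact: ltry.
  by apply: ge_ereal_sup => _ [w _ <-]; rewrite lee_fin.
have rs u w : unfolded_space theta q u -> csummable setT (fun w' => E w w' * u w').
  by move=> /bound[B B0 uB]; exact: row_summable uB.
exists Hq; split.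
- split.
  + by move=> _ [psi cpsi <-]; rewrite HqE//; exists (mom_ham theta hin hout psi) => //; exact: mom_ham_chi.
  + move=> a u v Vu Vv w; rewrite /Hq -csumZ; last exact: rs.
    rewrite -csumD; [|exact/csummableZ/rs|exact: rs].
    by apply: eq_csum => w' _; rewrite mulrDr mulrCA.
  + have [K K0 HK] := row_bound decay q.
    exists K => u Vu; apply: ge_ereal_sup => _ [w _ <-].
    have [B B0 uB] := bound u Vu.
    have uS w' : ((cabs (u w'))%:E <= sup_norm u)%E by apply: ereal_sup_ubound; exists w'.
    have Sf : (sup_norm u) \is a fin_num.
      rewrite ge0_fin_numE; last by apply: le_trans (uS w); rewrite lee_fin cabs_ge0.
      apply: (@le_lt_trans _ _ B%:E); last exact: ltry.
      by apply: ge_ereal_sup => _ [w' _ <-]; rewrite lee_fin.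
    rewrite -(fineK Sf) in uS *; set b := fine _ in uS *.
    have b0 : 0 <= b by rewrite -lee_fin; apply: le_trans (uS w); rewrite lee_fin cabs_ge0.
    apply: (le_trans (csum_le _ _)).
    rewrite muleC; apply: le_trans (lee_wpmul2l _ (HK w)); last by rewrite lee_fin.
    rewrite -esumZ//; last by move=> w' _; rewrite lee_fin cabs_ge0.
    apply: le_esum => w' _; rewrite -EFinM lee_fin cabsM mulrC ler_wpM2r ?cabs_ge0//.
    by rewrite -lee_fin.
- by move=> psi cpsi w; rewrite HqE.
- move=> M; split=> [HM w w'|ME].
    apply/eqP; rewrite -subr_eq0; apply/eqP.
    (* Both rows represent [Hq] at [w] by absolutely convergent sums, so their difference
       annihilates every unfolded state. *)
    apply: (row_unique (q := q) (D := fun w' => M w w' - E w w') incomm) => psi cpsi.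
    have Vu : unfolded_space theta q (unfolding theta q psi) by exists psi.
    have [Ms Meq] := HM _ Vu w; have Es := rs _ w Vu.
    have -> : (fun w' => (M w w' - E w w') * unfolding theta q psi w') =
      (fun w' => M w w' * unfolding theta q psi w' - E w w' * unfolding theta q psi w').
      by apply/funext => x; rewrite mulrBl.
    split; first exact: csummableB.
    by rewrite csumB// -Meq /Hq subrr.
  have -> : M = E by apply/funext => w; apply/funext => w'; exact: ME.
  by move=> u Vu w; split; first exact: rs.
Qed.
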